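(* Let $X\subset N_{\mathbb R}$ be a one-dimensional balanced polyhedral space and let $\gamma\in\mathrm{PAPC}(X)$ be positive at infinity. For any $\phi\in\mathrm{PC}(X,\gamma)\cap\mathrm{PS}(X)$ the equality of measures $$\mathrm{MA}_{\mathrm{poly}}(\phi)=\Delta\phi$$ holds.
   Context: Polyhedral spaces. $N$ is a lattice (free abelian group of finite rank), $M=\mathrm{Hom}(N,\mathbb Z)$, $N_R=N\otimes R$. A rational polyhedron in $N_{\mathbb R}$ is a subset defined by finitely many conditions $f(n)+b=0$ or $f(n)+b\ge 0$ with $f\in M$, $b\in\mathbb Z$. For a polyhedron $\sigma$: $N_{\sigma,\mathbb R}$ is the linear span of all $x-y$, $x,y\in\sigma$; $N_\sigma=N_{\sigma,\mathbb R}\cap N$; $M_\sigma$ is the dual lattice; $\mathrm{rec}(\sigma)=\{v: x+tv\in\sigma\ \forall x\in\sigma,t\ge0\}$. A rational polyhedral complex $\Pi$ is a finite collection of rational polyhedra (its faces), closed under taking faces, two of which meet in the empty set or in a common face; $|\Pi|$ is its support, $\Pi^{(k)}$ its set of $k$-dimensional faces, $\tau\prec\sigma$ means $\tau$ is a face of $\sigma$. A one-dimensional polyhedral space is a set $X=|\Pi|$ where all inclusion-maximal faces of $\Pi$ have dimension $1$; any rational polyhedral complex with support $X$ is called a polyhedral structure on $X$. Balancing. For an edge $e\in\Pi^{(1)}$ adjacent to a vertex $v\in\Pi^{(0)}$, $n_{e/v}\in N_e$ is the primitive vector pointing from $v$ into $e$. A balanced one-dimensional polyhedral space carries weights $[X](e)\in\mathbb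 Q_{>0}$ on the edges of some polyhedral structure (transported to refinements by restriction) with $\sum_{e\succ v}[X](e)n_{e/v}=0$ at each vertex $v$. Functions. A continuous $\phi:X\to\mathbb R$ is piecewise affine on $\Pi$ if on each $\sigma\in\Pi$ it is the restriction of an affine function with linear part $\phi_\sigma\in M_\sigma\otimes\mathbb Q$ and rational constant term; $\mathrm{PA}(\Pi)$ is the set of these, $\mathrm{PA}(X)=\bigcup_\Pi\mathrm{PA}(\Pi)$. $\gamma\in\mathrm{PA}(\Pi)$ is positive at infinity if $\gamma_\sigma(v)>0$ for every $\sigma\in\Pi$ and non-zero $v\in\mathrm{rec}(\sigma)$. A polyhedral convex combination in $X$ is a triple $(x,(x_i)_{i\in I},(\alpha_i)_{i\in I})$ with $I$ finite, $x_i\in X\cap N_{\mathbb Q}$, $\alpha_i\in[0,1]$, $\sum\alpha_i=1$, $x=\sum\alpha_ix_i\in X$, such that for some polyhedral structure $\Pi$ there are faces $\tau,\sigma_i\in\Pi$ with $x\in\tau$, $x_i\in\sigma_i$, and $\tau$ a (not necessarily proper) face of every $\sigma_i$. $\mathrm{PC}(X)$ is the set of continuous $\phi:X\to\mathbb R$ with $\phi(x)\le\sum\alpha_i\phi(x_i)$ for all such combinations; $\mathrm{PAPC}(X)=\mathrm{PA}(X)\cap\mathrm{PC}(X)$; $\mathrm{PC}(X,\gamma)$ and $\mathrm{PAPC}(X,\gamma)$ are the subsets of $\phi$ with $\phi-\gamma$ bounded. Monge--Ampère in dimension one. For $\phi\in\mathrm{PA}(\Pi)$, with $[X]$ defined on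 $\Pi$, $\mathrm{MA}_{\mathrm{poly}}(\phi)=\sum_{v\in\Pi^{(0)}}\Big(\sum_{e\succ v}[X](e)\phi_e(n_{e/v})\Big)\delta_v$. In dimension one every $\phi\in\mathrm{PC}(X,\gamma)$ is a uniform limit of functions in $\mathrm{PAPC}(X,\gamma)$, and $\mathrm{MA}_{\mathrm{poly}}(\phi)$ is the positive Radon measure on $X$ that is the weak limit of $\mathrm{MA}_{\mathrm{poly}}(\phi_j)$ for any sequence $\phi_j\in\mathrm{PAPC}(X,\gamma)$ converging uniformly to $\phi$ (it exists and is independent of choices). Laplacian. Each edge $e$ carries an integral affine coordinate $t_e$ (unique up to sign and translation, so that $N_e\cong\mathbb Z$), and $d\ell_e=dt_e$, $d\lambda_{|e}=[X](e)\,d\ell_e$. $\mathrm{PS}(X)$ is the set of continuous $f:X\to\mathbb R$ for which there is a polyhedral structure $\Pi$ with $f_{|e}$ of class $\mathcal C^2$ for all $e\in\Pi^{(1)}$ (then $f$ is defined on $\Pi$; also take $[X]$ defined on $\Pi$). Put $f''_{|e}=d^2f_{|e}/dt_e^2$ and, for $v\prec e$, $s_{e/v}(f)=\frac{d}{dt}\big|_{t=0^+}f(v+tn_{e/v})$. Then $$\Delta f=\sum_{e\in\Pi^{(1)}}f''_{|e}\,d\lambda_{|e}+\sum_{v\in\Pi^{(0)}}\sum_{e\succ v}[X](e)\,s_{e/v}(f)\,\delta_v .$$ *)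

(* Defs.v *)
From HB Require Import structures.
From mathcomp Require Import all_boot all_order all_algebra.
From mathcomp Require Import all_classical all_reals all_analysis.

Set Implicit Arguments.
Unset Strict Implicit.
Unset Printing Implicit Defensive.

Import Order.TTheory GRing.Theory Num.Theory.
Import numFieldNormedType.Exports.

Local Open Scope classical_set_scope.
Local Open Scope ring_scope.

(* The lattice is N = Z^n, so that N_R is 'rV[R]_n, N (resp. N_Q) is the set of
   vectors with integral (resp. rational) coordinates, and M, M_Q are identified
   with 'rV[int]_n, 'rV[rat]_n through the standard pairing.
   Functions on a subset X of N_R are functions on N_R of which only the values
   on X are ever used. *)

Section Polyhedra.
Variables (R : realType) (n : nat).
Local Notation V := 'rV[R]_n.
Implicit Types (sigma tau e : set V) (Pi : set (set V)).

Definition pairing (m x : V) : R := \sum_(i < n) m 0 i * x 0 i.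

Definition lattice : set V := [set x | exists z : 'rV[int]_n, x = map_mx intr z].

Definition rational_points : set V :=
  [set x | exists q : 'rV[rat]_n, x = map_mx ratr q].

Definition int_affine (c : 'rV[int]_n * int) (x : V) : R :=
  pairing (map_mx intr c.1) x + c.2%:~R.

Definition rational_polyhedron sigma :=
  exists Eqs Ineqs : seq ('rV[int]_n * int),
    sigma = [set x | (forall c, c \in Eqs -> int_affine c x = 0) /\
                     (forall c, c \in Ineqs -> 0 <= int_affine c x)].

(* Faces are nonempty, and [m = 0], [c = 0] gives [sigma] itself. *)
Definition face tau sigma :=
  tau !=set0 /\
  exists (m : V) (c : R),
    (forall x, sigma x -> 0 <= pairing m x + c) /\
    tau = sigma `&` [set x | pairing m x + c = 0].

Definition lin_span sigma : set V :=
  [set v | exists2 s : seq V,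
     (forall z, z \in s -> exists x y, [/\ sigma x, sigma y & z = x - y]) &
     v \in << s >>%VS].

Definition has_dim sigma (k : nat) :=
  exists2 W : {vspace V}, \dim W = k & [set v | v \in W] = lin_span sigma.

Definition rec_cone sigma : set V :=
  [set v | forall x t, sigma x -> 0 <= t -> sigma (x + t *: v)].

Definition polyhedral_complex Pi :=
  [/\ finite_set Pi,
      forall sigma, Pi sigma -> rational_polyhedron sigma /\ sigma !=set0,
      forall sigma tau, Pi sigma -> face tau sigma -> Pi tau &
      forall sigma tau, Pi sigma -> Pi tau ->
        sigma `&` tau = set0 \/
        (face (sigma `&` tau) sigma /\ face (sigma `&` tau) tau)].

Definition support Pi : set V := \bigcup_(sigma in Pi) sigma.

Definition polyhedral_structure (X : set V) Pi :=
  polyhedral_complex Pi /\ support Pi = X.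

Definition edges Pi : set (set V) := [set e | Pi e /\ has_dim e 1].

Definition vertices Pi : set V := [set v | Pi [set v]].

Definition star Pi (v : V) : set (set V) :=
  [set e | edges Pi e /\ face [set v] e].

Definition one_dim_polyhedral_space (X : set V) :=
  exists2 Pi, polyhedral_structure X Pi &
    forall sigma, Pi sigma ->
      (forall tau, Pi tau -> sigma `<=` tau -> tau = sigma) -> has_dim sigma 1.

Definition refines Pi' Pi :=
  forall sigma', Pi' sigma' -> exists2 sigma, Pi sigma & sigma' `<=` sigma.

Definition local_lattice sigma : set V := lin_span sigma `&` lattice.

(* [k = 0] in the last condition shows that [u] is nonzero. *)
Definition primitive_vector sigma (u : V) :=
  local_lattice sigma u /\
  forall (k : int) (u' : V), local_lattice sigma u' -> u = k%:~R *: u' ->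
    k = 1 \/ k = -1.

(* The vector n_{e/v}. *)
Definition primitive_at e (v : V) : V :=
  get [set u | primitive_vector e u /\
               exists2 eps : R, 0 < eps & e (v + eps *: u)].

Record balanced_space := BalancedSpace {
  bs_carrier :> set V;
  bs_structure : set (set V);
  bs_weight : set V -> rat;
  _ : one_dim_polyhedral_space bs_carrier;
  _ : polyhedral_structure bs_carrier bs_structure;
  _ : forall e, edges bs_structure e -> 0 < bs_weight e;
  _ : forall v, vertices bs_structure v ->
        \sum_(e \in star bs_structure v)
           (ratr (bs_weight e) : R) *: primitive_at e v = 0 }.

(* [X] is defined on the structures refining [bs_structure X]; the weight of an
   edge of such a structure is that of the original edge containing it. *)
Definition weight (X : balanced_space) e : R :=
  ratr (bs_weight X (get [set e0 | edges (bs_structure X) e0 /\ e `<=` e0])).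

Definition weighted_structure (X : balanced_space) Pi :=
  polyhedral_structure X Pi /\ refines Pi (bs_structure X).

End Polyhedra.

Section Functions.
Variables (R : realType) (n : nat).
Local Notation V := 'rV[R]_n.
Implicit Types (phi gamma f : V -> R) (sigma e : set V) (Pi : set (set V)).

(* Since N / N_sigma is torsion free, M_Q -> M_sigma (x) Q is onto: the linear
   part of a rational affine function on [sigma] lifts to M_Q. *)
Definition affine_on sigma phi (mc : 'rV[rat]_n * rat) :=
  forall x, sigma x -> phi x = pairing (map_mx ratr mc.1) x + ratr mc.2.

(* phi_sigma; the value does not depend on the choices for [v] in the span of
   the differences of points of [sigma]. *)
Definition linear_part phi sigma (v : V) : R :=
  pairing (map_mx ratr (get [set mc | affine_on sigma phi mc]).1) v.

Definition PA_on (X : set V) Pi phi :=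
  {within X, continuous phi} /\
  forall sigma, Pi sigma -> exists mc, affine_on sigma phi mc.

Definition PA (X : set V) : set (V -> R) :=
  [set phi | exists2 Pi, polyhedral_structure X Pi & PA_on X Pi phi].

Definition positive_at_infinity (X : set V) gamma :=
  exists Pi, [/\ polyhedral_structure X Pi, PA_on X Pi gamma &
    forall sigma v, Pi sigma -> rec_cone sigma v -> v != 0 ->
      0 < linear_part gamma sigma v].

Definition polyhedral_convex_combination (X : set V) (x : V)
    (k : nat) (xs : 'I_k -> V) (alpha : 'I_k -> R) :=
  [/\ forall i, X (xs i) /\ rational_points (xs i),
      forall i, 0 <= alpha i <= 1,
      \sum_i alpha i = 1,
      x = \sum_i alpha i *: xs i /\ X x &
      exists Pi tau (sigma : 'I_k -> set V),
        [/\ polyhedral_structure X Pi, Pi tau, tau x &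
            forall i, [/\ Pi (sigma i), sigma i (xs i) & face tau (sigma i)]]].

Definition PC (X : set V) : set (V -> R) :=
  [set phi | {within X, continuous phi} /\
     forall x (k : nat) (xs : 'I_k -> V) (alpha : 'I_k -> R),
       polyhedral_convex_combination X x xs alpha ->
       phi x <= \sum_i alpha i * phi (xs i)].

Definition PAPC (X : set V) : set (V -> R) := PA X `&` PC X.

Definition bounded_difference (X : set V) gamma : set (V -> R) :=
  [set phi | exists C : R, forall x, X x -> `|phi x - gamma x| <= C].

Definition PC_growth (X : set V) gamma := PC X `&` bounded_difference X gamma.

Definition PAPC_growth (X : set V) gamma :=
  PAPC X `&` bounded_difference X gamma.

End Functions.

Notation borelV R n := (g_sigma_algebraType (@open 'rV[R]_n)).

Section MongeAmpere.
Variables (R : realType) (n : nat).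
Local Notation V := 'rV[R]_n.
Implicit Types (phi gamma f : V -> R) (Pi : set (set V)).

(* The mass at the vertex [v] of MA_poly(phi), for phi in PA(Pi). *)
Definition MA_mass (X : balanced_space R n) Pi phi (v : V) : R :=
  \sum_(e \in star Pi v) weight X e * linear_part phi e (primitive_at e v).

(* The integral of [f] against the finite signed measure MA_poly(phi), for a
   piecewise affine phi; the choice of the structure is immaterial. *)
Definition MA_PA_integral (X : balanced_space R n) phi f : R :=
  let Pi := get [set Pi | weighted_structure X Pi /\ PA_on X Pi phi] in
  \sum_(v \in vertices Pi) MA_mass X Pi phi v * f v.

Definition compactly_supported (X : set V) f :=
  {within X, continuous f} /\
  exists K : set V, [/\ compact K, K `<=` X &
    forall x, X x -> ~ K x -> f x = 0].

(* Positive Radon measures on X are the Borel measures of N_R that are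
   concentrated on X and finite on compact sets (regularity is automatic). *)
Definition radon_on (X : set V) (mu : {measure set (borelV R n) -> \bar R}) :=
  mu (~` X) = 0%E /\
  forall K : set V, compact K -> K `<=` X -> (mu K < +oo)%E.

(* [mu] is the weak limit of the measures MA_poly(phi_j), for the duality with
   compactly supported continuous functions on X. *)
Definition weak_limit_MA (X : balanced_space R n) (psi : nat -> V -> R)
    (mu : {measure set (borelV R n) -> \bar R}) :=
  forall f, compactly_supported X f ->
    (fun j => MA_PA_integral X (psi j) f) @ \oo
      --> Rintegral mu (X : set (borelV R n)) f.

Definition approximates (X : set V) gamma phi (psi : nat -> V -> R) :=
  (forall j, PAPC_growth X gamma (psi j)) /\
  {uniform X, psi @ \oo --> phi}.

Definition is_MA_poly (X : balanced_space R n) gamma phi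
    (mu : {measure set (borelV R n) -> \bar R}) :=
  [/\ radon_on X mu,
      exists psi, approximates X gamma phi psi &
      forall psi, approximates X gamma phi psi -> weak_limit_MA X psi mu].

Definition MA_poly (X : balanced_space R n) gamma phi :
    {measure set (borelV R n) -> \bar R} :=
  if pselect (exists mu, is_MA_poly X gamma phi mu) is left mu_MA
  then sval (cid mu_MA) else mzero.

End MongeAmpere.

Section Laplacian.
Variables (R : realType) (n : nat).
Local Notation V := 'rV[R]_n.
Implicit Types (f : V -> R) (e : set V) (Pi : set (set V)).

(* A point of [e] and a primitive vector of N_e: the inverse of an integral
   affine coordinate on [e] is [t |-> p + t *: u]. *)
Definition edge_frame e : V * V :=
  get [set pu | e pu.1 /\ primitive_vector e pu.2].

Definition edge_point e (t : R) : V :=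
  (edge_frame e).1 + t *: (edge_frame e).2.

(* C^2 up to the endpoints of the closed edge [e]. *)
Definition C2_on_edge e f :=
  exists g : R -> R,
    [/\ forall t, derivable g t 1,
        forall t, derivable (derive1 g) t 1,
        continuous (derive1n 2 g) &
        forall t, e (edge_point e t) -> f (edge_point e t) = g t].

Definition PS (X : set V) : set (V -> R) :=
  [set f | {within X, continuous f} /\
     exists2 Pi, polyhedral_structure X Pi &
       forall e, edges Pi e -> C2_on_edge e f].

(* The slope s_{e/v}(f). *)
Definition slope_at e (v : V) f : R :=
  lim (t^-1 * (f (v + t *: primitive_at e v) - f v) @[t --> 0^'+]).

(* The measure of [A] under f''|_e d lambda|_e. The integral is taken over the
   interior of the edge: its endpoints are negligible, and the two-sided
   derivative is meaningful only there. *)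
Definition edge_measure (X : balanced_space R n) f e (A : set V) : \bar R :=
  ((weight X e)%:E *
   \int[@lebesgue_measure R]_(t in (edge_point e @^-1` e)° `&`
                                   (edge_point e @^-1` A))
     (derive1n 2 (f \o edge_point e) t)%:E)%E.

Definition laplacian_on (X : balanced_space R n) Pi f (A : set V) : \bar R :=
  (\sum_(e \in edges Pi) edge_measure X f e A +
   \sum_(v \in vertices Pi)
      (\sum_(e \in star Pi v) weight X e * slope_at e v f)%R%:E *
      @dirac _ (borelV R n) v R A)%E.

(* In general this is a signed Radon measure, to be evaluated on relatively
   compact Borel sets; if it is positive, it is a measure on all Borel sets. *)
Definition laplacian (X : balanced_space R n) f : set V -> \bar R :=
  laplacian_on X
    (get [set Pi | weighted_structure X Pi /\
                   forall e, edges Pi e -> C2_on_edge e f]) f.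

End Laplacian.

(* Main.v *)
From HB Require Import structures.
Require Import Defs.
From mathcomp Require Import all_boot all_order all_algebra finmap.
From mathcomp Require Import all_classical all_reals all_analysis measurable_realfun.
From mathcomp Require Import ring lra zify.

Set Implicit Arguments.
Unset Strict Implicit.
Unset Printing Implicit Defensive.

Import Order.TTheory GRing.Theory Num.Theory.
Import numFieldNormedType.Exports.

(** Both sides are one and the same Radon measure, because they have the same integrals
    against piecewise affine functions of compact support.

    For a function $f$ on $X$ with one-sided slopes let $m_f(x)$ be the weighted sum of the
    slopes of $f$ in the directions in which $X$ leaves $x$ ([mass]). For a piecewise affine
    $\psi$, the Monge-Ampere measure $MA(\psi)$ has mass $m_\psi(v)$ at the vertex $v$;
    for a piecewise $C^2$ function $\phi$, the numbers $m_\phi(v)$ are the atoms of $\Delta\phi$.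
    Let $f$ be piecewise affine of compact support. Partial summation on the edges gives
    $\int f\,MA(\psi) = \sum_v m_f(v) \psi(v)$ ([green_affine]), and
    integration by parts on the edges gives $\int f\,\Delta\phi = \sum_v m_f(v) \phi(v)$
    ([integral_PL]). If $\psi_j$ converges to $\phi$, then the first sum, for $\psi = \psi_j$,
    converges to the second.

    This extends to all continuous $f$ of compact support, since both measures are positive:
    such an $f \ge 0$ lies between a test function and the same test function plus a small
    multiple of a fixed cutoff ([PL_sandwich]). Positivity holds for $\psi_j$ because balancing
    turns the weighted sum of the increments at a vertex into a polyhedral convex combination
    ([mass_ge0]), and for $\Delta\phi$ for this reason and because $\phi$ is convex on
    edges, so that $\phi'' \ge 0$ ([laplacian_measure]). Hence $\Delta\phi$ is the weak limit
    of $MA(\psi_j)$ ([weak_limit]).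

    A Radon measure on $X$ is determined by its integrals against continuous functions of
    compact support ([radon_unique]). So it remains to find some sequence $\psi_j$, which is part
    of the property that characterizes $MA(\phi)$. On a fine structure,
    $\psi$ is to have rational values at the vertices, close to those of $\phi$, and the slopes of
    $\gamma$ on the rays. For $\psi$ to be polyhedrally convex it suffices that at each vertex some
    linear form supports $\psi$ on the adjacent edges ([support_PC]). For the values of $\phi$
    itself such forms exist by Farkas' lemma, whose hypothesis is the polyhedral convexity of
    $\phi$; on a ray the slope of $\gamma$ is large enough, since $\phi - \gamma$ is convex and
    bounded there, hence nonincreasing. Values and forms together solve a finite system of
    rational linear inequalities, and rational solutions of such a system are dense
    ([rational_polyhedron_dense], [PAPC_approximation]). *)

Local Open Scope classical_set_scope.
Local Open Scope ring_scope.

(** * Density of rational solutions of rational linear inequalities *)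

Lemma exists_small (R : realType) (I : finType) (c : I -> R) (e : R) : 0 < e ->
  exists2 d, 0 < d & forall i, d * c i < e.
Proof.
move=> e0; pose C := 1 + \sum_i `|c i|.
have C0 : 0 < C by rewrite ltr_pwDl// sumr_ge0.
exists (e / (2 * C)); first by rewrite divr_gt0// mulr_gt0.
move=> i; have ci : c i <= C.
  rewrite (le_trans (ler_norm _))// /C (bigD1 i)//= addrCA lerDl addr_ge0//.
  exact: sumr_ge0.
rewrite (@le_lt_trans _ _ (e / (2 * C) * C))//.
  by rewrite ler_wpM2l// ltW// divr_gt0// mulr_gt0.
rewrite invfM mulrA mulfVK ?gt_eqF// ltr_pdivrMr// ltr_pMr// ltr1n//.
Qed.

Lemma exists_rat_near (R : realType) (x e : R) : 0 < e ->
  exists q : rat, `|ratr q - x| < e.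
Proof.
move=> e0; have : x - e < x + e by lra.
move=> /rat_in_itvoo[q]; rewrite in_itv/= => /andP[h1 h2].
by exists q; rewrite ltr_norml; lra.
Qed.

(** The kernel of a rational matrix has a rational basis; rounding the coordinates of a real
    vector in this basis stays in the kernel. *)
Lemma rational_kernel_dense (R : realType) (N k : nat) (B : 'M[rat]_(N, k))
    (y : 'rV[R]_N) (e : R) : 0 < e -> y *m map_mx ratr B = 0 ->
  exists2 q : 'rV[rat]_N, q *m B = 0 & forall i, `|ratr (q 0 i) - y 0 i| < e.
Proof.
move=> e0 /sub_kermxP; rewrite -map_kermx => /submxP[w yE].
pose K := kermx B; pose c (i : 'I_N) : R := \sum_l `|ratr (K l i)|.
have [d d0 dc] := exists_small c e0.
pose w' := \row_l projT1 (cid (exists_rat_near (w 0 l) d0)).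
have w'P l : `|ratr (w' 0 l) - w 0 l| < d.
  by rewrite mxE; case: cid.
exists (w' *m K); first by rewrite -mulmxA mulmx_ker mulmx0.
move=> i; rewrite yE !mxE rmorph_sum/= -sumrB.
apply: le_lt_trans (dc i); rewrite mulr_sumr (le_trans (ler_norm_sum _ _ _))//.
apply: ler_sum => l _; rewrite !mxE rmorphM/= -mulrBl normrM ler_wpM2r//.
by have := w'P l; rewrite mxE => /ltW.
Qed.

(** The inequalities that are equalities at [y] are kept as equations, which
    [rational_kernel_dense] respects; the strict ones survive a small perturbation. *)
Lemma rational_cone_dense (R : realType) (N k : nat) (A : 'M[rat]_(N, k))
    (y : 'rV[R]_N) (e : R) : 0 < e ->
  (forall j, 0 <= (y *m map_mx ratr A) 0 j) ->
  exists2 q : 'rV[rat]_N, forall j, 0 <= (q *m A) 0 j &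
     forall i, `|ratr (q 0 i) - y 0 i| < e.
Proof.
move=> e0 yA.
pose B := \matrix_(i, j) (if (y *m map_mx ratr A) 0 j == 0 then A i j else 0).
have yB : y *m map_mx ratr B = 0.
  apply/rowP => j; rewrite !mxE.
  have [h|h] := eqVneq ((y *m map_mx ratr A) 0 j) 0.
    rewrite -[RHS]h mxE; apply: eq_bigr => i _.
    by rewrite [map_mx _ B _ _]mxE [B _ _]mxE h eqxx mxE.
  rewrite big1// => i _.
  by rewrite [map_mx _ B _ _]mxE [B _ _]mxE (negPf h) rmorph0 mulr0.
pose J := {j : 'I_k | (y *m map_mx ratr A) 0 j != 0}.
have [d1 d10 d1c] : exists2 d, 0 < d & forall j : J,
    d * (\sum_i `|ratr (A i (val j))|) < (y *m map_mx ratr A) 0 (val j).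
  have J0 (j : J) : 0 < (y *m map_mx ratr A) 0 (val j).
    by rewrite lt_neqAle yA eq_sym (valP j).
  have [d d0 dc] := exists_small (fun j : J =>
    (\sum_i `|ratr (A i (val j))|) / (y *m map_mx ratr A) 0 (val j)) (@ltr01 R).
  by exists d => // j; rewrite -[ltRHS]mul1r -ltr_pdivrMr// -mulrA.
have ed0 : 0 < Num.min e d1 by rewrite lt_min e0.
have [q qB qy] := rational_kernel_dense ed0 yB.
exists q; last by move=> i; rewrite (lt_le_trans (qy i))// ge_min lexx.
move=> j; have [h|h] := eqVneq ((y *m map_mx ratr A) 0 j) 0.
  rewrite (_ : (q *m A) 0 j = (q *m B) 0 j); first by rewrite qB mxE.
  rewrite [LHS]mxE [RHS]mxE; by apply: eq_bigr => i _; rewrite [B _ _]mxE h eqxx.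
rewrite -(ler0q R).
have {}d1c := d1c (exist _ j h); rewrite /= in d1c.
suff : `|ratr ((q *m A) 0 j) - (y *m map_mx ratr A) 0 j| <=
    d1 * (\sum_i `|ratr (A i j)|).
  by rewrite ler_norml => /andP[+ _]; move: d1c; lra.
rewrite !mxE rmorph_sum -sumrB mulr_sumr (le_trans (ler_norm_sum _ _ _))//.
apply: ler_sum => i _; rewrite !mxE rmorphM/= -mulrBl normrM ler_wpM2r//.
by rewrite ltW// (lt_le_trans (qy i))// ge_min lexx orbT.
Qed.

Definition rat_affine (R : realType) (I : finType) (c : {ffun I -> rat} * rat)
  (y : I -> R) : R := \sum_i ratr (c.1 i) * y i + ratr c.2.

(** The inhomogeneous case is homogenized: an additional coordinate, equal to $1$ at [y],
    multiplies the constant terms, and one divides by its perturbed value in the end. *)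
Lemma rational_polyhedron_dense (R : realType) (I : finType)
    (cs : seq ({ffun I -> rat} * rat)) (y : I -> R) (e : R) : 0 < e ->
  (forall c, c \in cs -> 0 <= rat_affine c y) ->
  exists2 q : I -> rat, forall c, c \in cs -> 0 <= rat_affine c (ratr \o q : I -> R) &
     forall i, `|ratr (q i) - y i| < e.
Proof.
move=> e0 ycs.
pose N := #|{: option I}|; pose c0 : {ffun I -> rat} * rat := ([ffun=> 0], 0).
pose c_ (j : 'I_(size cs)) := nth c0 cs j.
pose coef (c : {ffun I -> rat} * rat) (o : option I) :=
  if o is Some i then c.1 i else c.2.
pose A := \matrix_(i < N, j < size cs) coef (c_ j) (enum_val i).
pose Y : 'rV[R]_N := \row_i (if enum_val i is Some i then y i else 1).
have sumo (T : nmodType) (F : option I -> T) : \sum_(o < N) F (enum_val o) =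
    \sum_i F (Some i) + F None.
  rewrite -(@big_enum_val _ _ _ _ predT F)/= (bigD1 None)//= addrC.
  congr (_ + _); rewrite (reindex_omap Some id)/=; last by case.
  by apply: eq_bigl => i; rewrite eqxx.
have YA j : (Y *m map_mx ratr A) 0 j = rat_affine (c_ j) y.
  rewrite mxE /rat_affine -[ratr (c_ j).2]mulr1.
  rewrite -(sumo _ (fun o => ratr (coef (c_ j) o) * (if o is Some i then y i else 1))).
  by apply: eq_bigr => o _; rewrite !mxE mulrC.
pose C := 1 + \sum_i `|y i|.
have yC i : 1 + `|y i| <= C.
  rewrite /C (bigD1 i)//= lerD2l lerDl; exact: sumr_ge0.
have C0 : 0 < C by rewrite ltr_pwDl// sumr_ge0.
(* The first bound keeps the homogenizing coordinate above $1/2$; the second one makes up for the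
   division by it. *)
pose d := Num.min (2^-1) (e / (2 * C)).
have d0 : 0 < d by rewrite lt_min invr_gt0 ltr0n/= divr_gt0// mulr_gt0.
have Y0 j : 0 <= (Y *m map_mx ratr A) 0 j by rewrite YA ycs// mem_nth.
have [q qA qy] := rational_cone_dense d0 Y0.
pose z := q 0 (enum_rank None).
have zP : `|ratr z - 1 : R| < d.
  by have := qy (enum_rank None); rewrite /Y mxE enum_rankK.
have z12 : 2^-1 < ratr z :> R.
  have : d <= 2^-1 by rewrite ge_min lexx.
  by move: zP; rewrite ltr_norml; lra.
have z0 : 0 < ratr z :> R by lra.
exists (fun i => q 0 (enum_rank (Some i)) / z).
  move=> c; case/(nthP c0) => j jl <-.
  have := qA (Ordinal jl); rewrite -(ler0q R) mxE.
  rewrite (eq_bigr (fun o : 'I_N => q 0 (enum_rank (enum_val o)) *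
    coef (nth c0 cs j) (enum_val o))); last by move=> o _; rewrite !mxE enum_valK.
  rewrite (sumo _ (fun o => q 0 (enum_rank o) * coef (nth c0 cs j) o)) -/z.
  rewrite /rat_affine => h.
  rewrite -(pmulr_lge0 _ z0) mulrDl mulr_suml; move: h; rewrite rmorphD/= rmorph_sum/=.
  rewrite rmorphM/= [ratr z * _]mulrC.
  have E (a b b' : R) : a = b -> 0 <= a + b' -> 0 <= b + b' by move=> ->.
  apply: E; apply: eq_bigr => i _.
  by rewrite /= !rmorphM/= fmorphV; field; rewrite gt_eqF.
move=> i; rewrite rmorphM/= fmorphV/=.
have := qy (enum_rank (Some i)); rewrite /Y mxE enum_rankK => qi.
rewrite (_ : _ - _ = (ratr (q 0 (enum_rank (Some i))) - y i + y i * (1 - ratr z)) / ratr z); last first.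
  by field; rewrite gt_eqF.
rewrite normrM normfV [ `|ratr z|]gtr0_norm// ltr_pdivrMr//.
rewrite (@le_lt_trans _ _ (d * C))//; last first.
  have : d * C <= e / 2.
    rewrite -ler_pdivlMr// -mulrA -invfM; rewrite ge_min lexx orbT//.
  have : e / 2 < e * ratr z by rewrite ltr_pM2l.
  by move=> h1 h2; apply: le_lt_trans h1.
rewrite (le_trans (ler_normD _ _))// normrM.
rewrite (@le_trans _ _ (d * (1 + `|y i|)))//; last by rewrite ler_pM2l.
rewrite mulrDr mulr1; apply: lerD; first exact: ltW.
by rewrite [leRHS]mulrC ler_wpM2l// distrC ltW.
Qed.

(** * The pairing, and Farkas' lemma *)

Section PairingTheory.
Variables (R : realType) (n : nat).
Implicit Types m x y : 'rV[R]_n.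

Lemma pairingDl m m' x : pairing (m + m') x = pairing m x + pairing m' x.
Proof. by rewrite -big_split/=; apply: eq_bigr => i _; rewrite mxE mulrDl. Qed.

Lemma pairingZl k m x : pairing (k *: m) x = k * pairing m x.
Proof. by rewrite mulr_sumr; apply: eq_bigr => i _; rewrite mxE mulrA. Qed.

Lemma pairingC m x : pairing m x = pairing x m.
Proof. by apply: eq_bigr => i _; rewrite mulrC. Qed.

Lemma pairingDr m x y : pairing m (x + y) = pairing m x + pairing m y.
Proof. by rewrite pairingC pairingDl !(pairingC m). Qed.

Lemma pairingZr m k x : pairing m (k *: x) = k * pairing m x.
Proof. by rewrite pairingC pairingZl pairingC. Qed.

Lemma pairing0r m : pairing m 0 = 0.
Proof. by rewrite -(scale0r 0) pairingZr mul0r. Qed.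

Lemma pairingNr m x : pairing m (- x) = - pairing m x.
Proof. by rewrite -scaleN1r pairingZr mulN1r. Qed.

Lemma pairingNl m x : pairing (- m) x = - pairing m x.
Proof. by rewrite pairingC pairingNr pairingC. Qed.

Lemma pairingBr m x y : pairing m (x - y) = pairing m x - pairing m y.
Proof. by rewrite pairingDr pairingNr. Qed.

Lemma pairing_delta (i : 'I_n) x : pairing (delta_mx 0 i) x = x 0 i.
Proof.
rewrite /pairing (bigD1 i)//= mxE !eqxx mul1r big1 ?addr0// => j ji.
by rewrite mxE (negPf ji) andbF mul0r.
Qed.

Lemma pairing_sumr (I : Type) (r : seq I) m (F : I -> 'rV[R]_n) :
  pairing m (\sum_(i <- r) F i) = \sum_(i <- r) pairing m (F i).
Proof.
elim: r => [|i r IH]; first by rewrite !big_nil pairing0r.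
by rewrite !big_cons pairingDr IH.
Qed.

Lemma pairing_eq0 x : (pairing x x == 0) = (x == 0).
Proof.
apply/eqP/eqP => [|->]; last exact: pairing0r.
move=> h; apply/rowP => i; rewrite mxE; apply/eqP; rewrite -sqrf_eq0 expr2.
have := h; rewrite /pairing => /eqP; rewrite psumr_eq0; last first.
  by move=> j _; rewrite -expr2 sqr_ge0.
by move=> /allP/(_ i); rewrite mem_index_enum => /(_ isT).
Qed.

Lemma pairing_gt0 x : x != 0 -> 0 < pairing x x.
Proof.
rewrite -pairing_eq0 lt_neqAle eq_sym => ->/=.
by apply: sumr_ge0 => j _; rewrite -expr2 sqr_ge0.
Qed.

End PairingTheory.

(** One-dimensional Helly: it eliminates the last coordinate in Farkas' lemma. *)
Lemma exists_between (R : realType) (A B : seq R) :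
  (forall a b, a \in A -> b \in B -> a <= b) ->
  exists t, (forall a, a \in A -> a <= t) /\ (forall b, b \in B -> t <= b).
Proof.
elim: A => [|a A IH] AB.
  elim: B {AB} => [|b B [t [_ tB]]]; first by exists 0.
  exists (Num.min b t); split => // x; rewrite inE => /predU1P[->|/tB h].
    by rewrite ge_min lexx.
  by rewrite ge_min h orbT.
have [|t [tA tB]] := IH.
  by move=> x b xA bB; apply: AB => //; rewrite inE xA orbT.
exists (Num.max a t); split => x.
  rewrite inE => /predU1P[->|/tA h]; first by rewrite le_max lexx.
  by rewrite le_max h orbT.
by move=> xB; rewrite ge_max tB// AB// inE eqxx.
Qed.

Section Farkas.
Variables (R : realType) (n : nat).
Local Notation V := 'rV[R]_n.

(** The consequences of the inequalities [pairing m p.1 <= p.2], [p] in [l], that are obtained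
    as nonnegative combinations. *)
Inductive cone (l : seq (V * R)) : V -> R -> Prop :=
| cone0 : cone l 0 0
| cone_cons c p d s : 0 <= c -> p \in l -> cone l d s ->
    cone l (c *: p.1 + d) (c * p.2 + s).

Lemma coneD l d s d' s' : cone l d s -> cone l d' s' -> cone l (d + d') (s + s').
Proof.
move=> h h'; elim: h => [|c p {}d {}s c0 pl _ IH]; first by rewrite !add0r.
by rewrite -!addrA; exact: cone_cons.
Qed.

Lemma coneZ l k d s : 0 <= k -> cone l d s -> cone l (k *: d) (k * s).
Proof.
move=> k0; elim=> [|c p {}d {}s c0 pl _ IH].
  by rewrite scaler0 mulr0; exact: cone0.
by rewrite scalerDr scalerA mulrDr mulrA; apply: cone_cons => //; rewrite mulr_ge0.
Qed.

Lemma cone_mem l p : p \in l -> cone l p.1 p.2.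
Proof.
by move=> pl; have := cone_cons ler01 pl (cone0 l); rewrite scale1r mul1r !addr0.
Qed.

Lemma cone_sub l l' : (forall p, p \in l' -> cone l p.1 p.2) ->
  forall d s, cone l' d s -> cone l d s.
Proof.
move=> ll d s; elim=> [|c p {}d {}s c0 pl _ IH]; first exact: cone0.
by apply: coneD => //; apply: coneZ => //; exact: ll.
Qed.

(** Fourier-Motzkin elimination: the coordinate [k] is eliminated by combining every inequality
    in which it has a positive coefficient with every one in which it has a negative one. *)
Lemma farkas_coord k : (k <= n)%N -> forall l : seq (V * R),
  (forall d s, cone l d s -> (forall i : 'I_n, (i < k)%N -> d 0 i = 0) -> 0 <= s) ->
  exists m : V, (forall i : 'I_n, (k <= i)%N -> m 0 i = 0) /\
    forall p, p \in l -> pairing m p.1 <= p.2.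
Proof.
elim: k => [_|k IH kn] l lP.
  exists 0; split=> [i _|p pl]; first by rewrite mxE.
  by rewrite pairingC pairing0r; apply: lP (cone_mem pl) _.
pose o := Ordinal kn.
pose P := [seq p : V * R <- l | 0 < p.1 0 o]; pose Q := [seq p : V * R <- l | p.1 0 o < 0].
pose comb (p q : V * R) := (- q.1 0 o *: p.1 + p.1 0 o *: q.1,
  - q.1 0 o * p.2 + p.1 0 o * q.2).
pose l' := [seq p : V * R <- l | p.1 0 o == 0] ++ [seq comb p q | p <- P, q <- Q].
have combl p q : p \in P -> q \in Q -> comb p q \in l'.
  by move=> pP qQ; rewrite mem_cat; apply/orP; right; apply/allpairsP; exists (p, q).
have l'P p : p \in l' -> cone l p.1 p.2 /\ p.1 0 o = 0.
  rewrite mem_cat mem_filter => /orP[/andP[/eqP ? pl]|/allpairsP[[u v]]].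
    by split => //; exact: cone_mem.
  rewrite !mem_filter/= => -[/andP[u0 ul] /andP[v0 vl] ->]; split; last first.
    by rewrite /= !mxE mulNr mulrC addrC subrr.
  apply: coneD; apply: coneZ; rewrite ?oppr_ge0 ?ltW//; exact: cone_mem.
have [|m [m0 ml']] := IH (ltnW kn) l'.
  move=> d s dl' d0; apply: (lP d s); first by apply: cone_sub dl' => p /l'P[].
  move=> i; rewrite ltnS leq_eqVlt => /predU1P[ik|]; last exact: d0.
  rewrite (_ : i = o); last exact: val_inj.
  elim: dl' => [|c p d' s' _ /l'P[_ p0] _ IHd]; first by rewrite mxE.
  by rewrite !mxE p0 mulr0 add0r.
have [|t [tQ tP]] := @exists_between R [seq (q.2 - pairing m q.1) / q.1 0 o | q <- Q]
    [seq (p.2 - pairing m p.1) / p.1 0 o | p <- P].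
  move=> _ _ /mapP[q qQ ->] /mapP[p pP ->]; have := ml' _ (combl p q pP qQ).
  move: pP qQ; rewrite !mem_filter => /andP[p0 _] /andP[q0 _].
  rewrite /= pairingDr !pairingZr => h.
  rewrite ler_pdivlMr// mulrAC ler_ndivrMr//; nra.
exists (m + t *: delta_mx 0 o); split.
  move=> i ki; rewrite !mxE m0; last exact: ltnW.
  by rewrite (_ : (i == o) = false) ?mulr0 ?addr0//; apply/eqP => h; move: ki; rewrite h ltnn.
move=> p pl; rewrite pairingDl pairingZl pairing_delta.
have [p0|p0|p0] := ltgtP (p.1 0 o) 0.
- have /tQ : (p.2 - pairing m p.1) / p.1 0 o \in [seq (q.2 - pairing m q.1) / q.1 0 o | q <- Q].
    by apply/mapP; exists p => //; rewrite mem_filter p0.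
  by rewrite ler_ndivrMr//; lra.
- have /tP : (p.2 - pairing m p.1) / p.1 0 o \in [seq (p.2 - pairing m p.1) / p.1 0 o | p <- P].
    by apply/mapP; exists p => //; rewrite mem_filter p0.
  by rewrite ler_pdivlMr//; lra.
- by rewrite p0 mulr0 addr0 ml'// mem_cat mem_filter p0 eqxx pl.
Qed.

(** A finite system of linear inequalities is solvable as soon as it does not imply $0 \le s$ with
    $s < 0$. *)
Lemma farkas (l : seq (V * R)) : (forall s, cone l 0 s -> 0 <= s) ->
  exists m : V, forall p, p \in l -> pairing m p.1 <= p.2.
Proof.
move=> lP; have [|m [_ mP]] := farkas_coord (leqnn n) (l := l); last by exists m.
move=> d s ds d0; apply: lP; suff -> : 0 = d by [].
by apply/rowP => i; rewrite mxE d0.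
Qed.

End Farkas.

(** * Polyhedra and collinear sets *)

Lemma continuousP_eps (R : realType) (n : nat) (f : 'rV[R]_n -> R) :
  (forall x e, 0 < e -> exists2 d, 0 < d & forall y, `|y - x| < d -> `|f y - f x| < e) ->
  continuous f.
Proof.
move=> h x; apply/(@cvgrPdist_lt _ _ _ _ (nbhs_filter x)) => e e0.
have [d d0 dP] := h x e e0.
apply/nbhs_ballP; exists d => //= y.
rewrite -ball_normE/= => xy. rewrite distrC; apply: dP; rewrite distrC//.
Qed.

Lemma within_continuous_normP (R : realType) (U : normedModType R) (X : set U) (f : U -> R) :
  {within X, continuous f} <->
  (forall x e, X x -> 0 < e -> exists2 d, 0 < d &
    forall y, X y -> `|y - x| < d -> `|f y - f x| < e).
Proof.
split.
  move=> /subspace_continuousP h x e Xx e0.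
  have /(@cvgrPdist_lt _ _ _ _ (within_filter _ (nbhs_filter x))) := h x Xx => /(_ e e0).
  move=> /nbhs_ballP[d /= d0 dP]; exists d => // y Xy yx.
  rewrite distrC; apply: dP => //. rewrite -ball_normE/= distrC//.
move=> h; apply/subspace_continuousP => x Xx.
apply/(@cvgrPdist_lt _ _ _ _ (within_filter _ (nbhs_filter x))) => e e0.
have [d d0 dP] := h x e Xx e0.
apply/nbhs_ballP; exists d => //= y + Xy.
rewrite -ball_normE/= => xy; rewrite distrC; apply: dP; rewrite // distrC//.
Qed.

Lemma closedP_eps (R : realType) (n : nat) (X : set 'rV[R]_n) :
  closed X <-> (forall x, (forall d, 0 < d -> exists2 y, X y & `|y - x| < d) -> X x).
Proof.
split=> h x hx.
  apply: h => B /nbhs_ballP[d /= d0 dB].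
  have [y Xy yx] := hx d d0. exists y; split => //. apply: dB. rewrite -ball_normE/= distrC//.
apply: h => d d0.
have [|y [Xy yx]] := hx (ball x d); first exact: nbhsx_ballx.
by exists y => //; move: yx; rewrite -ball_normE/= distrC.
Qed.

Section Thin.
Variables (R : realType) (n : nat).
Local Notation V := 'rV[R]_n.
Implicit Types (sigma tau e : set V) (Pi : set (set V)) (x y z v : V).

Definition convex_set (S : set V) := forall x y t,
  S x -> S y -> 0 <= t -> t <= 1 -> S (x + t *: (y - x)).

Definition collinear (S : set V) := exists p d : V,
  forall x, S x -> exists t, x = p + t *: d.

Lemma affine_line m (c : R) x y t :
  pairing m (x + t *: (y - x)) + c =
  (1 - t) * (pairing m x + c) + t * (pairing m y + c).
Proof. by rewrite pairingDr pairingZr pairingBr; ring. Qed.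

Lemma polyhedron_ineqs sigma : rational_polyhedron sigma ->
  exists cs : seq ('rV[int]_n * int),
    sigma = [set x | forall c, c \in cs -> 0 <= int_affine c x].
Proof.
move=> [Eqs [Ineqs ->]]; pose opp (c : 'rV[int]_n * int) := (- c.1, - c.2).
have oppE c x : int_affine (opp c) x = - int_affine c x :> R.
  rewrite /int_affine -[(opp c).2]/(- c.2) -[(opp c).1]/(- c.1); rewrite mulrNz opprD; congr (_ + _).
  rewrite -pairingNl; congr (pairing _ _).
  by apply/rowP => i; rewrite !mxE; rewrite ?mulrNz ?rmorphN.
exists (Ineqs ++ Eqs ++ map opp Eqs); apply/seteqP; split => x /=.
  move=> [xE xI] c; rewrite !mem_cat => /orP[/xI//|/orP[/xE->//|/mapP[c' cE ->]]].
  by rewrite oppE xE// oppr0.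
move=> h; split=> c cI; last by apply: h; rewrite mem_cat cI.
apply/eqP; rewrite eq_le -oppr_ge0 -oppE !h// !mem_cat ?cI ?orbT//.
by rewrite (map_f opp cI) !orbT.
Qed.

Lemma convex_polyhedron sigma : rational_polyhedron sigma -> convex_set sigma.
Proof.
move=> /polyhedron_ineqs[cs ->] x y t/= xP yP t0 t1 c cs_c.
rewrite /int_affine affine_line addr_ge0// mulr_ge0 ?subr_ge0//.
  exact: xP.
exact: yP.
Qed.

Lemma coord_le_norm x i : `|x 0 i| <= `|x|.
Proof.
rewrite [leRHS]/Num.norm/= mx_normrE.
exact: (le_bigmax _ (fun ij : 'I_1 * 'I_n => `|x ij.1 ij.2|) (ord0, i)).
Qed.

Lemma norm_le_coord x (e : R) : 0 <= e -> (forall i, `|x 0 i| <= e) -> `|x| <= e.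
Proof.
move=> e0 h; rewrite [leLHS]/Num.norm/= mx_normrE; apply/bigmax_leP; split => //.
by move=> [i j] _ /=; rewrite ord1.
Qed.

Lemma norm_lt_coord x (e : R) : 0 < e -> (forall i, `|x 0 i| < e) -> `|x| < e.
Proof.
move=> e0 h; rewrite [ltLHS]/Num.norm/= mx_normrE; apply/bigmax_ltP; split => //.
by move=> [i j] _ /=; rewrite ord1.
Qed.

Lemma pairing_bounded (m : V) : exists2 C : R, 0 < C & forall x, `|pairing m x| <= C * `|x|.
Proof.
exists (1 + \sum_i `|m 0 i|); first by rewrite ltr_pwDl// sumr_ge0.
move=> x; rewrite (@le_trans _ _ ((\sum_i `|m 0 i|) * `|x|))//; last first.
  by rewrite ler_wpM2r// lerDr.
rewrite (le_trans (ler_norm_sum _ _ _))// mulr_suml ler_sum// => i _.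
by rewrite normrM ler_wpM2l// coord_le_norm.
Qed.

Lemma closed_affine_ge0 (m : V) (c : R) : closed [set x | 0 <= pairing m x + c].
Proof.
have [C C0 mC] := pairing_bounded m.
apply/closedP_eps => x h /=; rewrite leNgt; apply/negP => x0.
have [|y /= y0 yx] := h (- (pairing m x + c) / C).
  by rewrite divr_gt0// oppr_gt0.
have := mC (y - x); rewrite pairingBr.
move: yx; rewrite ltr_pdivlMr// => h1 h2.
have := ler_norm (pairing m y - pairing m x); nra.
Qed.

Lemma closed_polyhedron sigma : rational_polyhedron sigma -> closed sigma.
Proof.
move=> /polyhedron_ineqs[cs ->].
rewrite (_ : mkset _ = \bigcap_(c in [set` cs]) [set x : V | 0 <= int_affine c x]).
  by apply: closed_bigI => c _; exact: closed_affine_ge0.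
by apply/seteqP; split => x /= h c; apply: h.
Qed.

Lemma line_comb (p d x y : V) t : (exists s, x = p + s *: d) ->
  (exists s, y = p + s *: d) -> exists s, x + t *: (y - x) = p + s *: d.
Proof.
move=> [s ->] [s' ->]; exists (s + t * (s' - s)).
rewrite opprD addrACA subrr add0r -scalerBl scalerA -addrA; congr (_ + _).
by rewrite scalerDl.
Qed.

Lemma collinearP S x y z : collinear S -> S x -> S y -> S z -> x != y ->
  exists t, z = x + t *: (y - x).
Proof.
move=> [p [d Sd]] /Sd[a xE] /Sd[b yE] /Sd[c zE] xy.
have ab : b - a != 0.
  by apply: contraNneq xy => /eqP; rewrite subr_eq0 => /eqP ba; rewrite xE yE ba.
exists ((c - a) / (b - a)); rewrite xE yE zE opprD addrACA subrr add0r.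
by rewrite -scalerBl scalerA mulfVK// -addrA -scalerDl [a + _]addrC subrK.
Qed.

Lemma affine_collinear0 S m (c : R) x y : collinear S -> S x -> S y -> x != y ->
  pairing m x + c = 0 -> pairing m y + c = 0 ->
  forall z, S z -> pairing m z + c = 0.
Proof.
move=> cS Sx Sy xy xm ym z Sz; have [t ->] := collinearP cS Sx Sy Sz xy.
by rewrite affine_line xm ym !mulr0 addr0.
Qed.

(** If a convex set has a point $b$ off the other lines and a point $a$ off the first line, then the
    infinitely many points $b + (a - b)/j$ all lie on the other lines, hence two of them on the
    same one; this line then contains $b$. *)
Lemma convex_cover_collinear (s : seq (V * V)) (S : set V) : convex_set S ->
  (forall x, S x -> exists2 l, l \in s & exists t, x = l.1 + t *: l.2) ->
  collinear S.
Proof.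
move=> cS; elim: s => [|l s IH] Ss; first by exists 0, 0 => x /Ss[].
have [Sl|/existsNP[a /not_implyP[Sa al]]] :=
  pselect (forall x, S x -> exists t, x = l.1 + t *: l.2); first by exists l.1, l.2.
apply: IH => b Sb; apply: contrapT => bs.
have bl : exists t, b = l.1 + t *: l.2.
  have [l' + bl'] := Ss b Sb; rewrite inE => /predU1P[ll|ls]; last by case: bs; exists l'.
  by rewrite -ll.
pose p (j : nat) := b + (j.+2%:R)^-1 *: (a - b).
have Sp j : S (p j).
  by apply: cS; rewrite ?invr_ge0 ?invf_le1// ?ler1n ?ltr0n.
have pl j : exists2 l', l' \in s & exists t, p j = l'.1 + t *: l'.2.
  have [l' + pl'] := Ss _ (Sp j); rewrite inE => /predU1P[ll|ls]; last by exists l'.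
  rewrite ll in pl'; case: al; have := line_comb j.+2%:R bl pl'.
  suff -> : a = b + j.+2%:R *: (p j - b) by [].
  apply/rowP => i; rewrite /p; have : j.+2%:R != 0 :> R by rewrite pnatr_eq0.
  by move: (j.+2%:R) => c c0; rewrite !mxE; field.
pose l_ j := sval (cid2 (pl j)).
have l_s j : l_ j \in s by rewrite /l_; case: cid2.
have l_p j : exists t, p j = (l_ j).1 + t *: (l_ j).2 by rewrite /l_; case: cid2.
pose f (j : 'I_(size s).+1) : 'I_(size s) := Ordinal (etrans (index_mem _ _) (l_s j)).
have /injectivePn[i [j ij /(congr1 val)/= fij]] : ~~ injectiveb f.
  by apply/negP => /injectiveP/leq_card; rewrite !card_ord ltnn.
have lij : l_ i = l_ j by rewrite -(nth_index (0, 0) (l_s i)) fij nth_index.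
apply: bs; exists (l_ i) => //.
have jn : (j.+2%:R : R) - i.+2%:R != 0.
  by rewrite subr_eq0 eqr_nat !eqSS; apply: contra ij => /eqP/val_inj ->.
have lj := l_p j; rewrite -lij in lj.
have := line_comb (j.+2%:R / (j.+2%:R - i.+2%:R)) (l_p i) lj.
suff -> : b = p i + (j.+2%:R / (j.+2%:R - i.+2%:R)) *: (p j - p i) by [].
have ci0 : i.+2%:R != 0 :> R by rewrite pnatr_eq0.
have cj0 : j.+2%:R != 0 :> R by rewrite pnatr_eq0.
move: jn ci0 cj0; rewrite /p; move: (i.+2%:R) (j.+2%:R) => ci cj jn ci0 cj0.
by apply/rowP => k; rewrite !mxE; field; rewrite ci0 cj0.
Qed.

Lemma collinear_cell_dim sigma : has_dim sigma 1 -> collinear sigma.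
Proof.
move=> [W dW WE]; have [->|/set0P[p0 sp0]] := eqVneq sigma set0; first by exists 0, 0.
have WP : W = <[vpick W]>%VS.
  apply/esym/eqP; rewrite eqEdim -memvE memv_pick dW dim_vline.
  by rewrite vpick0; case: eqP dW => // ->; rewrite dimv0.
exists p0, (vpick W) => x sx.
have : [set v | v \in W] (x - p0).
  rewrite WE; exists [:: x - p0]; last by rewrite span_seq1 memv_line.
  by move=> z; rewrite inE => /eqP ->; exists x, p0.
move=> /= xW; have : x - p0 \in <[vpick W]>%VS by rewrite -WP.
move=> /vlineP[t tE]; exists t; apply/eqP; rewrite addrC -subr_eq; apply/eqP.
exact: tE.
Qed.

Lemma lin_spanP S x y : collinear S -> S x -> S y -> x != y ->
  lin_span S = [set v | exists k, v = k *: (y - x)].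
Proof.
move=> cS Sx Sy xy; apply/seteqP; split => v /=.
  move=> [s sS vs]; apply/vlineP; apply: subvP vs; apply/span_subvP => z /sS[a [b [Sa Sb ->]]].
  have [t ->] := collinearP cS Sx Sy Sa xy; have [t' ->] := collinearP cS Sx Sy Sb xy.
  by rewrite opprD addrACA subrr add0r -scalerBl memvZ// memv_line.
move=> [k ->]; exists [:: y - x]; last by rewrite memvZ// span_seq1 memv_line.
by move=> z; rewrite inE => /eqP ->; exists y, x.
Qed.

Lemma has_dim1P S : collinear S -> S !=set0 ->
  has_dim S 1 <-> exists x y, [/\ S x, S y & x != y].
Proof.
move=> cS [x0 Sx0]; split => [[W dW WE]|[x [y [Sx Sy xy]]]].
  apply: contrapT => h.
  have S0 z : S z -> z = x0.
    by move=> Sz; apply/eqP; apply: contrapT => zx; apply: h; exists z, x0; split => //; apply/negP.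
  have : lin_span S (vpick W) by rewrite -WE /=; exact: memv_pick.
  move=> [s sS].
  rewrite (_ : << s >>%VS = 0%VS).
    by rewrite memv0 vpick0 => /eqP W0; move: dW; rewrite W0 dimv0.
  apply/eqP; rewrite -subv0; apply/span_subvP => z /sS[a [b [/S0-> /S0-> ->]]].
  by rewrite subrr mem0v.
exists <[y - x]>%VS; first by rewrite dim_vline subr_eq0 eq_sym xy.
rewrite (lin_spanP cS Sx Sy xy); apply/seteqP; split => v /= /vlineP//.
Qed.

End Thin.

(** * Cells and faces of one-dimensional complexes *)

Section Complex.
Variables (R : realType) (n : nat).
Local Notation V := 'rV[R]_n.
Implicit Types (sigma tau e S : set V) (Pi : set (set V)) (x y z v : V).

Lemma exists_maximal (s : seq (set V)) (A : set V) :
  exists B, [/\ A `<=` B, B = A \/ B \in s &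
    forall C, C \in s -> B `<=` C -> C = B].
Proof.
elim: s => [|D s [B [AB Bs Bmax]]]; first by exists A; split => //; left.
have [BD|nBD] := pselect (B `<=` D).
  exists D; split; [exact: subset_trans BD|by right; rewrite inE eqxx|].
  move=> C; rewrite inE => /predU1P[->//|Cs] DC; apply/seteqP; split => //.
  by rewrite (Bmax C Cs) //; exact: subset_trans DC.
exists B; split => //; first by case: Bs => ?; [left|right; rewrite inE; apply/orP; right].
by move=> C; rewrite inE => /predU1P[->//|Cs]; exact: Bmax.
Qed.

(** The property of the cells that dimension one amounts to. It passes to every structure
    on the space, which the condition on maximal faces of one structure does not show directly. *)
Definition thin Pi := forall sigma, Pi sigma -> collinear sigma.

Lemma one_dim_cover (X : set V) : one_dim_polyhedral_space X ->
  exists s : seq (V * V), forall x, X x ->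
    exists2 l, l \in s & exists t, x = l.1 + t *: l.2.
Proof.
move=> [Pi [[/finite_seqP[s sE] _ _ _] supp] maxPi].
have inP C : Pi C <-> C \in s by rewrite sE.
have coll sigma : Pi sigma -> collinear sigma.
  move=> Ps; have [B [sB Bs Bmax]] := exists_maximal s sigma.
  have PB : Pi B by apply/inP; case: Bs => [->|//]; exact/inP.
  have [|p [d Bd]] := @collinear_cell_dim _ _ B.
    by apply: maxPi => // tau /inP; exact: Bmax.
  by exists p, d => x /sB; exact: Bd.
pose l (sigma : set V) : V * V := if pselect (collinear sigma) is left h
  then (projT1 (cid h), projT1 (cid (projT2 (cid h)))) else 0.
exists (map l s) => x; rewrite -supp => -[sigma Ps sx].
exists (l sigma); first by apply: map_f; apply/inP.
rewrite /l; case: pselect => [h|]; last by have := coll _ Ps.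
by case: cid => p /= h'; case: cid => d /= /(_ _ sx).
Qed.

(** The space lies in a finite union of lines because one structure has faces of dimension one;
    so does a convex cell of any other structure, to which [convex_cover_collinear] applies. *)
Lemma structure_thin (X : set V) Pi : one_dim_polyhedral_space X ->
  polyhedral_structure X Pi -> thin Pi.
Proof.
move=> /one_dim_cover[s sX] [[_ polPi _ _] XE] sigma Ps.
apply: (@convex_cover_collinear _ _ s).
  by apply: convex_polyhedron; have [] := polPi _ Ps.
by move=> x sx; apply: sX; rewrite -XE; exists sigma.
Qed.

Lemma face_sub tau sigma : face tau sigma -> tau `<=` sigma.
Proof. by move=> [_ [m [c [_ ->]]]] x []. Qed.

Lemma face_refl sigma : sigma !=set0 -> face sigma sigma.
Proof.
move=> s0; split => //; exists 0, 0; have p0 x : pairing (0 : V) x = 0.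
  by rewrite pairingC pairing0r.
split=> [x _|]; first by rewrite p0 addr0.
by apply/seteqP; split => x /=; rewrite p0 addr0; [split|case].
Qed.

(** An affine function that vanishes at two points of a line vanishes on the line. *)
Lemma face_two_points tau sigma x y : collinear sigma -> face tau sigma ->
  tau x -> tau y -> x != y -> tau = sigma.
Proof.
move=> cs ft tx ty xy; apply/seteqP; split; first exact: face_sub.
move: ft tx ty => [_ [m [c [_ ->]]]] [sx mx] [sy my] z sz; split => //=.
exact: affine_collinear0 cs sx sy xy mx my z sz.
Qed.

(** A form that is nonnegative on the ends of a segment and vanishes inside vanishes at the ends. *)
Lemma face_point_extreme v sigma x y t : face [set v] sigma -> sigma x -> sigma y ->
  v = x + t *: (y - x) -> 0 < t -> t < 1 -> x = v /\ y = v.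
Proof.
move=> [_ [m [c [m0 vE]]]] sx sy vxy t0 t1.
have [_ /=] : (sigma `&` [set x | pairing m x + c = 0]) v by rewrite -vE.
rewrite vxy affine_line => /eqP; rewrite paddr_eq0 ?mulr_ge0 ?m0 ?subr_ge0 ?ltW//.
rewrite !mulf_eq0 subr_eq0 [1 == t]gt_eqF// [t == 0]gt_eqF//= => /andP[/eqP mx /eqP my].
have h z : sigma z -> pairing m z + c = 0 -> z = v.
  by move=> sz mz; have : [set v] z by rewrite vE.
by rewrite -vxy; split; exact: h.
Qed.

Lemma face_endpoint v d sigma : sigma v -> d != 0 ->
  (forall x, sigma x -> exists2 t, 0 <= t & x = v + t *: d) -> face [set v] sigma.
Proof.
move=> sv d0 sP; split; first by exists v.
exists d, (- pairing d v); split.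
  move=> x /sP[t t0 ->]; rewrite pairingDr pairingZr addrAC subrr add0r.
  by rewrite mulr_ge0// ltW// pairing_gt0.
apply/seteqP; split => x /=; first by move=> ->; rewrite subrr.
move=> [/sP[t t0 ->]]; rewrite pairingDr pairingZr addrAC subrr add0r => /eqP.
by rewrite mulf_eq0 (gt_eqF (pairing_gt0 d0)) orbF => /eqP ->; rewrite scale0r addr0.
Qed.

Section InComplex.
Variables (Pi : set (set V)).
Hypotheses (cPi : polyhedral_complex Pi) (tPi : thin Pi).

Lemma cell_nonempty sigma : Pi sigma -> sigma !=set0.
Proof. by move=> Ps; have [_ h _ _] := cPi; have [] := h _ Ps. Qed.

Lemma cell_polyhedron sigma : Pi sigma -> rational_polyhedron sigma.
Proof. by move=> Ps; have [_ h _ _] := cPi; have [] := h _ Ps. Qed.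

Lemma cell_convex sigma : Pi sigma -> convex_set sigma.
Proof. by move=> /cell_polyhedron/convex_polyhedron. Qed.

Lemma cell_closed sigma : Pi sigma -> closed sigma.
Proof. by move=> /cell_polyhedron/closed_polyhedron. Qed.

Lemma cell_face sigma tau : Pi sigma -> face tau sigma -> Pi tau.
Proof. by move=> Ps ft; have [_ _ h _] := cPi; exact: h ft. Qed.

Lemma vertex_face v sigma : Pi [set v] -> Pi sigma -> sigma v -> face [set v] sigma.
Proof.
move=> Pv Ps sv; have [_ _ _ /(_ _ _ Ps Pv)[h|[+ _]]] := cPi.
  by have : (sigma `&` [set v]) v by []; rewrite h.
by rewrite (_ : sigma `&` [set v] = [set v])//; apply/seteqP; split => x /=; [case|move=> ->].
Qed.

Lemma edgeP e : edges Pi e <-> Pi e /\ exists x y, [/\ e x, e y & x != y].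
Proof.
by split=> -[Pe h]; split => //; apply/(has_dim1P (tPi Pe) (cell_nonempty Pe)).
Qed.

Lemma edge_unique e1 e2 x y : edges Pi e1 -> edges Pi e2 ->
  e1 x -> e1 y -> e2 x -> e2 y -> x != y -> e1 = e2.
Proof.
move=> [P1 _] [P2 _] x1 y1 x2 y2 xy; have [_ _ _ /(_ _ _ P1 P2)[h|[f1 f2]]] := cPi.
  by have : (e1 `&` e2) x by []; rewrite h.
rewrite -(face_two_points (tPi P1) f1 _ _ xy)//.
by rewrite {1}(face_two_points (tPi P2) f2 _ _ xy).
Qed.

End InComplex.
End Complex.

(** * Subdivisions *)

Section Cut.
Variables (R : realType) (n : nat).
Local Notation V := 'rV[R]_n.
Implicit Types (sigma tau e S : set V) (Pi : set (set V)) (x y z v : V).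
Implicit Types (c : 'rV[int]_n * int).

(** The closed half-spaces and the hyperplane that an affine form defines. *)
Definition sign_region c (r : option bool) : set V :=
  [set x | match r with
           | Some true => 0 <= int_affine c x
           | Some false => int_affine c x <= 0
           | None => int_affine c x = 0 end].

(** Every cell is replaced by its parts on both sides of the hyperplane and on the hyperplane. *)
Definition cut Pi c : set (set V) := [set s | s !=set0 /\
  exists2 sigma, Pi sigma & exists r, s = sigma `&` sign_region c r].

(** Intersecting with [sign_region c r'] amounts, inside [sign_region c r], to passing to a face. *)
Lemma sign_region_support c r r' : exists m : V, exists b : R,
  forall x, sign_region c r x ->
    0 <= pairing m x + b /\ (sign_region c r' x <-> pairing m x + b = 0).
Proof.
rewrite /sign_region/=.
have E0 x : pairing (0 : V) x + 0 = 0 by rewrite pairingC pairing0r addr0.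
have EN x : pairing (- map_mx intr c.1 : V) x + - c.2%:~R = - int_affine c x.
  by rewrite pairingNl -opprD.
have [->|oo'] := eqVneq r r'.
  by exists 0, 0 => x xo; rewrite E0; split.
case: r oo' => [[]|]; last first.
- by case: r' => [[]|] _; exists 0, 0 => x /= ->; rewrite E0; split.
- case: r' => [[]|] // _; exists (- map_mx intr c.1), (- c.2%:~R) => x /= h; rewrite EN oppr_ge0;
    split=> //; split; lra.
- case: r' => [[]|] // _; exists (map_mx intr c.1), c.2%:~R => x /= h;
    rewrite -/(int_affine c x); split=> //; split; lra.
Qed.

(** The sum of the form that defines [tau] and of the one that defines the region. *)
Lemma face_trans_region c r r' tau sigma : face tau sigma ->
  (tau `&` sign_region c r `&` sign_region c r') !=set0 ->
  face (tau `&` sign_region c r `&` sign_region c r') (sigma `&` sign_region c r).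
Proof.
move=> [_ [m [b [mb ->]]]] ne; split => //.
have [m' [b' h]] := sign_region_support c r r'.
exists (m + m'), (b + b').
have E x : pairing (m + m') x + (b + b') = (pairing m x + b) + (pairing m' x + b').
  by rewrite pairingDl addrACA.
split=> [x [sx xo]|]; first by rewrite E addr_ge0// ?mb//; have [] := h x xo.
apply/seteqP; split => x /=; rewrite E.
  by move=> [[[sx ->] xo] xo']; split=> //; rewrite add0r; apply/(h x xo).2.
move=> [[sx xo]] /eqP; have [h1 h2] := h x xo.
by rewrite paddr_eq0 ?mb// => /andP[/eqP mx /eqP mx']; split => //; exact/h2.
Qed.

Lemma sign_region_polyhedron c r : exists Eqs Ineqs : seq ('rV[int]_n * int),
    sign_region c r = [set x | (forall c, c \in Eqs -> int_affine c x = 0) /\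
                     (forall c, c \in Ineqs -> 0 <= int_affine c x)].
Proof.
pose c' : 'rV[int]_n * int := (- c.1, - c.2).
have c'E x : int_affine c' x = - int_affine c x :> R.
  rewrite /int_affine /c' /= mulrNz opprD -pairingNl; congr (pairing _ _ + _).
  by apply/rowP => i; rewrite !mxE; rewrite ?mulrNz ?rmorphN.
case: r => [[]|].
- exists [::], [:: c]; apply/seteqP; split => x /=; last by move=> [_]; apply; rewrite inE.
  by move=> h; split=> // ?; rewrite inE => /eqP ->.
- exists [::], [:: c']; apply/seteqP; split => x /=.
    by move=> h; split=> // ?; rewrite inE => /eqP ->; rewrite c'E oppr_ge0.
  by move=> [_ /(_ c')]; rewrite c'E inE eqxx oppr_ge0; apply.
- exists [:: c], [::]; apply/seteqP; split => x /=; last by move=> [h _]; apply: h; rewrite inE.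
  by move=> h; split=> // ?; rewrite inE => /eqP ->.
Qed.

Lemma polyhedronI sigma tau : rational_polyhedron sigma -> rational_polyhedron tau ->
  rational_polyhedron (sigma `&` tau).
Proof.
move=> [E1 [I1 ->]] [E2 [I2 ->]]; exists (E1 ++ E2), (I1 ++ I2).
apply/seteqP; split => x /=.
  move=> [[e1 i1] [e2 i2]]; split=> c; rewrite mem_cat => /orP[].
  - exact: e1. - exact: e2. - exact: i1. - exact: i2.
by move=> [e i]; do ![split] => c h; (apply: e || apply: i); rewrite mem_cat h ?orbT.
Qed.

(** The point that uses dimension one is that faces of the new cells are new cells: a proper face
    of a collinear set is a point, which lies on the hyperplane or is a face of the old cell. *)
Lemma cut_complex Pi c : polyhedral_complex Pi -> thin Pi -> polyhedral_complex (cut Pi c).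
Proof.
move=> cPi tPi; have [finPi polPi faceP interP] := cPi.
split.
- apply: (@sub_finite_set _ _ ((fun p => p.1 `&` sign_region c p.2) @`
    (Pi `*` [set: option bool]))).
    by move=> s [_ [sigma Ps [r ->]]]; exists (sigma, r).
  by apply: finite_image; apply: finite_setX => //; exact: finite_finset.
- move=> s [s0 [sigma Ps [r sE]]]; subst s; split => //; apply: polyhedronI.
    exact: cell_polyhedron Ps.
  by have [E [I ->]] := sign_region_polyhedron c r; exists E, I.
- move=> s tau [s0 [sigma Ps [r sE]]] ft.
  have cs : collinear s.
    by have [p [d h]] := tPi _ Ps; exists p, d => x; rewrite sE => -[sx _]; exact: h.
  have [->|tauNs] := pselect (tau = s); first by split=> //; exists sigma => //; exists r.
  have [[v tv] [m [b [mb tauE]]]] := ft.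
  have tE : tau = [set v].
    apply/seteqP; split => x /= => [tx|->//]; apply/eqP; apply: contra_notT tauNs => xv.
    exact: face_two_points cs ft tx tv xv.
  have sv : s v by apply: face_sub ft _ tv.
  have [w [sw wv]] : exists w, s w /\ v != w.
    apply: contrapT => h; apply: tauNs; rewrite tE; apply/seteqP; split => x /= => [->//|sx].
    by apply/eqP; rewrite eq_sym; apply: contra_notT h => vx; exists x.
  have [[sigv vo] [sigw wo]] : (sigma v /\ sign_region c r v) /\ (sigma w /\ sign_region c r w).
    by move: sv sw; rewrite sE => -[? ?] [? ?].
  have mv : pairing m v + b = 0 by move: tv; rewrite tauE => -[].
  have mw : pairing m w + b != 0.
    apply/eqP => mw; move: wv; apply/negP; rewrite negbK eq_sym; apply/eqP.
    by have : tau w; [rewrite tauE|rewrite tE].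
  have [lv|lv] := eqVneq (int_affine c v : R) 0.
    have [lw|lw] := eqVneq (int_affine c w : R) 0.
      (* The form vanishes on all of the collinear [sigma], so that [s] is [sigma]. *)
      have l0 := affine_collinear0 (tPi _ Ps) sigv sigw wv lv lw.
      have ss : s = sigma.
        rewrite sE; apply/seteqP; split => x /= => [[]//|sx]; split => //.
        by case: (r) => [[]|]; rewrite /sign_region/= /int_affine l0.
      split; first by exists v.
      exists tau; first by apply: (faceP sigma) => //; rewrite -ss.
      exists None; apply/seteqP; split => x /= => [tx|[]//]; split => //.
      by apply: l0; rewrite -ss; apply: face_sub ft _ tx.
    split; first by exists v.
    exists sigma => //; exists None; rewrite tE; apply/seteqP; split => x /= => [->//|[sx lx]].
    apply/eqP; apply: contraNT lw; rewrite eq_sym => vx; apply/eqP.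
    exact: affine_collinear0 (tPi _ Ps) sigv sx vx lv lx _ sigw.
  (* A point [y] of [sigma] with a negative value would give, on the segment from [v] to [y]
     and near [v], a point of [s] with a negative value. *)
  have m0 y : sigma y -> 0 <= pairing m y + b.
    move=> sy; rewrite leNgt; apply/negP => my.
    pose L (x : V) : R := int_affine c x.
    pose t := `|L v| / (`|L v| + `|L y|).
    have Lv0 : 0 < `|L v| by rewrite normr_gt0.
    have t0 : 0 < t by rewrite divr_gt0// ltr_pwDl.
    have t1 : t <= 1 by rewrite ler_pdivrMr ?ltr_pwDl// mul1r lerDl.
    have tE' : (1 - t) * `|L v| = t * `|L y| by rewrite /t; field; rewrite gt_eqF// ltr_pwDl.
    have sz : s (v + t *: (y - v)).
      rewrite sE; split; first by apply: (cell_convex cPi Ps) => //; exact: ltW.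
      move: lv vo; rewrite -/(L v); case: (r) => [[]|]; rewrite /sign_region/= => lv; last first.
      - by rewrite -/(L v) => /eqP; rewrite (negPf lv).
      - rewrite /int_affine affine_line -/(int_affine c v) -/(int_affine c y) -/(L v) -/(L y) => vo.
        move: tE'; rewrite (ler0_norm vo) => tE'; have := ler_norm (L y); nra.
      - rewrite /int_affine affine_line -/(int_affine c v) -/(int_affine c y) -/(L v) -/(L y) => vo.
        move: tE'; rewrite (ger0_norm vo) => tE'; have := ler_norm (- L y); rewrite normrN; nra.
    by have := mb _ sz; rewrite affine_line mv mulr0 add0r leNgt pmulr_rlt0// my.
  split; first by exists v.
  exists [set v]; last by exists r; rewrite tE; apply/seteqP; split => x /= => [->//|[]//].
  apply: (faceP sigma) => //; split; first by exists v.
  exists m, b; split => //; apply/seteqP; split => x /= => [->//|[sx mx]].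
  apply/eqP; apply: contraNT mw; rewrite eq_sym => vx; apply/eqP.
  exact: affine_collinear0 (tPi _ Ps) sigv sx vx mv mx _ sigw.
- move=> s1 s2 [s10 [sg1 P1 [r1 ->]]] [s20 [sg2 P2 [r2 ->]]].
  have E : sg1 `&` sign_region c r1 `&` (sg2 `&` sign_region c r2) =
      sg1 `&` sg2 `&` sign_region c r1 `&` sign_region c r2.
    by apply/seteqP; split => x /=; [move=> [[? ?] [? ?]]|move=> [[[? ?] ?] ?]].
  have [e|/set0P ne] := eqVneq (sg1 `&` sign_region c r1 `&` (sg2 `&` sign_region c r2)) set0;
    first by left.
  right; rewrite E in ne *; have [h|[f1 f2]] := interP _ _ P1 P2.
    by case: ne => x [[[]]] h1 h2; have : (sg1 `&` sg2) x by []; rewrite h.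
  split; first exact: face_trans_region.
  rewrite -setIA [_ `&` sign_region c r2]setIC setIA.
  apply: face_trans_region => //.
  by rewrite -setIA [_ `&` sign_region c r1]setIC setIA.
Qed.

Lemma cut_structure (X : set V) Pi c : one_dim_polyhedral_space X ->
  polyhedral_structure X Pi -> polyhedral_structure X (cut Pi c).
Proof.
move=> oX sPi; have tPi := structure_thin oX sPi; have [cPi XE] := sPi.
split; first exact: cut_complex.
rewrite -XE; apply/seteqP; split => x [s].
  by move=> [_ [sigma Ps [r ->]]] [sx _]; exists sigma.
move=> Ps sx; have [l0|l0] := leP 0 (int_affine c x : R).
  exists (s `&` sign_region c (Some true)) => //; split; first by exists x.
  by exists s => //; exists (Some true).
exists (s `&` sign_region c (Some false)); last by split=> //; exact: ltW.
split; first by exists x; split => //; exact: ltW.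
by exists s => //; exists (Some false).
Qed.

Lemma refines_trans Pi1 Pi2 Pi3 : refines Pi1 Pi2 -> refines Pi2 Pi3 -> refines Pi1 Pi3.
Proof.
move=> h12 h23 s /h12[t /h23[u Pu tu] st]; exists u => //; exact: subset_trans tu.
Qed.

Definition constant_sign S c :=
  (forall x : V, S x -> 0 <= int_affine c x) \/ (forall x, S x -> int_affine c x <= 0).

Lemma constant_sign_structure (X : set V) Pi (cs : seq ('rV[int]_n * int)) :
  one_dim_polyhedral_space X -> polyhedral_structure X Pi ->
  exists Pi', [/\ polyhedral_structure X Pi', refines Pi' Pi &
    forall s c, Pi' s -> c \in cs -> constant_sign s c].
Proof.
move=> oX sPi; elim: cs => [|c cs [Pi' [sPi' rPi' csPi']]].
  by exists Pi; split => // s Ps; exists s.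
exists (cut Pi' c); split; first exact: cut_structure.
  move=> s [_ [sigma Ps [r ->]]]; have [t Pt st] := rPi' _ Ps.
  by exists t => // x [/st].
move=> s c' [_ [sigma Ps [r ->]]]; rewrite inE => /predU1P[->|c's].
  case: r => [[]|]; [left|right|left] => x [_] //=.
  by rewrite /sign_region/= => ->.
by have [h|h] := csPi' _ _ Ps c's; [left|right] => x [sx _]; exact: h.
Qed.

(** Such a point detects the constraints that hold with equality on the whole set; the midpoint
    of two distinct points of a collinear set will do. *)
Lemma relative_interior_point S : S !=set0 -> convex_set S -> collinear S ->
  exists2 z, S z & forall c, constant_sign S c ->
    int_affine c z = 0 :> R -> forall x, S x -> int_affine c x = 0 :> R.
Proof.
move=> [x0 Sx0] cS lS.
have [one|[y [Sy xy]]] : (forall y, S y -> y = x0) \/ exists y, S y /\ x0 != y.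
- have [|/existsNP[y /not_implyP[Sy yx]]] := pselect (forall y, S y -> y = x0); first by left.
  by right; exists y; split=> //; apply/eqP => /esym.
- by exists x0 => // c _ cx x /one ->.
exists (x0 + 2^-1 *: (y - x0)); first by apply: cS => //; lra.
move=> c sc; rewrite {1}/int_affine affine_line -/(int_affine c x0) -/(int_affine c y).
move=> h.
have [hx hy] : int_affine c x0 = 0 :> R /\ int_affine c y = 0 :> R.
  by case: sc => sc; have := sc _ Sx0; have := sc _ Sy; split; lra.
by move=> x Sx; exact: affine_collinear0 lS Sx0 Sy xy hx hy x Sx.
Qed.

(** The first structure is cut along all constraints of the cells of the second one. All these
    constraints then have constant sign on a cell, so that the whole cell satisfies those that
    a point of its relative interior satisfies. *)
Lemma common_refinement (X : set V) Pi1 Pi2 : one_dim_polyhedral_space X ->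
  polyhedral_structure X Pi1 -> polyhedral_structure X Pi2 ->
  exists Pi, [/\ polyhedral_structure X Pi, refines Pi Pi1 & refines Pi Pi2].
Proof.
move=> oX sPi1 sPi2; have [cPi2 X2] := sPi2.
have [/finite_seqP[s sE] polPi _ _] := cPi2.
pose cs (sigma : set V) : seq ('rV[int]_n * int) :=
  if pselect (rational_polyhedron sigma) is left h
  then sval (cid (polyhedron_ineqs h)) else [::].
have csE sigma : Pi2 sigma -> sigma = [set x | forall c, c \in cs sigma -> 0 <= int_affine c x].
  move=> Ps; rewrite /cs; case: pselect => [h|[]]; last by have [] := polPi _ Ps.
  by case: cid.
have [Pi [sPi rPi csPi]] := constant_sign_structure (flatten (map cs s)) oX sPi1.
exists Pi; split => // tau Pt.
have tPi := structure_thin oX sPi; have [cPi XE] := sPi.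
have [z tz zP] := relative_interior_point (cell_nonempty cPi Pt) (cell_convex cPi Pt) (tPi _ Pt).
have : X z by rewrite -XE; exists tau.
rewrite -X2 => -[sigma Ps sz]; exists sigma => // x tx.
have := Ps; move=> /csE sigE; rewrite sigE in sz *; move=> c cc.
have sgn : constant_sign tau c.
  by apply: csPi => //; apply/flatten_mapP; exists sigma => //; move: Ps; rewrite sE.
have [h|h] := sgn; first exact: h.
by rewrite (zP c)//; apply/eqP; rewrite eq_le h//= sz.
Qed.

End Cut.

(** * Rational points and primitive vectors *)

Section Rational.
Variables (R : realType) (n : nat).
Local Notation V := 'rV[R]_n.
Implicit Types (sigma tau e S : set V) (Pi : set (set V)) (x y z v u : V).
Implicit Types (c : 'rV[int]_n * int).

Lemma rational_point_near sigma x (e : R) : rational_polyhedron sigma -> sigma x ->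
  0 < e -> exists q, [/\ sigma q, rational_points q & `|q - x| < e].
Proof.
move=> /polyhedron_ineqs[cs ->] /= sx e0.
pose conv c : {ffun 'I_n -> rat} * rat := ([ffun i => (c.1 0 i)%:~R], c.2%:~R).
have convE c (y : 'I_n -> R) : rat_affine (conv c) y = int_affine c (\row_i y i).
  rewrite /rat_affine /int_affine ratr_int; congr (_ + _).
  by apply: eq_bigr => i _; rewrite !mxE ffunE ratr_int.
have [|q qP qx] := @rational_polyhedron_dense R _ (map conv cs) (fun i => x 0 i) e e0.
  move=> _ /mapP[c ccs ->]; rewrite convE (_ : \row_i _ = x); first exact: sx.
  by apply/rowP => i; rewrite mxE.
exists (\row_i ratr (q i)); split.
- by move=> c ccs; rewrite -convE; apply: qP; exact: map_f.
- by exists (\row_i q i); apply/rowP => i; rewrite !mxE.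
- by apply: norm_lt_coord => // i; rewrite !mxE.
Qed.

Lemma vertex_rational v : rational_polyhedron [set v] -> rational_points v.
Proof. by move=> /rational_point_near-/(_ v 1 erefl ltr01)[q [/= -> ]]. Qed.

Lemma common_denominator (q : 'rV[rat]_n) : exists (D : int) (z : 'rV[int]_n),
  D != 0 /\ map_mx intr z = D%:~R *: q :> 'rV[rat]_n.
Proof.
exists (\prod_i denq (q 0 i)), (\row_i (numq (q 0 i) * \prod_(j | j != i) denq (q 0 j))).
split; first by apply/prodf_neq0 => i _; rewrite denq_eq0.
apply/rowP => i; rewrite !mxE [X in _ = X%:~R * _](bigD1 i)//= !rmorphM/=.
by rewrite [in LHS]numqE; ring.
Qed.

(** A rational vector close to $y - x$, on which the linear parts that vanish on $y - x$ vanish as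
    well, leads from the midpoint to points of the set, hence is a multiple of $y - x$. *)
Lemma rational_direction S x y : rational_polyhedron S -> collinear S -> S x -> S y ->
  x != y -> exists z : 'rV[int]_n, z != 0 /\ exists k, map_mx intr z = k *: (y - x).
Proof.
move=> /polyhedron_ineqs[cs SE] cS Sx Sy xy; pose d := y - x.
have d0 : d != 0 by rewrite subr_eq0 eq_sym.
have [i0 di0] : exists i, d 0 i != 0.
  apply/existsP; apply: contraNT d0 => /existsPn h; apply/eqP/rowP => i.
  by rewrite [RHS]mxE; apply/eqP; move: (h i); rewrite negbK.
pose cs0 := [seq c <- cs | pairing (map_mx intr c.1) d == 0].
pose B : 'M[rat]_(n, size cs0) := \matrix_(i, j) ((nth 0 cs0 j).1 0 i)%:~R.
have dB : d *m map_mx ratr B = 0.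
  apply/rowP => j; rewrite !mxE.
  have : nth 0 cs0 j \in cs0 by exact: mem_nth.
  rewrite mem_filter => /andP[/eqP h _]; rewrite -[RHS]h; apply: eq_bigr => i _.
  by rewrite !mxE ratr_int mulrC.
have di00 : 0 < `|d 0 i0| by rewrite normr_gt0.
have [q qB qd] := rational_kernel_dense di00 dB.
pose Q : V := map_mx ratr q.
have q0 : q != 0.
  apply/eqP => q0; have := qd i0; rewrite q0 mxE rmorph0 sub0r normrN ltxx//.
have QB c : c \in cs0 -> pairing (map_mx intr c.1) Q = 0.
  case/(nthP 0) => j jl <-; have /rowP/(_ (Ordinal jl)) := qB.
  rewrite !mxE => h; rewrite -[RHS](rmorph0 (@ratr R)) -h rmorph_sum; apply: eq_bigr => i _.
  by rewrite !mxE rmorphM/= ratr_int mulrC.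
pose m := x + 2^-1 *: (y - x).
have mE c : int_affine c m = (int_affine c x + int_affine c y) / 2 :> R.
  by rewrite /int_affine affine_line; field.
pose f (i : 'I_(size cs)) : R := - pairing (map_mx intr (nth 0 cs i).1) Q /
  int_affine (nth 0 cs i) m.
have [ep ep0 epf] := exists_small f (@ltr01 R).
have SP z : S z <-> forall c, c \in cs -> 0 <= int_affine c z by rewrite SE.
have Sm : S (m + ep *: Q).
  apply/SP => c ccs; rewrite /int_affine pairingDr pairingZr addrAC -/(int_affine c m).
  have [c0|c0] := boolP (c \in cs0).
    by rewrite QB// mulr0 addr0 mE divr_ge0// addr_ge0//; apply SP.
  have m0 : 0 < int_affine c m :> R.
    rewrite mE divr_gt0// lt_neqAle addr_ge0 ?andbT; [|exact: (SP x).1|exact: (SP y).1].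
    apply: contra c0; rewrite eq_sym paddr_eq0; [|exact: (SP x).1|exact: (SP y).1].
    move=> /andP[/eqP cx /eqP cy]; rewrite mem_filter ccs andbT pairingBr.
    by move: cx cy; rewrite /int_affine; move=> cx cy; apply/eqP; lra.
  case/(nthP 0) : ccs m0 => i il <- m0; have := epf (Ordinal il).
  rewrite /f/= mulrA ltr_pdivrMr// mul1r; lra.
have [t tE] := collinearP cS Sx Sy Sm xy.
have [D [z [D0 zE]]] := common_denominator q.
exists z; split.
  apply: contra_neq q0 => z0; move: zE; rewrite z0 map_mx0 => /esym/eqP.
  by rewrite scaler_eq0 intr_eq0 (negPf D0) => /eqP.
exists (D%:~R * (t - 2^-1) / ep).
have -> : map_mx intr z = D%:~R *: Q.
  apply/rowP => i; have /rowP/(_ i) := zE; rewrite !mxE => h.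
  by rewrite -ratr_int h rmorphM/= ratr_int.
have QE : Q = ((t - 2^-1) / ep) *: (y - x).
  have : ep *: Q = (t - 2^-1) *: (y - x).
    rewrite -[LHS](addKr m) tE /m; apply/rowP => i; rewrite !mxE; ring.
  by move=> /(congr1 (fun w => ep^-1 *: w)); rewrite !scalerA mulVf ?gt_eqF// scale1r mulrC.
by rewrite QE scalerA mulrA.
Qed.

(** Primitive vectors of the full lattice; those of an edge are of this kind, because
    $N \cap N_{e,R}$ is saturated in $N$. *)
Definition prim u := lattice u /\
  forall (k : int) u', lattice u' -> u = k%:~R *: u' -> k = 1 \/ k = -1.

Lemma prim_neq0 u : prim u -> u != 0.
Proof.
move=> [ul up]; apply/eqP => u0; have [|//|//] := up 0 u ul.
by rewrite scale0r.
Qed.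

Lemma latticeZ (k : int) u : lattice u -> lattice (k%:~R *: u).
Proof. by move=> [z ->]; exists (k *: z); apply/rowP => i; rewrite !mxE intrM. Qed.

Lemma latticeD u u' : lattice u -> lattice u' -> lattice (u + u').
Proof. by move=> [z ->] [z' ->]; exists (z + z'); apply/rowP => i; rewrite !mxE intrD. Qed.

Lemma primN u : prim u -> prim (- u).
Proof.
move=> [ul up]; split; first by rewrite -scaleN1r -[-1](@intrN R 1); exact: latticeZ.
move=> k u' u'l uE; have := up (- k) u' u'l; rewrite intrN scaleNr -uE opprK => /(_ erefl).
by rewrite -[-k]opprK; case => /eqP; rewrite eqr_oppLR ?opprK => /eqP ->; [right|left]; rewrite ?opprK.
Qed.

(** A vector that is not primitive is a multiple of a shorter one, in terms of the sum of the
    absolute values of the coordinates. *)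
Lemma prim_exists (z : 'rV[int]_n) : z != 0 ->
  exists u, prim u /\ exists k, (map_mx intr z : V) = k *: u.
Proof.
pose N (w : 'rV[int]_n) := (\sum_(i < n) `|w 0%R i|)%N.
have [m] := ubnP (N z); elim: m z => // m IH z zm z0.
have [pz|] := pselect (prim (map_mx intr z : V)).
  by exists (map_mx intr z); split => //; exists 1; rewrite scale1r.
move=> /not_andP[[]|]; first by exists z.
move=> /existsNP[k /existsNP[_ /not_implyP[[w ->] /not_implyP[zE /not_orP[k1 kN1]]]]].
have {}zE : z = k *: w.
  apply/rowP => i; have /rowP/(_ i) := zE; rewrite !mxE -intrM => /eqP.
  by rewrite eqr_int => /eqP.
have w0 : w != 0 by apply: contra_neq z0 => w0; rewrite zE w0 scaler0.
have k0 : k != 0 by apply: contra_neq z0 => k0; rewrite zE k0 scale0r.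
have NzE : N z = (`|k| * N w)%N.
  by rewrite /N big_distrr/=; apply: eq_bigr => i _; rewrite zE mxE abszM.
have Nw0 : (0 < N w)%N.
  rewrite lt0n; apply: contra w0; rewrite sum_nat_eq0 => /forallP h.
  by apply/eqP/rowP => i; rewrite mxE; apply/eqP; rewrite -absz_eq0; exact: (h i).
have k2 : (1 < `|k|)%N by case: k k0 k1 kN1 {zE NzE} => [[|[|k]]|[|k]].
have [|u [pu [l lE]]] := IH w _ w0.
  by rewrite -ltnS (leq_trans _ zm)// ltnS NzE ltn_Pmull.
exists u; split => //; exists (k%:~R * l); rewrite -scalerA -lE zE.
by apply/rowP => i; rewrite !mxE intrM.
Qed.

(** If the factor is $p/q$ in lowest terms, then by Bezout both vectors are multiples of one lattice
    vector, by $q$ and by $p$; primitivity gives $p, q = \pm 1$. *)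
Lemma prim_unique u u' r : prim u -> prim u' -> u' = r *: u -> u' = u \/ u' = - u.
Proof.
move=> pu pu' uE.
have [ul up] := pu; have [u'l up'] := pu'; have u0 := prim_neq0 pu.
have [[z zE] [z' z'E]] : lattice u /\ lattice u' by [].
have [i zi] : exists i, z 0 i != 0.
  apply/existsP; apply: contraNT u0 => /existsPn h; rewrite zE; apply/eqP/rowP => i.
  by rewrite !mxE; apply/eqP; rewrite intr_eq0; move: (h i); rewrite negbK.
pose q : rat := (z' 0 i)%:~R / (z 0 i)%:~R.
have rq : r = ratr q.
  have := uE; rewrite zE z'E => /rowP/(_ i); rewrite !mxE => h.
  by rewrite rmorphM/= fmorphV/= !ratr_int h mulfK// intr_eq0.
have E1 : (denq q)%:~R *: u' = (numq q)%:~R *: u.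
  rewrite uE scalerA rq; congr (_ *: _); rewrite -ratr_int -rmorphM/= mulrC -numqE.
  by rewrite ratr_int.
have [a [b ab]] : exists a b : int, a * numq q + b * denq q = 1.
  have /coprimezP[[a b] /= ab] : coprimez (numq q) (denq q) by rewrite coprimezE coprime_num_den.
  by exists a, b.
pose w := a%:~R *: u' + b%:~R *: u.
have wl : lattice w by apply: latticeD; exact: latticeZ.
have u'w : u' = (numq q)%:~R *: w.
  transitivity (a%:~R *: ((numq q)%:~R *: u') + b%:~R *: ((denq q)%:~R *: u')).
    by rewrite !scalerA -scalerDl -!intrM -intrD ab scale1r.
  by rewrite E1 scalerDr !scalerA ![(numq q)%:~R * _]mulrC.
have uw : u = (denq q)%:~R *: w.
  transitivity (a%:~R *: ((numq q)%:~R *: u) + b%:~R *: ((denq q)%:~R *: u)).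
    by rewrite !scalerA -scalerDl -!intrM -intrD ab scale1r.
  by rewrite -E1 scalerDr !scalerA ![(denq q)%:~R * _]mulrC.
have n1 := up' _ _ wl u'w; have d1 := up _ _ wl uw.
have dq1 : denq q = 1 by case: d1 => // d1; have := denq_gt0 q; rewrite d1.
move: E1; rewrite dq1 scale1r => ->.
by case: n1 => ->; [left; rewrite scale1r|right; rewrite intrN scaleN1r].
Qed.

End Rational.

(** * Edges: primitive vectors and shapes *)

Section Edges.
Variables (R : realType) (n : nat).
Local Notation V := 'rV[R]_n.
Implicit Types (sigma tau e S : set V) (x y z v u : V).
Variables (Pi : set (set V)).
Hypotheses (cPi : polyhedral_complex Pi) (tPi : thin Pi).

Lemma primitive_vectorP e u x y : edges Pi e -> e x -> e y -> x != y ->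
  primitive_vector e u <-> prim u /\ exists k, u = k *: (y - x).
Proof.
move=> [Pe _] ex ey xy; have LE := lin_spanP (tPi Pe) ex ey xy.
have LP w : lin_span e w <-> exists k, w = k *: (y - x) by rewrite LE.
rewrite /primitive_vector /local_lattice; split.
  move=> [[/LP[k uk] ul] up]; split; last by exists k.
  split => // k' u' u'l uE; apply: (up k' u') => //; split => //; apply/LP.
  have [k0|k0] := eqVneq k' 0.
    have [] : (0 : int) = 1 \/ (0 : int) = -1 => //; apply: (up 0 u); last first.
      by rewrite scale0r uE k0 scale0r.
    by split => //; apply/LP; exists k.
  exists (k'%:~R^-1 * k); rewrite -scalerA -uk uE scalerA mulVf ?scale1r// intr_eq0//.
move=> [[ul up] uk]; split; first by split => //; apply/LP.
by move=> k u' [_ u'l]; exact: up.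
Qed.

Lemma edge_two_points e : edges Pi e -> exists x y, [/\ e x, e y & x != y].
Proof. by move=> /(edgeP cPi tPi)[]. Qed.

Lemma primitive_prim e u : edges Pi e -> primitive_vector e u -> prim u.
Proof.
move=> Ee; have [x [y [ex ey xy]]] := edge_two_points Ee.
by move=> /(primitive_vectorP u Ee ex ey xy)[].
Qed.

Lemma primitive_line e u x y : edges Pi e -> primitive_vector e u -> e x -> e y ->
  exists t, y = x + t *: u.
Proof.
move=> Ee pu ex ey; have [->|xy] := eqVneq y x; first by exists 0; rewrite scale0r addr0.
have /(primitive_vectorP u Ee ex ey)[|/prim_neq0 u0 [k uk]] := pu; first by rewrite eq_sym.
have k0 : k != 0 by apply: contra_neq u0 => k0; rewrite uk k0 scale0r.
by exists k^-1; rewrite uk scalerA mulVf// scale1r addrC subrK.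
Qed.

Lemma primitive_vector_of e u x y t : edges Pi e -> prim u -> e x -> e y -> t != 0 ->
  y = x + t *: u -> primitive_vector e u.
Proof.
move=> Ee pu ex ey t0 yE.
have xy : x != y.
  by rewrite yE eq_sym addrC -subr_eq0 addrK scaler_eq0 negb_or t0 prim_neq0.
apply/(primitive_vectorP u Ee ex ey xy); split => //; exists t^-1.
by rewrite yE addrC addKr scalerA mulVf// scale1r.
Qed.

Lemma primitive_vector_unique e u u' : edges Pi e -> primitive_vector e u ->
  primitive_vector e u' -> u' = u \/ u' = - u.
Proof.
move=> Ee pu pu'; have [x [y [ex ey xy]]] := edge_two_points Ee.
have [t yE] := primitive_line Ee pu ex ey.
have /(primitive_vectorP u' Ee ex ey xy)[pu'' [k u'E]] := pu'.
apply: (@prim_unique _ _ _ _ (k * t)) => //; first exact: primitive_prim pu.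
by rewrite u'E yE addrC addKr scalerA.
Qed.

Lemma edge_primitive e : edges Pi e -> exists u, primitive_vector e u.
Proof.
move=> Ee; have [x [y [ex ey xy]]] := edge_two_points Ee.
have [Pe _] := Ee.
have [z [z0 [k zE]]] := rational_direction (cell_polyhedron cPi Pe) (tPi Pe) ex ey xy.
have [u [pu [l lE]]] := @prim_exists R n z z0.
have l0 : l != 0.
  apply: contra_neq z0 => l0; apply/rowP => i; move: lE; rewrite l0 scale0r => /rowP/(_ i).
  by rewrite !mxE => /eqP; rewrite intr_eq0 => /eqP.
exists u; apply/(primitive_vectorP u Ee ex ey xy); split => //; exists (l^-1 * k).
by rewrite -scalerA -zE lE scalerA mulVf// scale1r.
Qed.

Lemma starP e v : star Pi v e <-> [/\ edges Pi e, Pi [set v] & e v].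
Proof.
split=> [[Ee fe]|[Ee Pv ev]].
  split => //; first by apply: (cell_face cPi _ fe) => //; case: Ee.
  exact: (face_sub fe).
by split => //; apply: (vertex_face cPi) => //; case: Ee.
Qed.

(** Of the two primitive vectors of the edge, one points from the end point into the edge. *)
Lemma primitive_at_exists e v : star Pi v e -> exists u, primitive_vector e u /\
  exists2 eps : R, 0 < eps & e (v + eps *: u).
Proof.
move=> /starP[Ee Pv ev]; have [u pu] := edge_primitive Ee.
have [w [ew vw]] : exists w, e w /\ v != w.
  have [x [y [ex ey xy]]] := edge_two_points Ee.
  by have [vx|vx] := eqVneq v x; [exists y; rewrite vx|exists x].
have [t wE] := primitive_line Ee pu ev ew.
have [t0|t0|t0] := ltgtP t 0.
- exists (- u); split; last by exists (- t); rewrite ?oppr_gt0// scaleNr scalerN opprK -wE.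
  apply: (@primitive_vector_of _ _ v w (- t)) => //; rewrite ?scaleNr ?scalerN ?opprK ?oppr_eq0 ?lt_eqF//.
  exact/primN/(primitive_prim Ee).
- by exists u; split => //; exists t; rewrite -?wE.
- by move: vw; rewrite wE t0 scale0r addr0 eqxx.
Qed.

Lemma primitive_atP e v : star Pi v e -> primitive_vector e (primitive_at e v) /\
  exists2 eps : R, 0 < eps & e (v + eps *: primitive_at e v).
Proof.
move=> /primitive_at_exists[u uP].
exact: (@getPex _ [set u | primitive_vector e u /\
  exists2 eps : R, 0 < eps & e (v + eps *: u)] (ex_intro _ u uP)).
Qed.

Lemma star_halfline e v u : star Pi v e -> primitive_vector e u ->
  (exists2 eps : R, 0 < eps & e (v + eps *: u)) ->
  forall x, e x -> exists2 t, 0 <= t & x = v + t *: u.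
Proof.
move=> Sev pu [eps e0 eeps] x ex; have [Ee fe] := Sev; have /starP[_ _ ev] := Sev.
have [t xE] := primitive_line Ee pu ev ex; exists t => //.
rewrite leNgt; apply/negP => t0.
have d0 : 0 < eps - t by rewrite subr_gt0 (lt_trans t0).
have [|||_] := face_point_extreme (t := - t / (eps - t)) fe ex eeps.
- by rewrite xE; apply/rowP => i; rewrite !mxE; field; rewrite gt_eqF.
- by rewrite divr_gt0// oppr_gt0.
- by rewrite ltr_pdivrMr// mul1r ltrDr.
have u0 : u != 0 by apply/prim_neq0/(primitive_prim Ee).
move=> /eqP; rewrite addrC -subr_eq0 addrK scaler_eq0 (negPf u0) orbF gt_eqF//.
Qed.

Lemma primitive_at_unique e v u : star Pi v e -> primitive_vector e u ->
  (exists2 eps : R, 0 < eps & e (v + eps *: u)) -> primitive_at e v = u.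
Proof.
move=> Sev pu hu; have [pu' [ep ep0 eep]] := primitive_atP Sev; have [Ee _] := Sev.
have [//|uN] := primitive_vector_unique Ee pu pu'.
have [t t0] := star_halfline Sev pu hu eep; rewrite uN => /eqP.
rewrite -subr_eq0 opprD addrACA subrr add0r scalerN -opprD -scalerDl oppr_eq0 scaler_eq0.
by rewrite gt_eqF ?ltr_wpDr//= (negPf (prim_neq0 (primitive_prim Ee pu))).
Qed.

Definition is_ray e v u := forall x, e x <-> exists2 t : R, 0 <= t & x = v + t *: u.
Definition is_segment e v u (L : R) :=
  0 < L /\ forall x, e x <-> exists2 t, 0 <= t <= L & x = v + t *: u.

Lemma ray_closed (u v : V) S : closed S -> closed [set t : R | S (v + t *: u)].
Proof.
move=> cS; apply: (@closed_comp _ _ (fun t : R => v + t *: u)) => // t _.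
apply: cvgD; [exact: cvg_cst|apply: cvgZr_tmp; exact: cvg_id].
Qed.

(** An edge with end point $v$ is an interval in its half-line; its length is the supremum of
    the parameters, attained because the edge is closed. *)
Lemma edge_shape e v u : star Pi v e -> u = primitive_at e v ->
  is_ray e v u \/ exists L, is_segment e v u L.
Proof.
move=> Sev uE; have [pu hu] := primitive_atP Sev; rewrite -uE in pu hu.
have half := star_halfline Sev pu hu; have [[Pe _] _] := Sev; have /starP[_ _ ev] := Sev.
have down t s : e (v + t *: u) -> 0 <= s <= t -> e (v + s *: u).
  move=> et /andP[s0 st]; have [t0|t0] := eqVneq t 0.
    by rewrite (_ : s = 0) ?scale0r ?addr0//; apply/eqP; rewrite eq_le s0 -t0 st.
  have tgt0 : 0 < t by rewrite lt_neqAle eq_sym t0 (le_trans s0).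
  have := @cell_convex _ _ _ cPi _ Pe v (v + t *: u) (s / t) ev et.
  rewrite [v + _ - v]addrC addKr scalerA mulfVK//; apply; first by rewrite divr_ge0// ltW.
  by rewrite ler_pdivrMr// mul1r.
pose T := [set t | 0 <= t /\ e (v + t *: u)].
have T0 : T 0 by split; rewrite ?scale0r ?addr0.
have [bT|ubT] := pselect (has_ubound T); last first.
  left => x; split => [/half//|[t t0 ->]].
  apply: contrapT => et; apply: ubT; exists t => s [s0 es]; rewrite leNgt; apply/negP => ts.
  by apply: et; apply: down es _; rewrite t0 ltW.
right; have sT : has_sup T by split => //; exists 0.
pose L := sup T.
have TL t : T t -> t <= L by move=> Tt; exact: (ub_le_sup bT).
have eL : T L.
  have cT : closed T.
    rewrite (_ : T = [set t | 0 <= t] `&` [set t | e (v + t *: u)])//.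
    by apply: closedI; [exact: closed_ge|apply: ray_closed; exact: (cell_closed cPi Pe)].
  by apply: cT; apply: closure_sup => //; exists 0.
exists L; split.
  by have [ep ep0 eep] := hu; rewrite (lt_le_trans ep0)// TL//; split => //; exact: ltW.
move=> x; split => [ex|[t /andP[t0 tL] ->]]; last by apply: down (eL.2) _; rewrite t0.
by have [t t0 xE] := half x ex; exists t => //; rewrite t0 TL//; split=> //; rewrite -xE.
Qed.

Lemma segment_end e v u L : star Pi v e -> u = primitive_at e v ->
  is_segment e v u L -> star Pi (v + L *: u) e /\ primitive_at e (v + L *: u) = - u.
Proof.
move=> Sev uE [L0 eP]; have [pu hu] := primitive_atP Sev; rewrite -uE in pu hu.
have [Ee _] := Sev; have pru := primitive_prim Ee pu.
have eL : e (v + L *: u) by apply/eP; exists L => //; rewrite lexx ltW.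
have ev : e v by apply/eP; exists 0; rewrite ?lexx ?ltW// scale0r addr0.
have S' : star Pi (v + L *: u) e.
  split => //; apply: (@face_endpoint _ _ _ (- u)) => //.
    by rewrite oppr_eq0 prim_neq0.
  move=> x /eP[t /andP[t0 tL] ->]; exists (L - t); first by rewrite subr_ge0.
  by apply/rowP => i; rewrite !mxE; ring.
split => //; have vE : v = v + L *: u + L *: - u by rewrite scalerN addrK.
apply: primitive_at_unique => //; last by exists L; rewrite // -vE.
by apply: primitive_vector_of vE => //; [exact: primN|rewrite gt_eqF].
Qed.

(** An extreme point of a segment is one of its ends. *)
Lemma segment_vertices e v u L x : star Pi v e -> u = primitive_at e v ->
  is_segment e v u L -> star Pi x e <-> (x = v \/ x = v + L *: u).
Proof.
move=> Sev uE sg; have [S' _] := segment_end Sev uE sg; split; last by case=> ->.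
have [L0 eP] := sg.
move=> Sx; have /starP[_ _ /eP[t /andP[t0 tL] xE]] := Sx.
have [t0'|tgt0] := eqVneq t 0; first by left; rewrite xE t0' scale0r addr0.
have [tL'|tltL] := eqVneq t L; first by right; rewrite xE tL'.
have ev : e v by have /starP[] := Sev.
have eL : e (v + L *: u) by have /starP[] := S'.
have [|||-> _] := face_point_extreme (t := t / L) Sx.2 ev eL; last by left.
- by rewrite xE; apply/rowP => i; rewrite !mxE; field; rewrite gt_eqF.
- by rewrite divr_gt0// lt_neqAle eq_sym tgt0.
- by rewrite ltr_pdivrMr// mul1r lt_neqAle tltL.
Qed.

Lemma ray_vertices e v u x : star Pi v e -> u = primitive_at e v ->
  is_ray e v u -> star Pi x e <-> x = v.
Proof.
move=> Sev uE eP; split; last by move=> ->.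
move=> Sx; have /starP[_ _ /eP[t t0 xE]] := Sx.
have [t0'|tgt0] := eqVneq t 0; first by rewrite xE t0' scale0r addr0.
have ev : e v by have /starP[] := Sev.
have e2 : e (v + (t + t) *: u) by apply/eP; exists (t + t) => //; rewrite addr_ge0.
have [|||-> _] := face_point_extreme (t := 2^-1) Sx.2 ev e2 => //.
- by rewrite xE; apply/rowP => i; rewrite !mxE; field.
- lra.
Qed.

(** The coordinate in which the direction does not vanish is bounded below or above on the edge,
    so that the edge is not a line and ends on that side. *)
Lemma edge_has_vertex e : edges Pi e ->
  (forall i, (forall x, e x -> 0 <= x 0 i) \/ (forall x, e x -> x 0 i <= 0)) ->
  exists v, star Pi v e.
Proof.
move=> Ee sgn; have [u pu] := edge_primitive Ee.
have [x0 ex0] : e !=set0 by apply: (cell_nonempty cPi); case: Ee.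
have u0 := prim_neq0 (primitive_prim Ee pu).
have key u' : primitive_vector e u' -> u' != 0 ->
    has_ubound [set t : R | e (x0 + t *: u')] -> exists v, star Pi v e.
  move=> pu' u'0 ub; pose T := [set t : R | e (x0 + t *: u')].
  have T0 : T 0 by rewrite /T/= scale0r addr0.
  have Ta : T (sup T).
    have cT : closed T by apply: ray_closed; apply: (cell_closed cPi); case: Ee.
    by apply: cT; apply: closure_sup => //; exists 0.
  exists (x0 + sup T *: u'); split => //.
  apply: (@face_endpoint _ _ _ (- u')) => //; first by rewrite oppr_eq0.
  move=> x ex; have [t xE] := primitive_line Ee pu' ex0 ex.
  exists (sup T - t); last by rewrite xE; apply/rowP => i; rewrite !mxE; ring.
  by rewrite subr_ge0; apply: ub_le_sup => //; rewrite /T/= -xE.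
have puN : primitive_vector e (- u).
  have [x [y [ex ey xy]]] := edge_two_points Ee.
  move: pu => /(primitive_vectorP _ Ee ex ey xy)[pu [k kE]].
  apply/(primitive_vectorP _ Ee ex ey xy); split; first exact: primN.
  by exists (- k); rewrite scaleNr -kE.
have uN0 : - u != 0 by rewrite oppr_eq0.
have [i ui] : exists i, u 0 i != 0.
  apply/existsP; apply: contraNT u0 => /existsPn h; apply/eqP/rowP => i.
  by rewrite [RHS]mxE; apply/eqP; move: (h i); rewrite negbK.
have bd (u' : V) : u' 0 i < 0 -> (forall x, e x -> 0 <= x 0 i) ->
    has_ubound [set t : R | e (x0 + t *: u')].
  move=> ui0 h; exists (- (x0 0 i) / u' 0 i) => t /= /h; rewrite !mxE ler_ndivlMr//; lra.
have bd' (u' : V) : 0 < u' 0 i -> (forall x, e x -> x 0 i <= 0) ->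
    has_ubound [set t : R | e (x0 + t *: u')].
  move=> ui0 h; exists (- (x0 0 i) / u' 0 i) => t /= /h; rewrite !mxE ler_pdivlMr//; lra.
have [ui0|ui0|ui0] := ltgtP (u 0 i) 0; last by rewrite ui0 eqxx in ui.
- have [h|h] := sgn i; [apply: (key u)|apply: (key (- u))] => //; first exact: bd.
  by apply: bd' => //; rewrite mxE oppr_gt0.
- have [h|h] := sgn i; [apply: (key (- u))|apply: (key u)] => //; last exact: bd'.
  by apply: bd => //; rewrite mxE oppr_lt0.
Qed.

End Edges.

(** * Fine subdivisions *)

Section Refinement.
Variables (R : realType) (n : nat).
Local Notation V := 'rV[R]_n.
Implicit Types (sigma tau e S : set V) (x y z v u : V) (Pi : set (set V)).

(** Cutting along the hyperplanes $N x_i = k$ with $|k| \le K$. *)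
Lemma grid_structure (X : set V) Pi (N K : nat) : one_dim_polyhedral_space X ->
  polyhedral_structure X Pi -> exists Pi', [/\ polyhedral_structure X Pi', refines Pi' Pi &
    forall s (i : 'I_n) (k : int), Pi' s -> `|k| <= K%:Z ->
      (forall x, s x -> k%:~R <= N%:R * x 0 i) \/ (forall x, s x -> N%:R * x 0 i <= k%:~R)].
Proof.
move=> oX sPi.
pose form (i : 'I_n) (k : int) : 'rV[int]_n * int := (N%:Z *: delta_mx 0 i, - k).
have formE i k x : int_affine (form i k) x = N%:R * x 0 i - k%:~R :> R.
  rewrite /int_affine -[(form i k).1]/(N%:Z *: delta_mx 0 i) -[(form i k).2]/(- k) mulrNz.
  congr (_ - _); rewrite -[x in RHS](scale1r) ?scale1r.
  rewrite (_ : map_mx _ _ = N%:R *: delta_mx 0 i) ?pairingZl ?pairing_delta//.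
  by apply/rowP => j; rewrite !mxE intrM; case: (_ && _).
pose cs := [seq form i (j%:Z - K%:Z) | i <- enum 'I_n, j <- iota 0 (2 * K).+1].
have [Pi' [sPi' rPi' csPi']] := constant_sign_structure cs oX sPi.
exists Pi'; split => // s i k Ps kK.
have [|h|h] := csPi' s (form i k) Ps; last 2 first.
- by left => x /h; rewrite formE subr_ge0.
- by right => x /h; rewrite formE subr_le0.
apply/allpairsP; exists (i, absz (k + K%:Z)); split; first by rewrite mem_enum.
  by rewrite -[_.2]/(absz (k + K%:Z)) mem_iota; lia.
by rewrite -[_.2]/(absz (k + K%:Z)) -[_.1]/i; congr form; lia.
Qed.

(** Cells of the grid of mesh $1/N$ are small where the grid extends, that is inside a large box.
    The hyperplanes $x_i = 0$ are part of the grid, so that no edge is a whole line. *)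
Lemma fine_structure (X : set V) Pi (T eta : R) : one_dim_polyhedral_space X ->
  polyhedral_structure X Pi -> 0 < eta -> exists Pi',
  [/\ polyhedral_structure X Pi', refines Pi' Pi,
    forall e, edges Pi' e -> exists v, star Pi' v e &
    forall s x y, Pi' s -> s x -> s y -> `|x - y| <= eta \/ (T <= `|x| /\ T <= `|y|)].
Proof.
move=> oX sPi eta0.
(* The mesh $1/N$ is at most [eta], and the grid reaches up to $M \ge T$. *)
pose N := (Num.bound (eta^-1)).+1; pose M := Num.bound `|T|.
have NE : N%:R^-1 <= eta :> R.
  have ei : 0 <= eta^-1 by rewrite invr_ge0 ltW.
  rewrite invf_ple ?posrE// (le_trans (ltW (archi_boundP ei)))//.
  by rewrite ler_nat /N; exact: leqnSn.
have TM : T <= M%:R.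
  by rewrite (le_trans (ler_norm _))// ltW// archi_boundP.
have [Pi' [sPi' rPi' gPi']] := grid_structure N (N * M)%N oX sPi.
have [cPi' _] := sPi'; have tPi' := structure_thin oX sPi'.
exists Pi'; split => //.
  move=> e Ee; apply: (edge_has_vertex cPi' tPi') => // i.
  have Pe : Pi' e by case: Ee.
  have k0 : `|0 : int| <= (N * M)%N%:Z by rewrite normr0.
  have [h|h] := gPi' e i 0 Pe k0; [left|right] => x /h.
    by rewrite pmulr_rge0.
  by rewrite pmulr_rle0.
have near1 s x y i : Pi' s -> s x -> s y -> `|x 0 i| < M%:R -> x 0 i - y 0 i <= N%:R^-1.
  move=> Ps sx sy xM; have N0 : 0 < N%:R :> R by [].
  pose k : int := - (Num.floor (- (N%:R * x 0 i)) + 1).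
  have /andP[f1 f2] := floor_itv (- (N%:R * x 0 i)).
  have k1 : N%:R * x 0 i - 1 <= k%:~R by rewrite /k intrN intrD; lra.
  have k2 : k%:~R < N%:R * x 0 i by rewrite /k intrN; lra.
  have [|h|h] := gPi' s i k Ps; last 2 first.
  - by have h' := h _ sy; rewrite -(ler_pM2l N0) mulfV ?gt_eqF// mulrBr; lra.
  - by have := h _ sx; lra.
  have kM1 : k%:~R < (N * M)%:Z%:~R :> R.
    rewrite (lt_trans k2)// -[_%:~R]/((N * M)%:R) natrM ltr_pM2l//.
    by rewrite (le_lt_trans (ler_norm _)).
  have kM2 : (- (N * M)%:Z - 1)%:~R < k%:~R :> R.
    rewrite intrB intrN -[_%:Z%:~R]/((N * M)%:R) natrM (lt_le_trans _ k1)// ltrD2r.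
    by rewrite -mulrN ltr_pM2l//; move: xM; rewrite ltr_norml => /andP[].
  by rewrite !ltr_int in kM1 kM2; lia.
have near1' s x y i : Pi' s -> s x -> s y -> `|x 0 i| < M%:R -> y 0 i - x 0 i <= N%:R^-1.
  move=> Ps sx sy xM; have N0 : 0 < N%:R :> R by [].
  pose k : int := Num.floor (N%:R * x 0 i) + 1.
  have /andP[f1 f2] := floor_itv (N%:R * x 0 i).
  have k1 : k%:~R <= N%:R * x 0 i + 1 by rewrite /k intrD; lra.
  have k2 : N%:R * x 0 i < k%:~R by rewrite /k.
  have [|h|h] := gPi' s i k Ps; last 2 first.
  - by have := h _ sx; lra.
  - by have h' := h _ sy; rewrite -(ler_pM2l N0) mulfV ?gt_eqF// mulrBr; lra.
  have kM1 : - (N * M)%:Z%:~R < k%:~R :> R.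
    rewrite (lt_trans _ k2)// -[_%:~R]/((N * M)%:R) natrM -mulrN ltr_pM2l//.
    by move: xM; rewrite ltr_norml => /andP[].
  have kM2 : k%:~R < ((N * M)%:Z + 1)%:~R :> R.
    rewrite intrD -[_%:Z%:~R]/((N * M)%:R) natrM (le_lt_trans k1)// ltrD2r.
    by rewrite ltr_pM2l//; move: xM; rewrite ltr_norml => /andP[].
  by rewrite -intrN !ltr_int in kM1; rewrite ltr_int in kM2; lia.
have near2 s x y : Pi' s -> s x -> s y -> `|x| < T -> `|x - y| <= eta.
  move=> Ps sx sy xT; apply: norm_le_coord; first exact: ltW.
  move=> i; rewrite !mxE.
  have xM : `|x 0 i| < M%:R by rewrite (le_lt_trans (coord_le_norm _ _))// (lt_le_trans xT).
  have := near1 s x y i Ps sx sy xM; have := near1' s x y i Ps sx sy xM.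
  by rewrite ler_norml; move: NE; lra.
move=> s x y Ps sx sy; have [xT|xT] := ltP `|x| T; first by left; apply: (near2 s).
have [yT|yT] := ltP `|y| T; first by left; rewrite distrC; apply: (near2 s).
by right.
Qed.

End Refinement.

(** * Germs of the space at a point *)

Section Germs.
Variables (R : realType) (n : nat).
Local Notation V := 'rV[R]_n.
Implicit Types (sigma tau e S X : set V) (x y z v u : V) (Pi : set (set V)).

(** The primitive directions in which the space leaves $x$: an intrinsic version of the star of
    a vertex, which makes sums over stars independent of the structure. *)
Definition germs X x : set V := [set u | prim u /\
  exists2 eps : R, 0 < eps & forall t, 0 <= t <= eps -> X (x + t *: u)].

(** The union of the cells that do not contain $x$ is closed, so that points of the germ close to $x$
    lie in cells that contain $x$. *)
Lemma germ_cell X Pi x u : polyhedral_structure X Pi -> germs X x u ->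
  exists2 sigma, Pi sigma & sigma x /\ exists2 t : R, 0 < t & sigma (x + t *: u).
Proof.
move=> [cPi XE] [pu [eps eps0 epsP]].
pose F := \bigcup_(s in Pi `&` [set s | ~ s x]) s.
have cF : closed F.
  apply: closed_bigcup => [|s [Ps _]]; last exact: (cell_closed cPi Ps).
  by have [h _ _ _] := cPi; apply: sub_finite_set h; exact: subIsetl.
have Fx : ~ F x by move=> [s [_ /= sx]].
have [d d0 dF] : exists2 d, 0 < d & forall y, F y -> d <= `|y - x|.
  apply: contrapT => h; apply: Fx; move/closedP_eps: cF; apply => d d0.
  apply: contrapT => h'; apply: h; exists d => // y Fy; rewrite leNgt; apply/negP => yx.
  by apply: h'; exists y.
have u0 : 0 < `|u| by rewrite normr_gt0 prim_neq0.
pose t := Num.min eps (d / (2 * `|u|)).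
have t0 : 0 < t by rewrite lt_min eps0 divr_gt0// mulr_gt0.
have : X (x + t *: u) by apply: epsP; rewrite ltW//= ge_min lexx.
rewrite -XE => -[s Ps sxt]; exists s => //.
have [sx|sx] := pselect (s x); first by split => //; exists t.
have : d <= `|x + t *: u - x| by apply: dF; exists s.
rewrite addrC addKr normrZ gtr0_norm// leNgt -ltr_pdivlMr//.
rewrite (le_lt_trans (_ : t <= d / (2 * `|u|)))//; first by rewrite ge_min lexx orbT.
by rewrite ltr_pM2l// ltf_pV2 ?posrE ?mulr_gt0// ltr_pMl// ltr1n.
Qed.

Lemma cell_germ X Pi sigma x u (t : R) : polyhedral_structure X Pi -> Pi sigma -> prim u ->
  sigma x -> 0 < t -> sigma (x + t *: u) -> germs X x u.
Proof.
move=> [cPi XE] Ps pu sx t0 st; split => //; exists t => // s /andP[s0 st'].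
rewrite -XE; exists sigma => //.
have := cell_convex cPi Ps sx st (t := s / t).
rewrite [x + _ - x]addrC addKr scalerA mulfVK ?gt_eqF//; apply.
  by rewrite divr_ge0// ltW.
by rewrite ler_pdivrMr// mul1r.
Qed.

Lemma star_germs_bij X Pi x : one_dim_polyhedral_space X -> polyhedral_structure X Pi ->
  Pi [set x] -> set_bij (star Pi x) (germs X x) (fun e => primitive_at e x).
Proof.
move=> oX sPi Px; have tPi := structure_thin oX sPi; have [cPi XE] := sPi.
split.
- move=> e Se; have [pu [t t0 et]] := primitive_atP cPi tPi Se.
  have [Ee _ ex] := (starP cPi _ _).1 Se; have [Pe _] := Ee.
  exact: cell_germ sPi Pe (primitive_prim cPi tPi Ee pu) ex t0 et.
- move=> e e'; rewrite !inE => Se Se' ee'.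
  have [pu [t t0 et]] := primitive_atP cPi tPi Se.
  have [_ [t' t'0 et']] := primitive_atP cPi tPi Se'; rewrite -ee' in et'.
  have [Ee _ ex] := (starP cPi _ _).1 Se; have [Ee' _ ex'] := (starP cPi _ _).1 Se'.
  pose u := primitive_at e x; have u0 := prim_neq0 (primitive_prim cPi tPi Ee pu).
  pose s := Num.min t t'; have s0 : 0 < s by rewrite lt_min t0.
  have mid (T : R) E : Pi E -> E x -> E (x + T *: u) -> s <= T -> E (x + s *: u).
    move=> PE Ex ET sT; have T0 : 0 < T by rewrite (lt_le_trans s0).
    have := cell_convex cPi PE Ex ET (t := s / T).
    rewrite [x + _ - x]addrC addKr scalerA mulfVK ?gt_eqF//; apply.
      by rewrite divr_ge0// ltW.
    by rewrite ler_pdivrMr// mul1r.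
  apply: (edge_unique cPi tPi (x := x) (y := x + s *: u) Ee Ee') => //.
  + by apply: mid ex et _ => //; [case: Ee|rewrite ge_min lexx].
  + by apply: mid ex' et' _ => //; [case: Ee'|rewrite ge_min lexx orbT].
  + by rewrite eq_sym addrC -subr_eq0 addrK scaler_eq0 negb_or u0 gt_eqF.
- move=> u gu; have [e Pe [ex [t t0 et]]] := germ_cell sPi gu; have [pu _] := gu.
  have Ee : edges Pi e.
    apply/(edgeP cPi tPi); split => //; exists x, (x + t *: u); split => //.
    by rewrite eq_sym addrC -subr_eq0 addrK scaler_eq0 negb_or prim_neq0// gt_eqF.
  have Se : star Pi x e by apply/(starP cPi).
  exists e => //; apply: (primitive_at_unique cPi tPi) => //; last by exists t.
  by apply: (primitive_vector_of tPi Ee pu ex et) => //; rewrite gt_eqF.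
Qed.

(** A point that is not a vertex lies inside an edge, and in no other cell. *)
Lemma germs_interior X Pi x : one_dim_polyhedral_space X -> polyhedral_structure X Pi ->
  X x -> ~ Pi [set x] -> exists e u, [/\ edges Pi e, primitive_vector e u,
    exists2 eps : R, 0 < eps & forall t, `|t| <= eps -> e (x + t *: u) &
    germs X x = [set u; - u]].
Proof.
move=> oX sPi Xx Px; have tPi := structure_thin oX sPi; have [cPi XE] := sPi.
have [e Pe ex] : Defs.support Pi x by rewrite XE.
have Ee : edges Pi e.
  apply/(edgeP cPi tPi); split => //; apply: contrapT => h; apply: Px.
  rewrite (_ : [set x] = e)//; apply/seteqP; split => y /=; [by move=> ->|move=> ey].
  by apply/eqP; apply: contra_notT h => yx; exists y, x.
have [u pu] := edge_primitive cPi tPi Ee.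
have pru := primitive_prim cPi tPi Ee pu; have u0 := prim_neq0 pru.
have side w : prim w -> (exists c, c != 0 /\ w = c *: u) ->
    exists2 t : R, 0 < t & e (x + t *: w).
  move=> pw [c [c0 wE]]; apply: contrapT => h; apply: Px; apply: (cell_face cPi Pe).
  apply: (@face_endpoint _ _ _ (- w)) => //; first by rewrite oppr_eq0 prim_neq0.
  move=> y ey; have [t yE] := primitive_line tPi Ee pu ex ey.
  have yE' : y = x + (t / c) *: w by rewrite wE scalerA mulfVK.
  exists (- (t / c)); last by rewrite scalerN scaleNr opprK.
  rewrite oppr_ge0 leNgt; apply/negP => tc; apply: h; exists (t / c) => //.
  by rewrite -yE'.
have [|t1 t10 et1] := side u pru; first by exists 1; rewrite oner_neq0 scale1r.
have [|t2 t20 et2] := side (- u) (primN pru).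
  by exists (-1); rewrite oppr_eq0 oner_neq0 scaleN1r.
pose eps := Num.min t1 t2.
have eps0 : 0 < eps by rewrite lt_min t10.
have inte t : `|t| <= eps -> e (x + t *: u).
  rewrite ler_norml le_min lerNl le_min => /andP[/andP[h1 h2] /andP[h3 h4]].
  have t12 : 0 < t1 + t2 by rewrite addr_gt0.
  have := cell_convex cPi Pe et2 et1 (t := (t + t2) / (t1 + t2)).
  rewrite (_ : x + t2 *: - u + _ = x + t *: u); last first.
    by apply/rowP => i; rewrite !mxE; field; rewrite gt_eqF.
  by apply; [apply: divr_ge0; lra|rewrite ler_pdivrMr// mul1r; lra].
exists e, u; split => //; first by exists eps.
apply/seteqP; split => w /=; last first.
  move=> [->|->]; first by apply: (cell_germ sPi Pe pru ex t10).
  exact: (cell_germ sPi Pe (primN pru) ex t20).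
move=> gw; have [s Ps [sx [t t0 st]]] := germ_cell sPi gw; have [pw _] := gw.
have es : e `<=` s.
  have [_ _ _ /(_ _ _ Pe Ps)[h|[fe _]]] := cPi; first by have : (e `&` s) x by []; rewrite h.
  have [_ [m [b [mb E]]]] := fe.
  have mx : pairing m x + b = 0 by have : (e `&` s) x by []; rewrite E => -[].
  have mu : pairing m (x + eps *: u) + b = 0 /\ pairing m (x + (- eps) *: u) + b = 0.
    have := mb _ (inte eps _); have := mb _ (inte (- eps) _).
    rewrite normrN gtr0_norm// lexx => /(_ erefl) h1 /(_ erefl) h2.
    by move: mx h1 h2; rewrite !pairingDr !pairingZr; lra.
  have eps_e : e (x + eps *: u) by apply: inte; rewrite gtr0_norm.
  have eps_es : (e `&` s) (x + eps *: u) by rewrite E; split => //; exact: mu.1.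
  rewrite -(face_two_points (tPi _ Pe) fe (x := x) (y := x + eps *: u)) => //.
  by rewrite eq_sym addrC -subr_eq0 addrK scaler_eq0 negb_or u0 gt_eqF.
have Es : edges Pi s.
  apply/(edgeP cPi tPi); split => //; exists x, (x + t *: w); split => //.
  by rewrite eq_sym addrC -subr_eq0 addrK scaler_eq0 negb_or prim_neq0// gt_eqF.
have pus : primitive_vector s u.
  apply: (primitive_vector_of tPi Es pru sx (es _ et1)) => //; by rewrite gt_eqF.
have pws : primitive_vector s w.
  apply: (primitive_vector_of tPi Es pw sx st) => //; by rewrite gt_eqF.
exact: (primitive_vector_unique cPi tPi Es pus pws).
Qed.

End Germs.

(** * Weighted sums of slopes *)

Section Mass.
Variables (R : realType) (n : nat) (X : balanced_space R n).
Local Notation V := 'rV[R]_n.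
Implicit Types (sigma tau e S : set V) (x y z v u : V) (Pi : set (set V)).

Lemma bs_one_dim : one_dim_polyhedral_space X. Proof. by case: X. Qed.

Lemma bs_poly : polyhedral_structure X (bs_structure X). Proof. by case: X. Qed.

Lemma bs_weight_gt0 e : edges (bs_structure X) e -> 0 < bs_weight X e.
Proof. by case: X => ? ? ? ? ? h ?; exact: h. Qed.

Lemma bs_balanced v : vertices (bs_structure X) v ->
  \sum_(e \in star (bs_structure X) v) (ratr (bs_weight X e) : R) *: primitive_at e v = 0.
Proof. by case: X => ? ? ? ? ? ? h; exact: h. Qed.

Let oX := bs_one_dim.

Lemma structure_complex Pi : polyhedral_structure X Pi -> polyhedral_complex Pi.
Proof. by case. Qed.

Lemma structure_thinX Pi : polyhedral_structure X Pi -> thin Pi.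
Proof. exact: structure_thin. Qed.

Lemma structure_sub Pi sigma : polyhedral_structure X Pi -> Pi sigma -> sigma `<=` X.
Proof. by move=> [_ <-] Ps x sx; exists sigma. Qed.

Lemma finite_vertices Pi : polyhedral_structure X Pi -> finite_set (vertices Pi).
Proof.
move=> [[fPi _ _ _] _]; apply: (@sub_finite_set _ _ ((fun s => get s) @` Pi)).
  by move=> v Pv; exists [set v] => //; apply: get_unique.
exact: finite_image.
Qed.

Lemma finite_edges Pi : polyhedral_structure X Pi -> finite_set (edges Pi).
Proof. by move=> [[fPi _ _ _] _]; apply: sub_finite_set fPi => s []. Qed.

Lemma finite_star Pi v : polyhedral_structure X Pi -> finite_set (star Pi v).
Proof. by move=> /finite_edges; apply: sub_finite_set => s []. Qed.

Definition germ_weight x u : R := ratr (bs_weight X (get [set e0 |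
  edges (bs_structure X) e0 /\ e0 x /\ exists2 t : R, 0 < t & e0 (x + t *: u)])).

Lemma prim_shift x u (t : R) : prim u -> t != 0 -> x != x + t *: u.
Proof.
by move=> pu t0; rewrite eq_sym addrC -subr_eq0 addrK scaler_eq0 negb_or t0 prim_neq0.
Qed.

Lemma refined_edge Pi e : weighted_structure X Pi -> edges Pi e ->
  exists2 e0, edges (bs_structure X) e0 & e `<=` e0.
Proof.
move=> [sPi rPi] Ee; have [e0 Pe0 ee0] := rPi _ Ee.1.
exists e0 => //; apply/(edgeP (structure_complex bs_poly) (structure_thinX bs_poly)); split => //.
have [x [y [ex ey xy]]] := edge_two_points (structure_complex sPi) (structure_thinX sPi) Ee.
by exists x, y; split => //; exact: ee0.
Qed.

Lemma weight_parent Pi e e0 : weighted_structure X Pi -> edges Pi e ->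
  edges (bs_structure X) e0 -> e `<=` e0 -> weight X e = ratr (bs_weight X e0).
Proof.
move=> [sPi rPi] Ee Ee0 ee0; rewrite /weight.
rewrite (_ : get _ = e0)//; apply: get_unique => // e1 [Ee1 ee1].
have [x [y [ex ey xy]]] := edge_two_points (structure_complex sPi) (structure_thinX sPi) Ee.
by apply: (edge_unique (structure_complex bs_poly) (structure_thinX bs_poly) (x := x) (y := y)); auto.
Qed.

Lemma weight_gt0 Pi e : weighted_structure X Pi -> edges Pi e -> 0 < weight X e.
Proof.
move=> wPi Ee; have [e0 Ee0 ee0] := refined_edge wPi Ee.
by rewrite (weight_parent wPi Ee Ee0 ee0) ltr0q bs_weight_gt0.
Qed.

Lemma weight_germ Pi e x u (t : R) : weighted_structure X Pi -> edges Pi e -> prim u ->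
  e x -> 0 < t -> e (x + t *: u) -> weight X e = germ_weight x u.
Proof.
move=> wPi Ee pu ex t0 et; have [e0 Ee0 ee0] := refined_edge wPi Ee.
rewrite (weight_parent wPi Ee Ee0 ee0) /germ_weight.
rewrite (_ : get _ = e0)//; apply: get_unique.
  by split => //; split; [exact: ee0|exists t => //; exact: ee0].
move=> e1 [Ee1 [e1x [s s0 es]]].
have cPi := structure_complex bs_poly; have tPi := structure_thinX bs_poly.
pose r := Num.min t s; have r0 : 0 < r by rewrite lt_min t0.
have mid (T : R) E : edges (bs_structure X) E -> E x -> E (x + T *: u) -> r <= T -> E (x + r *: u).
  move=> [PE _] Ex ET sT; have T0 : 0 < T by rewrite (lt_le_trans r0).
  have := cell_convex cPi PE Ex ET (t := r / T).
  rewrite [x + _ - x]addrC addKr scalerA mulfVK ?gt_eqF//; apply.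
    by rewrite divr_ge0// ltW.
  by rewrite ler_pdivrMr// mul1r.
apply: (edge_unique cPi tPi (x := x) (y := x + r *: u)) => //.
- by apply: mid es _ => //; rewrite ge_min lexx orbT.
- exact: ee0.
- by apply: mid (ee0 _ et) _ => //; [exact: ee0|rewrite ge_min lexx].
- by apply: prim_shift => //; rewrite gt_eqF.
Qed.

Lemma weight_star Pi e x : weighted_structure X Pi -> star Pi x e ->
  weight X e = germ_weight x (primitive_at e x).
Proof.
move=> wPi Se; have cPi := structure_complex wPi.1; have tPi := structure_thinX wPi.1.
have [pu [t t0 et]] := primitive_atP cPi tPi Se; have [Ee _ ex] := (starP cPi _ _).1 Se.
exact: weight_germ wPi Ee (primitive_prim cPi tPi Ee pu) ex t0 et.
Qed.

Lemma star_sum (W : nmodType) Pi x (F : R -> V -> W) : weighted_structure X Pi ->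
  Pi [set x] -> \sum_(e \in star Pi x) F (weight X e) (primitive_at e x) =
  \sum_(u \in germs X x) F (germ_weight x u) u.
Proof.
move=> wPi Px; rewrite (reindex_fsbig _ _ _ _ (star_germs_bij oX wPi.1 Px)).
by apply: eq_fsbigr => e; rewrite inE => Se; rewrite -(weight_star wPi Se).
Qed.

(** Both germs belong to one edge of the original structure. *)
Lemma germ_weight_opp Pi e x u (t : R) : weighted_structure X Pi -> edges Pi e -> prim u ->
  e x -> 0 < t -> e (x + t *: u) -> e (x + t *: - u) ->
  germ_weight x (- u) = germ_weight x u.
Proof.
move=> wPi Ee pu ex t0 et et'.
by rewrite -(weight_germ wPi Ee pu ex t0 et) -(weight_germ wPi Ee (primN pu) ex t0 et').
Qed.

Lemma prim_opp_neq u : prim u -> u != - u.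
Proof.
by move=> /prim_neq0; apply: contra; rewrite -addr_eq0 -mulr2n -scaler_nat scaler_eq0 pnatr_eq0.
Qed.

Lemma fsum_opp_pair (W : nmodType) (F : V -> W) u : prim u ->
  \sum_(w \in [set u; - u]) F w = F u + F (- u).
Proof.
move=> pu; rewrite (_ : [set u; - u] = [set` [:: u; - u]]); last first.
  apply/seteqP; split => w /=; rewrite !inE; first by case=> ->; rewrite eqxx ?orbT.
  by move=> /orP[]/eqP ->; [left|right].
by rewrite -fsbig_seq/= ?inE ?andbT ?prim_opp_neq// !big_cons big_nil addr0.
Qed.

Lemma weighted_bs : weighted_structure X (bs_structure X).
Proof. by split; [exact: bs_poly|move=> s Ps; exists s]. Qed.

(** At a vertex this is the balancing condition; elsewhere the two germs are opposite. *)
Lemma balanced_germs x : bs_carrier X x -> \sum_(u \in germs X x) germ_weight x u *: u = 0.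
Proof.
move=> Xx; have [Px|Px] := pselect (bs_structure X [set x]).
  rewrite -(star_sum (fun w u => w *: u) weighted_bs Px) -[RHS](bs_balanced Px).
  apply: eq_fsbigr => e; rewrite inE => -[Ee _].
  by rewrite (weight_parent weighted_bs Ee Ee).
have [e [u [Ee pu [t t0 et] ->]]] := germs_interior oX bs_poly Xx Px.
have pru := primitive_prim (structure_complex bs_poly) (structure_thinX bs_poly) Ee pu.
rewrite fsum_opp_pair// (germ_weight_opp weighted_bs Ee pru _ t0).
- by rewrite scalerN subrr.
- by rewrite -[x]addr0 -(scale0r u); apply: et; rewrite normr0 ltW.
- by apply: et; rewrite gtr0_norm.
- by rewrite scalerN -scaleNr; apply: et; rewrite normrN gtr0_norm.
Qed.

(** Along a germ this is the slope $s_{e/x}(f)$. *)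
Definition dirderiv (f : V -> R) x u : R := lim (t^-1 * (f (x + t *: u) - f x) @[t --> 0^'+]).

(** The sum of the weighted outgoing slopes at $x$. It is the coefficient of the Dirac measure at
    $x$ both in the Laplacian and in the Monge-Ampere measure, and involves no structure. *)
Definition mass (f : V -> R) x : R := \sum_(u \in germs X x) germ_weight x u * dirderiv f x u.

Lemma mass_star f Pi x : weighted_structure X Pi -> Pi [set x] ->
  \sum_(e \in star Pi x) weight X e * slope_at e x f = mass f x.
Proof. by move=> wPi Px; rewrite /mass -(star_sum (fun w u => w * dirderiv f x u) wPi Px). Qed.

Lemma dirderiv_eq f x u s : (t^-1 * (f (x + t *: u) - f x) @[t --> 0^'+] --> (s : R)) -> dirderiv f x u = s.
Proof. exact: cvg_lim. Qed.

Lemma dirderiv_affine f x u (s eps : R) : 0 < eps ->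
  (forall t, 0 < t < eps -> f (x + t *: u) = f x + t * s) -> dirderiv f x u = s.
Proof.
move=> e0 h; apply: dirderiv_eq; apply: cvg_near_cst; near=> t.
have t0 : 0 < t by near: t; exact: nbhs_right_gt.
rewrite h; first by rewrite [f x + _]addrC addrK mulKf// gt_eqF.
rewrite t0/=.
by near: t; exact: nbhs_right_lt.
Unshelve. all: by end_near. Qed.

(** Rationality is left out, so as to apply to interpolations of arbitrary real data. *)
Definition affine_cell (f : V -> R) sigma := exists (m : V) (c : R),
  forall x, sigma x -> f x = pairing m x + c.

Lemma affine_on_cell f sigma mc : affine_on sigma f mc -> affine_cell f sigma.
Proof. by move=> h; exists (map_mx ratr mc.1), (ratr mc.2). Qed.

Lemma dirderiv_affine_cell f sigma (m : V) (c : R) x u (t : R) : convex_set sigma ->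
  (forall x, sigma x -> f x = pairing m x + c) ->
  sigma x -> 0 < t -> sigma (x + t *: u) -> dirderiv f x u = pairing m u.
Proof.
move=> cs fE sx t0 st; apply: (dirderiv_affine t0) => s /andP[s0 s_t].
rewrite !fE//; first by rewrite pairingDr pairingZr; lra.
have := cs _ _ (s / t) sx st; rewrite [x + _ - x]addrC addKr scalerA mulfVK ?gt_eqF//; apply.
  by rewrite divr_ge0// ltW.
by rewrite ler_pdivrMr// mul1r ltW.
Qed.

Lemma MA_mass_mass Pi f x : weighted_structure X Pi -> PA_on X Pi f -> Pi [set x] ->
  MA_mass X Pi f x = mass f x.
Proof.
move=> wPi [_ PAf] Px; rewrite -(mass_star f wPi Px); apply: eq_fsbigr => e.
rewrite inE => Se; congr (_ * _).
have cPi := structure_complex wPi.1; have tPi := structure_thinX wPi.1.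
have [pu [t t0 et]] := primitive_atP cPi tPi Se; have [Ee _ ex] := (starP cPi _ _).1 Se.
have Pe := Ee.1.
have [mc mcP] := PAf _ Pe.
have := @getPex _ [set mc | affine_on e f mc] (ex_intro _ mc mcP).
rewrite /linear_part; move: (get _) => mc' mc'P.
by apply/esym; apply: (dirderiv_affine_cell (cell_convex cPi Pe) mc'P ex t0 et).
Qed.

(** The two opposite germs have the same weight, and opposite slopes. *)
Lemma mass_interior f Pi x : weighted_structure X Pi -> bs_carrier X x -> ~ Pi [set x] ->
  (forall e u (t : R), edges Pi e -> primitive_vector e u -> 0 < t ->
    (forall s, `|s| <= t -> e (x + s *: u)) -> dirderiv f x (- u) = - dirderiv f x u) ->
  mass f x = 0.
Proof.
move=> wPi Xx Px h; have [e [u [Ee pu [t t0 et] gE]]] := germs_interior oX wPi.1 Xx Px.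
have pru := primitive_prim (structure_complex wPi.1) (structure_thinX wPi.1) Ee pu.
rewrite /mass gE fsum_opp_pair// (germ_weight_opp wPi Ee pru _ t0).
- by rewrite (h _ _ _ Ee pu t0 et) mulrN subrr.
- by rewrite -[x]addr0 -(scale0r u); apply: et; rewrite normr0 ltW.
- by apply: et; rewrite gtr0_norm.
- by rewrite scalerN -scaleNr; apply: et; rewrite normrN gtr0_norm.
Qed.

Lemma mass_interior_affine f Pi x : weighted_structure X Pi -> bs_carrier X x -> ~ Pi [set x] ->
  (forall e, edges Pi e -> affine_cell f e) -> mass f x = 0.
Proof.
move=> wPi Xx Px h; apply: (mass_interior wPi Xx Px) => e u t Ee pu t0 et.
have [m [c fE]] := h e Ee; have cve := cell_convex (structure_complex wPi.1) Ee.1.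
have ex : e x by rewrite -[x]addr0 -(scale0r u); apply: et; rewrite normr0 ltW.
have e1 : e (x + t *: u) by apply: et; rewrite gtr0_norm.
have e2 : e (x + t *: - u) by rewrite scalerN -scaleNr; apply: et; rewrite normrN gtr0_norm.
by rewrite (dirderiv_affine_cell cve fE ex t0 e1) (dirderiv_affine_cell cve fE ex t0 e2) pairingNr.
Qed.

Lemma refines_vertices Pi Pi' : polyhedral_structure X Pi -> polyhedral_structure X Pi' ->
  refines Pi' Pi -> vertices Pi `<=` vertices Pi'.
Proof.
move=> sPi sPi' rf v Pv; have : bs_carrier X v by apply: (structure_sub sPi Pv).
case: (sPi') => cPi' XE; rewrite -XE => -[s Ps sv].
have [t Pt st] := rf _ Ps; have [_ [m [c [m0 vE]]]] := vertex_face (structure_complex sPi) Pv Pt (st _ sv).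
apply: (cell_face cPi' Ps); split; first by exists v.
exists m, c; split=> [x /st|]; first exact: m0.
apply/seteqP; split => x /=.
  by move=> ->; split => //; have : [set v] v by []; rewrite vE => -[].
move=> [sx mx]; have : (t `&` [set x | pairing m x + c = 0]) x by split=> //; exact: st.
by rewrite -vE.
Qed.

Lemma vertex_in Pi v : polyhedral_structure X Pi -> vertices Pi v -> bs_carrier X v.
Proof. by move=> sPi Pv; apply: (structure_sub sPi Pv). Qed.

(** The new vertices have mass zero. *)
Lemma mass_sum_refines f g Pi Pi' : weighted_structure X Pi -> weighted_structure X Pi' ->
  refines Pi' Pi -> (forall x, bs_carrier X x -> ~ Pi [set x] -> mass f x = 0) ->
  \sum_(v \in vertices Pi) mass f v * g v = \sum_(v \in vertices Pi') mass f v * g v.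
Proof.
move=> wPi wPi' rf f0; apply: fsbig_widen; first exact: refines_vertices wPi.1 wPi'.1 rf.
by move=> v [Pv' Pv] /=; rewrite f0 ?mul0r//; exact: vertex_in wPi'.1 Pv'.
Qed.

Lemma weighted_refinement Pi1 Pi2 : polyhedral_structure X Pi1 -> polyhedral_structure X Pi2 ->
  exists Pi, [/\ weighted_structure X Pi, refines Pi Pi1 & refines Pi Pi2].
Proof.
move=> s1 s2; have [Pi [sPi r1 r2]] := common_refinement oX s1 s2.
have [Pi' [sPi' r r']] := common_refinement oX sPi bs_poly.
by exists Pi'; split; [split|exact: refines_trans r1|exact: refines_trans r2].
Qed.

Lemma PA_on_refines Pi Pi' f : refines Pi' Pi -> PA_on X Pi f -> PA_on X Pi' f.
Proof.
move=> rf [cf af]; split => // s /rf[t Pt st]; have [mc h] := af _ Pt.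
by exists mc => x /st; exact: h.
Qed.

(** The chosen structure is replaced by one about which only its properties are known. *)
Lemma MA_PA_integralE psi f : PA X psi ->
  exists Pi, [/\ weighted_structure X Pi, PA_on X Pi psi &
  MA_PA_integral X psi f = \sum_(v \in vertices Pi) mass psi v * f v].
Proof.
move=> [Pi0 sPi0 pa]; have [Pi1 [w1 r1 _]] := weighted_refinement sPi0 sPi0.
have := @getPex _ [set Pi | weighted_structure X Pi /\ PA_on X Pi psi]
  (ex_intro _ Pi1 (conj w1 (PA_on_refines r1 pa))).
rewrite /MA_PA_integral; move: (get _) => Pi [/= wPi paPi]; exists Pi; split => //.
by apply: eq_fsbigr => v; rewrite inE => Pv; rewrite (MA_mass_mass wPi paPi Pv).
Qed.

End Mass.

(** * Positivity of the masses, and Green's formula *)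

Section Convexity.
Variables (R : realType) (n : nat).
Local Notation V := 'rV[R]_n.
Implicit Types (sigma tau e S : set V) (x y z v u : V) (Pi : set (set V)).

(** After division by $\sum_e c_e$ the relation exhibits $x$ as a polyhedral convex combination of
    the points $x + d_e$. *)
Lemma PC_relation (X : set V) (phi : V -> R) Pi x (s : seq (set V)) (c : set V -> R)
    (d : set V -> V) : PC X phi -> polyhedral_structure X Pi -> Pi [set x] ->
  (forall e, e \in s -> [/\ Pi e, e x, e (x + d e), rational_points (x + d e) & 0 <= c e]) ->
  \sum_(e <- s) c e *: d e = 0 ->
  0 <= \sum_(e <- s) c e * (phi (x + d e) - phi x).
Proof.
move=> [_ pc] sPi Px sP cd; have [cPi XE] := sPi.
pose W := \sum_(e <- s) c e.
have c0 e : e \in s -> 0 <= c e by move=> /sP[].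
have W0 : 0 <= W by rewrite /W big_seq; apply: sumr_ge0 => e /c0.
have [WE|Wn] := eqVneq W 0.
  rewrite big_seq big1 ?lexx// => e es.
  have : \sum_(i <- s | i \in s) c i = 0 by rewrite -big_seq.
  move=> /eqP; rewrite psumr_eq0// => /allP/(_ e es); rewrite es/= => /eqP ->.
  by rewrite mul0r.
have Wgt : 0 < W by rewrite lt_neqAle eq_sym Wn.
pose k := size s; pose E (i : 'I_k) := nth set0 s i.
have Es i : E i \in s by exact: mem_nth.
have sumE (T : nmodType) (F : set V -> T) : \sum_(e <- s) F e = \sum_(i < k) F (E i).
  by rewrite (big_nth set0) big_mkord.
have hx : x = \sum_(i < k) (c (E i) / W) *: (x + d (E i)).
  under eq_bigr do rewrite scalerDr.
  rewrite big_split/= -scaler_suml -mulr_suml -(sumE _ c) -/W mulfV// scale1r.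
  rewrite -[LHS]addr0; congr (_ + _); apply/esym.
  under eq_bigr do rewrite mulrC -scalerA.
  by rewrite -scaler_sumr -(sumE _ (fun e => c e *: d e)) cd scaler0.
have hX e : e \in s -> X (x + d e) by move=> /sP[Pe _ ed _ _]; rewrite -XE; exists e.
have comb : polyhedral_convex_combination X x (fun i => x + d (E i)) (fun i => c (E i) / W).
  split.
  - by move=> i; split; [exact: hX|have [] := sP _ (Es i)].
  - move=> i; rewrite divr_ge0 ?c0//= ler_pdivrMr// mul1r /W (sumE _ c) (bigD1 i)//= lerDl.
    by apply: sumr_ge0 => j _; exact: c0.
  - by rewrite -mulr_suml -(sumE _ c) mulfV.
  - by split => //; rewrite -XE; exists [set x].
  - exists Pi, [set x], E; split => // i; have [Pe ex ed _ _] := sP _ (Es i).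
    by split => //; exact: (vertex_face cPi Px Pe ex).
have h := pc _ _ _ _ comb; rewrite (sumE _ (fun e => c e * (phi (x + d e) - phi x))).
rewrite -(ler_pM2r (_ : 0 < W^-1)) ?invr_gt0// mul0r mulr_suml.
rewrite (eq_bigr (fun i => c (E i) / W * phi (x + d (E i)) - c (E i) / W * phi x)); last first.
  by move=> i _; ring.
by rewrite sumrB -mulr_suml -[X in X * phi x]mulr_suml -(sumE _ c) mulfV// mul1r subr_ge0.
Qed.

Lemma rational_pointsD x y : rational_points x -> rational_points y -> rational_points (x + y).
Proof.
by move=> [q ->] [r ->]; exists (q + r); apply/rowP => i; rewrite !mxE rmorphD.
Qed.

Lemma rational_pointsZ (q : rat) x : rational_points x -> rational_points (ratr q *: x : V).
Proof. by move=> [r ->]; exists (q *: r); apply/rowP => i; rewrite !mxE rmorphM. Qed.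

Lemma lattice_rational x : lattice x -> rational_points x.
Proof. by move=> [z ->]; exists (map_mx intr z); apply/rowP => i; rewrite !mxE ratr_int. Qed.

Lemma common_pos (T : eqType) (s : seq T) (P : T -> R -> Prop) :
  (forall a, a \in s -> exists2 d, 0 < d & forall t, 0 < t <= d -> P a t) ->
  exists2 d, 0 < d & forall a t, a \in s -> 0 < t <= d -> P a t.
Proof.
elim: s => [|a s IH] h; first by exists 1.
have [|d d0 dP] := IH; first by move=> b bs; apply: h; rewrite inE bs orbT.
have [|d' d'0 d'P] := h a; first by rewrite inE eqxx.
exists (Num.min d d'); first by rewrite lt_min d0.
move=> b t; rewrite inE le_min => /predU1P[->|bs] /and3P[t0 td td'].
  by apply: d'P; rewrite t0.
by apply: dP => //; rewrite t0.
Qed.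

Lemma near_right_rational (P : R -> Prop) : (\forall t \near (0 : R)^'+, P t) ->
  exists q : rat, 0 < q /\ P (ratr q).
Proof.
move=> /nbhs_ballP[e /= e0 eP]; have [q] := rat_in_itvoo e0.
rewrite in_itv/= => /andP[q0 qe]; exists q; split; first by rewrite -(ltr0q R).
by apply: eP => //; rewrite /ball/= sub0r normrN gtr0_norm.
Qed.

Variable X : balanced_space R n.

(** By balancing the relation $\sum_e [X](e) n_{e/x} = 0$ holds, so that the difference quotients
    satisfy [PC_relation] for small rational $t$; let $t$ tend to $0$. *)
Lemma mass_ge0 (phi : V -> R) Pi x : PC X phi -> weighted_structure X Pi -> Pi [set x] ->
  (forall u, germs X x u ->
    t^-1 * (phi (x + t *: u) - phi x) @[t --> 0^'+] --> dirderiv phi x u) ->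
  0 <= mass X phi x.
Proof.
move=> pc wPi Px hdd; have sPi := wPi.1; have cPi := structure_complex sPi.
have tPi := structure_thinX sPi; have fS := finite_star x sPi.
have Xx : bs_carrier X x by exact: vertex_in sPi Px.
pose u_ e := primitive_at e x.
have gu e : star Pi x e -> germs X x (u_ e).
  by move=> Se; have [h _ _] := star_germs_bij (bs_one_dim X) sPi Px; exact: h.
pose Q t := \sum_(e <- fset_set (star Pi x)) weight X e * (t^-1 * (phi (x + t *: u_ e) - phi x)).
have massE : mass X phi x = \sum_(e <- fset_set (star Pi x)) weight X e * dirderiv phi x (u_ e).
  by rewrite -(mass_star phi wPi Px) fsbig_finite.
have [d d0 dP] : exists2 d, 0 < d & forall e t, e \in fset_set (star Pi x) -> 0 < t <= d ->
    e (x + t *: u_ e).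
  apply: common_pos => e; rewrite in_fset_set// inE => Se.
  have [Ee _ ex] := (starP cPi _ _).1 Se.
  have [_ [t t0 et]] := primitive_atP cPi tPi Se; exists t => // r /andP[r0 rt].
  have := cell_convex cPi Ee.1 ex et (t := r / t).
  rewrite [x + _ - x]addrC addKr scalerA mulfVK ?gt_eqF//; apply.
    by rewrite divr_ge0// ltW.
  by rewrite ler_pdivrMr// mul1r.
have Q0 (q : rat) : 0 < (ratr q : R) <= d -> 0 <= Q (ratr q).
  move=> /andP[q0 qd]; rewrite /Q.
  under eq_bigr do rewrite mulrCA.
  rewrite -mulr_sumr mulr_ge0//; first by rewrite invr_ge0 ltW.
  apply: (@PC_relation _ _ Pi x _ (weight X) (fun e => ratr q *: u_ e) pc sPi Px).
    move=> e es; have := es; rewrite in_fset_set// inE => Se; have [Ee _ ex] := (starP cPi _ _).1 Se.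
    split => //; [by case: Ee|by apply: dP => //; rewrite q0| |exact/ltW/(weight_gt0 wPi)].
    apply: rational_pointsD; first exact/vertex_rational/(cell_polyhedron cPi).
    by apply/rational_pointsZ/lattice_rational; have [[]] := gu _ Se.
  under eq_bigr do rewrite scalerA mulrC -scalerA.
  rewrite -scaler_sumr -fsbig_finite// (star_sum (fun w u => w *: u) wPi Px).
  by rewrite balanced_germs ?scaler0.
have Qc : Q t @[t --> 0^'+] --> mass X phi x.
  rewrite massE big_seq /Q; under eq_cvg do rewrite big_seq.
  apply: cvg_big; first exact: add_continuous.
  move=> e; rewrite in_fset_set// inE => Se; apply: cvgMl_tmp; apply: hdd; exact: gu.
rewrite leNgt; apply/negP => m0.
have [|q [q0 [Qq qd]]] := @near_right_rational (fun t => Q t < 0 /\ t <= d).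
  by near=> t; split; near: t; [exact: cvgr_lt m0|exact: nbhs_right_le].
by have := Q0 q; rewrite ltr0q q0 qd leNgt Qq => /(_ erefl).
Unshelve. all: by end_near. Qed.

Definition edge_vertices Pi e : set V := [set v | star Pi v e].

Lemma sum_vertices_edges Pi (G : set V -> V -> R) : polyhedral_structure X Pi ->
  \sum_(v \in vertices Pi) \sum_(e \in star Pi v) G e v =
  \sum_(e \in edges Pi) \sum_(v \in edge_vertices Pi e) G e v.
Proof.
move=> sPi; have cPi := structure_complex sPi.
have E v : star Pi v = edges Pi `&` [set e | star Pi v e].
  by apply/seteqP; split => e /=; [move=> h; split => //; case: h|case].
have E' e : edge_vertices Pi e = vertices Pi `&` [set v | star Pi v e].
  apply/seteqP; split => v /=; last by case.
  by move=> h; split => //; have [] := (starP cPi _ _).1 h.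
under eq_fsbigr do rewrite E fsbig_mkcondr.
rewrite exchange_fsbig; [|exact: finite_vertices sPi|exact: finite_edges sPi].
apply: eq_fsbigr => e _; rewrite E' fsbig_mkcondr; apply: eq_fsbigr => v _.
by congr (if _ then _ else _); apply/idP/idP; rewrite !inE.
Qed.

(** Summation by parts: a sum over vertices and their stars is a sum over edges and their ends. *)
Lemma mass_sum_edges Pi (f g : V -> R) : weighted_structure X Pi ->
  \sum_(v \in vertices Pi) mass X f v * g v =
  \sum_(e \in edges Pi) weight X e * \sum_(v \in edge_vertices Pi e) slope_at e v f * g v.
Proof.
move=> wPi; have sPi := wPi.1.
rewrite (eq_fsbigr (fun v => \sum_(e \in star Pi v) weight X e * (slope_at e v f * g v))); last first.
  move=> v; rewrite inE => Pv; rewrite -(mass_star f wPi Pv) mulr_fsuml.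
  by apply: eq_fsbigr => e _; rewrite mulrA.
rewrite (sum_vertices_edges (fun e v => weight X e * (slope_at e v f * g v)))//.
by apply: eq_fsbigr => e _; rewrite mulr_fsumr.
Qed.

Lemma segment_sum Pi e v u L (G : V -> R) : polyhedral_structure X Pi -> star Pi v e ->
  u = primitive_at e v -> is_segment e v u L ->
  \sum_(x \in edge_vertices Pi e) G x = G v + G (v + L *: u).
Proof.
move=> sPi Se uE sg; have cPi := structure_complex sPi; have tPi := structure_thinX sPi.
have pu : prim u.
  by rewrite uE; apply: (primitive_prim cPi tPi Se.1); have [] := primitive_atP cPi tPi Se.
rewrite (_ : edge_vertices Pi e = [set` [:: v; v + L *: u]]).
  by rewrite -fsbig_seq/= ?inE ?andbT ?prim_shift ?gt_eqF ?sg.1// !big_cons big_nil addr0.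
apply/seteqP; split => x /=; rewrite !inE.
  by move/(segment_vertices cPi tPi x Se uE sg) => [->|->]; rewrite eqxx ?orbT.
by move=> h; apply/(segment_vertices cPi tPi x Se uE sg); case/orP: h => /eqP; [left|right].
Qed.

Lemma ray_sum Pi e v u (G : V -> R) : polyhedral_structure X Pi -> star Pi v e ->
  u = primitive_at e v -> is_ray e v u ->
  \sum_(x \in edge_vertices Pi e) G x = G v.
Proof.
move=> sPi Se uE sg; have cPi := structure_complex sPi.
rewrite (_ : edge_vertices Pi e = [set v]) ?fsbig_set1//.
by apply/seteqP; split => x /=; move/(ray_vertices cPi x Se uE sg).
Qed.

(** No edge is a whole line; a vertex can then serve as origin on each edge. *)
Definition rooted Pi := forall e, edges Pi e -> exists v, star Pi v e.

Definition vanishes_on_rays Pi (f : V -> R) := forall e v u, star Pi v e ->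
  is_ray e v u -> forall x, e x -> f x = 0.

(** Green's formula. On a bounded edge with ends $v, w$ and slopes $r, s$ of $f, g$ the two
    contributions are $s (f(v) - f(w))$ and $r (g(v) - g(w))$, both equal to minus $r s$ times
    the length; on a ray $f$ vanishes. *)
Lemma green_affine Pi (f g : V -> R) : weighted_structure X Pi -> rooted Pi ->
  (forall e, edges Pi e -> affine_cell f e) -> (forall e, edges Pi e -> affine_cell g e) ->
  vanishes_on_rays Pi f ->
  \sum_(v \in vertices Pi) mass X g v * f v = \sum_(v \in vertices Pi) mass X f v * g v.
Proof.
move=> wPi rPi af ag f0; have sPi := wPi.1; have cPi := structure_complex sPi.
have tPi := structure_thinX sPi.
rewrite !mass_sum_edges//; apply: eq_fsbigr => e; rewrite inE => Ee; congr (_ * _).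
have [v Se] := rPi e Ee; pose u := primitive_at e v.
have [_ _ ev] := (starP cPi _ _).1 Se.
have [pu [t t0 et]] := primitive_atP cPi tPi Se.
have [m [c fE]] := af e Ee; have [m' [c' gE]] := ag e Ee.
have cve := cell_convex cPi Ee.1.
have slf : slope_at e v f = pairing m u := dirderiv_affine_cell cve fE ev t0 et.
have slg : slope_at e v g = pairing m' u := dirderiv_affine_cell cve gE ev t0 et.
have [ry|[L sg]] := edge_shape cPi tPi Se erefl.
  rewrite !(ray_sum _ sPi Se erefl ry) (f0 _ _ _ Se ry)// mulr0.
  have fu : f (v + t *: u) = f v by rewrite !(f0 _ _ _ Se ry).
  move: fu; rewrite !fE// pairingDr pairingZr => fu.
  have : t * pairing m u = 0 by move: fu; lra.
  by move/eqP; rewrite mulf_eq0 gt_eqF//= slf => /eqP ->; rewrite mul0r.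
have [Se' uN] := segment_end cPi tPi Se erefl sg; have L0 := sg.1.
have [_ _ ew] := (starP cPi _ _).1 Se'; set w := v + L *: _ in Se' uN ew.
have wN : e (w + L *: - u) by rewrite /w scalerN addrK.
have slf' : slope_at e w f = - pairing m u.
  by rewrite -pairingNr /slope_at uN; exact: (dirderiv_affine_cell cve fE ew L0 wN).
have slg' : slope_at e w g = - pairing m' u.
  by rewrite -pairingNr /slope_at uN; exact: (dirderiv_affine_cell cve gE ew L0 wN).
rewrite !(segment_sum _ sPi Se erefl sg) -/w slf slg slf' slg' !fE// !gE//.
by rewrite /w !pairingDr !pairingZr; ring.
Qed.

End Convexity.

(** * Local support and piecewise affine interpolation *)

Section Support.
Variables (R : realType).

(** A maximum principle: otherwise $g(t) - a t$ has a maximum on $[0,1]$ that is larger than its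
    value at $1$, and the last point where it is attained has no local support. *)
Lemma supported_segment (g : R -> R) a :
  (forall t e, 0 <= t <= 1 -> 0 < e -> exists2 d, 0 < d &
    forall s, 0 <= s <= 1 -> `|s - t| < d -> `|g s - g t| < e) ->
  (forall t, 0 <= t <= 1 -> exists b, exists2 d, 0 < d &
    forall s, 0 <= s <= 1 -> `|s - t| < d -> g t + b * (s - t) <= g s) ->
  (exists2 d, 0 < d & forall s, 0 <= s < d -> g 0 + a * s <= g s) ->
  g 0 + a <= g 1.
Proof.
move=> cg sg [d0 d00 sg0]; rewrite leNgt; apply/negP => g1.
pose k t := g t - a * t.
have ck t e : 0 <= t <= 1 -> 0 < e -> exists2 d, 0 < d &
    forall s, 0 <= s <= 1 -> `|s - t| < d -> `|k s - k t| < e.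
  move=> t01 e0; have [|d d0' dP] := cg t (e / 2) t01; first exact: divr_gt0.
  have a0 : 0 < 1 + `|a| by rewrite ltr_pwDl.
  exists (Num.min d (e / 2 / (1 + `|a|))).
    by rewrite lt_min d0' !divr_gt0.
  move=> s s01; rewrite lt_min => /andP[sd se].
  have -> : k s - k t = (g s - g t) - a * (s - t) by rewrite /k; ring.
  rewrite (le_lt_trans (ler_normB _ _))// [ltRHS](splitr e) ltr_leD// ?dP// normrM.
  move: se; rewrite ltr_pdivlMr// => /ltW; apply: le_trans.
  by rewrite mulrC ler_wpM2l// lerDr.
have [c c01 cmax] : exists2 c, c \in `[0, 1]%R & forall t, t \in `[0, 1]%R -> k t <= k c.
  apply: EVT_max; first exact: ler01.
  apply/within_continuous_normP => t e; rewrite /= in_itv/= => t01 e0.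
  have [d d0' dP] := ck t e t01 e0; exists d => // s; rewrite /= in_itv/=; exact: dP.
have k10 : k 1 < k 0 by rewrite /k mulr1 mulr0 subr0 ltrBlDr.
rewrite in_itv/= in c01.
pose T := [set t | 0 <= t <= 1 /\ k t = k c].
have Tc : T c by [].
have supT : has_sup T by split; [exists c|exists 1 => t [/andP[]]].
pose z := sup T.
have z01 : 0 <= z <= 1.
  apply/andP; split; last by apply: ge_sup => [|t [/andP[]]//]; exists c.
  by rewrite (le_trans (proj1 (andP c01)))//; apply: ub_le_sup => //; case: supT.
have zT : k z = k c.
  apply/eqP; rewrite eq_le (cmax z) ?in_itv//= leNgt; apply/negP => zc.
  have [|d d0' dP] := ck z (k c - k z) z01; first by rewrite subr_gt0.
  have [t Tt tz] := sup_adherent d0' supT; have [t01 tc] := Tt.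
  have tz' : t <= z by apply: ub_le_sup => //; case: supT.
  have := dP t t01; rewrite tc ler0_norm ?subr_le0// opprB -/z => /(_ _)/wrap[].
    by move: tz; rewrite -/z; lra.
  by rewrite gtr0_norm ?subr_gt0// ltxx.
have z1 : z < 1.
  have /andP[z0 z1'] := z01; rewrite lt_neqAle z1' andbT; apply/eqP => zE.
  by move: k10; rewrite -zE zT ltNge cmax// in_itv/= lexx ler01.
have {}z0 : 0 <= z by case/andP: z01.
(* The support line at [z] has slope at least [a], as [k] has a maximum at [z]: so [k] does
   not decrease just after [z], against the choice of [z] as last maximum point. *)
have [d d0' dP] : exists2 d, 0 < d & forall s, 0 <= s <= 1 -> z <= s < z + d -> k z <= k s.
  have [zE|zn0] := eqVneq z 0.
    exists d0 => // s s01; rewrite zE add0r => /sg0; rewrite /k; lra.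
  have zgt0 : 0 < z by rewrite lt_neqAle eq_sym zn0.
  have [b [d d0' dP]] := sg z z01.
  exists d => // s s01 /andP[zs sd].
  have kP s' : 0 <= s' <= 1 -> `|s' - z| < d -> k z + (b - a) * (s' - z) <= k s'.
    by move=> h1 h2; have := dP s' h1 h2; rewrite /k; lra.
  have ba : 0 <= b - a.
    pose r := Num.min z (d / 2); have r0 : 0 < r by rewrite lt_min zgt0 divr_gt0.
    have rz : r <= z by rewrite ge_min lexx.
    have rd : r <= d / 2 by rewrite ge_min lexx orbT.
    have h1 : 0 <= z - r <= 1 by lra.
    have := kP (z - r) h1; rewrite addrAC subrr add0r normrN gtr0_norm// => /(_ _)/wrap[].
      by lra.
    have : k (z - r) <= k z by rewrite zT cmax// in_itv.
    by nra.
  rewrite (le_trans _ (kP s s01 _))//; first by rewrite lerDl mulr_ge0// subr_ge0.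
  by rewrite ger0_norm ?subr_ge0// ltrBlDl.
pose s := Num.min 1 (z + d / 2).
have zs : z < s by rewrite lt_min z1 ltrDl divr_gt0.
have sd : s <= z + d / 2 by rewrite ge_min lexx orbT.
have s1 : s <= 1 by rewrite ge_min lexx.
have s01 : 0 <= s <= 1 by rewrite s1 andbT; lra.
have : k z <= k s by apply: dP => //; rewrite ltW//=; lra.
rewrite zT => ks; have : T s.
  by split => //; apply/eqP; rewrite eq_le ks cmax ?in_itv.
by move=> Ts; have : s <= z by [apply: ub_le_sup => //; case: supT]; rewrite leNgt zs.
Qed.

End Support.

Section SupportPC.
Variables (R : realType) (n : nat).
Local Notation V := 'rV[R]_n.
Implicit Types (sigma tau e S X : set V) (x y z v u : V) (Pi : set (set V)) (f : V -> R).

(** Along the segment from $x$ to $x_i$, [supported_segment] propagates the local support at $x$ to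
    $x_i$; averaging the inequalities $f(x) + \langle m, x_i - x\rangle \le f(x_i)$ removes the linear term. *)
Lemma support_PC X f : {within X, continuous f} ->
  (forall x, X x -> exists m : V, exists2 d, 0 < d &
    forall y, X y -> `|y - x| < d -> f x + pairing m (y - x) <= f y) ->
  PC X f.
Proof.
move=> cf sf; split => // x k xs al [xsX al01 al1 [xE Xx] [Pi [tau [sg [sPi Pt tx sgP]]]]].
have [cPi XE] := sPi; have [m [d d0 dP]] := sf x Xx.
have key i : f x + pairing m (xs i - x) <= f (xs i).
  have [Ps sxi ft] := sgP i; pose w := xs i - x; pose p t := x + t *: w.
  have Xp t : 0 <= t <= 1 -> X (p t).
    move=> /andP[t0 t1]; rewrite -XE; exists (sg i) => //.
    by apply: (cell_convex cPi Ps) => //; exact: face_sub ft _ tx.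
  have pB s t : p s - p t = (s - t) *: w by rewrite /p opprD addrACA subrr add0r scalerBl.
  have w1 : 0 < 1 + `|w| by rewrite ltr_pwDl.
  have small (e s t : R) : 0 < e -> `|s - t| < e / (1 + `|w|) -> `|p s - p t| < e.
    move=> e0; rewrite pB normrZ ltr_pdivlMr//; apply: le_lt_trans.
    by rewrite ler_wpM2l// lerDr.
  have -> : f (xs i) = f (p 1) by rewrite /p scale1r addrC subrK.
  have -> : f x = f (p 0) by rewrite /p scale0r addr0.
  apply: (@supported_segment _ (fun t => f (p t))).
  - move=> t e t01 e0; have [d' d'0 d'P] := (within_continuous_normP _ _).1 cf _ _ (Xp t t01) e0.
    exists (d' / (1 + `|w|)); first exact: divr_gt0.
    by move=> s s01 st; apply: d'P; [exact: Xp|exact: small].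
  - move=> t t01; have [m' [d' d'0 d'P]] := sf _ (Xp t t01).
    exists (pairing m' w), (d' / (1 + `|w|)); first exact: divr_gt0.
    move=> s s01 st; have := d'P _ (Xp s s01) (small _ _ _ d'0 st).
    by rewrite pB pairingZr mulrC.
  - exists (Num.min 1 (d / (1 + `|w|))); first by rewrite lt_min ltr01 divr_gt0.
    move=> s /andP[s0]; rewrite lt_min => /andP[s1 sd].
    have s01 : 0 <= s <= 1 by rewrite s0 ltW.
    have := dP _ (Xp s s01); rewrite (_ : p s - x = s *: w); last by rewrite /p addrC addKr.
    rewrite pairingZr mulrC (_ : p 0 = x); last by rewrite /p scale0r addr0.
    apply; rewrite normrZ ger0_norm//; move: sd; rewrite ltr_pdivlMr//; apply: le_lt_trans.
    by rewrite ler_wpM2l// lerDr.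
rewrite (@le_trans _ _ (\sum_i al i * (f x + pairing m (xs i - x))))//; last first.
  by apply: ler_sum => i _; rewrite ler_wpM2l//; case/andP: (al01 i).
have S0 : \sum_i al i * pairing m (xs i - x) = 0.
  rewrite (eq_bigr (fun i => pairing m (al i *: xs i) - al i * pairing m x)); last first.
    by move=> i _; rewrite pairingBr pairingZr mulrBr.
  by rewrite sumrB -pairing_sumr -xE -mulr_suml al1 mul1r subrr.
under eq_bigr do rewrite mulrDr.
by rewrite big_split/= S0 addr0 -mulr_suml al1 mul1r.
Qed.

Lemma seq_of_finite (T : eqType) (A : set T) : finite_set A -> exists s : seq T,
  forall a, A a <-> a \in s.
Proof. by move=> /finite_seqP[s ->]; exists s. Qed.

(** The finitely many closed cells that do not contain $x$ have positive distance to it. *)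
Lemma near_cells X Pi x : polyhedral_structure X Pi ->
  exists2 d, 0 < d & forall s y, Pi s -> s y -> `|y - x| < d -> s x.
Proof.
move=> [cPi XE]; have [fPi _ _ _] := cPi; have [r rP] := seq_of_finite fPi.
have [|d d0 dP] := @common_pos R _ r (fun s d => forall y, s y -> `|y - x| < d -> s x).
  move=> s /rP Ps; have [sx|sx] := pselect (s x); first by exists 1.
  have : exists2 d, 0 < d & forall y, s y -> d <= `|y - x|.
    apply: contrapT => h; apply: sx; have /closedP_eps := cell_closed cPi Ps; apply => d d0.
    apply: contrapT => h'; apply: h; exists d => // y sy; rewrite leNgt; apply/negP => yx.
    by apply: h'; exists y.
  move=> [d d0 dP]; exists d => // t /andP[t0 td] y sy yx.
  by have := dP y sy; rewrite leNgt (lt_le_trans yx).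
by exists d => // s y /rP sr; apply: dP => //; rewrite d0 lexx.
Qed.

Lemma affine_cells_continuous X Pi f : polyhedral_structure X Pi ->
  (forall s, Pi s -> affine_cell f s) -> {within X, continuous f}.
Proof.
move=> sPi af; have [[fPi _ _ _] XE] := sPi; have [r rP] := seq_of_finite fPi.
apply/within_continuous_normP => x e Xx e0; have [d0 d00 d0P] := near_cells x sPi.
have [|d d0' dP] := @common_pos R _ r (fun s d => s x -> forall y, s y ->
    `|y - x| < d -> `|f y - f x| < e).
  move=> s /rP Ps; have [m [c fE]] := af s Ps; have [C C0 mC] := pairing_bounded m.
  exists (e / C); first exact: divr_gt0.
  move=> t /andP[t0 tC] sx y sy yx; rewrite !fE// opprD addrACA subrr addr0 -pairingBr.
  rewrite (le_lt_trans (mC _))// mulrC -ltr_pdivlMr//; exact: lt_le_trans tC.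
exists (Num.min d d0); first by rewrite lt_min d0'.
move=> y Xy; rewrite lt_min => /andP[yd yd0]; rewrite -XE in Xy; have [s Ps sy] := Xy.
apply: (dP s d) => //; first exact/rP.
  by rewrite d0' lexx.
exact: d0P Ps sy yd0.
Qed.

Lemma cell_cases X Pi s : one_dim_polyhedral_space X -> polyhedral_structure X Pi -> Pi s ->
  edges Pi s \/ exists v, s = [set v].
Proof.
move=> oX sPi Ps; have [cPi _] := sPi; have tPi := structure_thin oX sPi.
have [v sv] := cell_nonempty cPi Ps.
have [h|/existsNP[w /not_implyP[sw wv]]] := pselect (forall w, s w -> w = v).
  by right; exists v; apply/seteqP; split => x /=; [exact: h|move=> ->].
left; apply/(edgeP cPi tPi); split => //; exists w, v; split => //; exact/eqP.
Qed.

Lemma segment_bounded e v u L x : is_segment e v u L -> e x -> `|x| <= `|v| + L * `|u|.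
Proof.
move=> [L0 eP] /eP[t /andP[t0 tL] ->]; rewrite (le_trans (ler_normD _ _))// lerD2l normrZ.
by rewrite ger0_norm// ler_wpM2r.
Qed.

Lemma ray_norm v u (t : R) : 0 <= t -> t * `|u| - `|v| <= `|v + t *: u|.
Proof.
move=> t0; rewrite lerBlDr (le_trans _ (ler_normB _ _))//.
by rewrite addrC addKr normrZ ger0_norm.
Qed.

Lemma ray_not_segment e v u L z w : is_segment e v u L -> is_ray e z w -> w != 0 -> False.
Proof.
move=> sg ry w0; have w0' : 0 < `|w| by rewrite normr_gt0.
pose t := (`|v| + L * `|u| + `|z| + 1) / `|w|.
have t0 : 0 <= t by rewrite divr_ge0// !addr_ge0// mulr_ge0// ltW// (sg.1).
have := segment_bounded sg ((ry (z + t *: w)).2 (ex_intro2 _ _ t t0 erefl)).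
by have := ray_norm z w t0; rewrite mulfVK ?gt_eqF//; lra.
Qed.

Definition israt (r : R) := exists q : rat, r = ratr q.

Lemma isratD r s : israt r -> israt s -> israt (r + s).
Proof. by move=> [q ->] [q' ->]; exists (q + q'); rewrite rmorphD. Qed.

Lemma isratM r s : israt r -> israt s -> israt (r * s).
Proof. by move=> [q ->] [q' ->]; exists (q * q'); rewrite rmorphM. Qed.

Lemma isratN r : israt r -> israt (- r).
Proof. by move=> [q ->]; exists (- q); rewrite rmorphN. Qed.

Lemma isratV r : israt r -> israt r^-1.
Proof. by move=> [q ->]; exists (q^-1); rewrite fmorphV. Qed.

Lemma israt_pairing x y : rational_points x -> rational_points y -> israt (pairing x y).
Proof.
move=> [q ->] [q' ->]; exists (\sum_i q 0 i * q' 0 i); rewrite rmorph_sum.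
by apply: eq_bigr => i _; rewrite !mxE rmorphM.
Qed.

Lemma rational_points_scale r x : israt r -> rational_points x -> rational_points (r *: x).
Proof. by move=> [q ->]; exact: rational_pointsZ. Qed.

Lemma rational_pointsB x y : rational_points x -> rational_points y -> rational_points (x - y).
Proof.
move=> xr yr; apply: rational_pointsD => //; rewrite -scaleN1r; apply: rational_points_scale => //.
by exists (-1); rewrite rmorphN rmorph1.
Qed.

Lemma structure_vertex_rational X Pi v : polyhedral_structure X Pi -> Pi [set v] -> rational_points v.
Proof. by move=> [cPi _] /(cell_polyhedron cPi)/vertex_rational. Qed.

Lemma affine_on_rat f s (m : V) c : rational_points m -> israt c ->
  (forall x, s x -> f x = pairing m x + c) -> exists mc, affine_on s f mc.
Proof. by move=> [q mE] [r cE] h; exists (q, r) => x sx; rewrite h// mE cE. Qed.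

Section Extension.
Variables (X : set V) (Pi : set (set V)).
Hypotheses (oX : one_dim_polyhedral_space X) (sPi : polyhedral_structure X Pi).
Hypothesis rPi : rooted Pi.
Variables (y : V -> R) (sl : set V -> R).

Let cPi : polyhedral_complex Pi. Proof. by case: sPi. Qed.
Let tPi : thin Pi. Proof. exact: structure_thin sPi. Qed.

(** On the line of the edge, multiples of the linear form $\langle u, \cdot\rangle$ with $u$ primitive on the edge
    realize every slope, and a rational slope by a rational form. *)
Lemma edge_interpolation e : edges Pi e -> exists mc : V * R,
  [/\ forall v, star Pi v e -> pairing mc.1 v + mc.2 = y v,
    forall v, star Pi v e -> is_ray e v (primitive_at e v) ->
      pairing mc.1 (primitive_at e v) = sl e &
    (forall v, star Pi v e -> israt (y v)) -> israt (sl e) ->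
      rational_points mc.1 /\ israt mc.2].
Proof.
move=> Ee; have [v Se] := rPi Ee; pose u := primitive_at e v.
have [pu _] := primitive_atP cPi tPi Se; have pru := primitive_prim cPi tPi Ee pu.
have u0 : 0 < pairing u u by apply: pairing_gt0; exact: prim_neq0.
have ur : rational_points u by apply: lattice_rational; case: pru.
have vr : rational_points v by apply: (structure_vertex_rational sPi); have [] := (starP cPi _ _).1 Se.
have [ry|[L sg]] := edge_shape cPi tPi Se erefl.
  pose m := (sl e / pairing u u) *: u; exists (m, y v - pairing m v); split => /=.
  - by move=> w /(ray_vertices cPi w Se erefl ry) ->; rewrite addrC subrK.
  - move=> w /(ray_vertices cPi w Se erefl ry) -> _; rewrite pairingZl mulfVK ?gt_eqF//.
  - move=> yr slr; have mr : rational_points m.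
      by apply: rational_points_scale => //; apply: isratM => //; apply: isratV; exact: israt_pairing.
    split => //; apply: isratD; first exact: yr.
    by apply: isratN; exact: israt_pairing.
have L0 := sg.1; have [Se' uN] := segment_end cPi tPi Se erefl sg.
set w := v + _ in Se' uN.
pose m := ((y w - y v) / L / pairing u u) *: u.
have mw : pairing m w = pairing m v + (y w - y v).
  have mu : pairing m u = (y w - y v) / L by rewrite pairingZl mulfVK ?gt_eqF.
  by rewrite [in LHS]/w pairingDr pairingZr mu mulrCA mulfV ?gt_eqF// mulr1.
have wr : rational_points w by apply: (structure_vertex_rational sPi); have [] := (starP cPi _ _).1 Se'.
have Lr : israt L.
  have -> : L = pairing u (w - v) / pairing u u.
    by rewrite /w addrC addKr pairingZr mulfK ?gt_eqF.
  apply: isratM; last by apply: isratV; exact: israt_pairing.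
  by apply: israt_pairing => //; exact: rational_pointsB.
exists (m, y v - pairing m v); split => /=.
- by move=> z /(segment_vertices cPi tPi z Se erefl sg) [->|->]; rewrite -/w ?mw; ring.
- move=> z /(segment_vertices cPi tPi z Se erefl sg) zP ry.
  case: (ray_not_segment sg ry); apply: prim_neq0.
  have Sz : star Pi z e by case: zP => ->.
  by apply: (primitive_prim cPi tPi Ee); have [] := primitive_atP cPi tPi Sz.
- move=> yr slr; have mr : rational_points m.
    apply: rational_points_scale => //; apply: isratM.
      apply: isratM; last exact: isratV.
      by apply: isratD; [exact: yr|apply: isratN; exact: yr].
    by apply: isratV; exact: israt_pairing.
  split => //; apply: isratD; first exact: yr.
  by apply: isratN; exact: israt_pairing.
Qed.

(** Prescribed values [y] at the vertices and slopes [sl] on the rays; continuity is automatic as the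
    affine functions on two edges agree at common points, which are vertices. *)
Lemma PL_extension : exists f : V -> R,
  [/\ {within X, continuous f}, forall v, Pi [set v] -> f v = y v,
    forall s, Pi s -> affine_cell f s,
    forall e v t, star Pi v e -> is_ray e v (primitive_at e v) -> 0 <= t ->
      f (v + t *: primitive_at e v) = y v + t * sl e &
    (forall v, Pi [set v] -> israt (y v)) -> (forall e, edges Pi e -> israt (sl e)) ->
    forall s, Pi s -> exists mc, affine_on s f mc].
Proof.
pose M e : V * R := if pselect (edges Pi e) is left h then sval (cid (edge_interpolation h)) else (0, 0).
have MP e : edges Pi e -> [/\ forall v, star Pi v e -> pairing (M e).1 v + (M e).2 = y v,
    forall v, star Pi v e -> is_ray e v (primitive_at e v) ->
      pairing (M e).1 (primitive_at e v) = sl e &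
    (forall v, star Pi v e -> israt (y v)) -> israt (sl e) ->
      rational_points (M e).1 /\ israt (M e).2].
  by move=> Ee; rewrite /M; case: pselect => // h; case: cid.
pose f x := if pselect (Pi [set x]) then y x else
  let e := get [set e | edges Pi e /\ e x] in pairing (M e).1 x + (M e).2.
have fv v : Pi [set v] -> f v = y v by move=> Pv; rewrite /f; case: pselect.
have fe e x : edges Pi e -> e x -> f x = pairing (M e).1 x + (M e).2.
  move=> Ee ex; rewrite /f; case: pselect => [Px|Px].
    by have [-> //] := MP e Ee; apply/(starP cPi).
  rewrite (_ : get _ = e)//; apply: get_unique => // e' [Ee' e'x].
  apply: contrapT => ee'; apply: Px.
  have [_ _ _ /(_ _ _ Ee.1 Ee'.1)[h|[fc fc']]] := cPi.
    by have : (e `&` e') x by []; rewrite h.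
  apply: (cell_face cPi Ee.1); rewrite (_ : [set x] = e `&` e')//.
  apply/seteqP; split => z /=; [by move=> ->|move=> [ez e'z]]; apply/eqP; apply: contra_notT ee' => zx.
  exact: (edge_unique cPi tPi Ee' Ee e'z e'x ez ex zx).
have af s : Pi s -> affine_cell f s.
  move=> Ps; have [Es|[v sE]] := cell_cases oX sPi Ps.
    by exists (M s).1, (M s).2 => x sx; rewrite (fe s).
  by exists 0, (y v) => x; rewrite sE => /= ->; rewrite pairingC pairing0r add0r fv -?sE.
exists f; split => //.
- exact: affine_cells_continuous af.
- move=> e v t Se ry t0; have [Ee Pv ev] := (starP cPi _ _).1 Se.
  have [h1 h2 _] := MP e Ee; rewrite (fe e) //; last by apply/ry; exists t.
  by rewrite pairingDr pairingZr h2// -(h1 v Se); ring.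
- move=> yr slr s Ps; have [Es|[v sE]] := cell_cases oX sPi Ps.
    have [_ _ h] := MP s Es; have [||mr cr] := h.
    + by move=> v /(starP cPi)[_ Pv _]; exact: yr.
    + exact: slr.
    by apply: (affine_on_rat mr cr) => x sx; rewrite (fe s).
  have Pv : Pi [set v] by rewrite -sE.
  have zr : rational_points (0 : V).
    by exists 0; apply/rowP => i; rewrite !mxE rmorph0.
  apply: (affine_on_rat zr (yr v Pv)) => x; rewrite sE => /= ->.
  by rewrite pairingC pairing0r add0r fv.
Qed.

End Extension.

End SupportPC.

(** * Behaviour at infinity *)

Section Growth.
Variables (R : realType) (n : nat).
Local Notation V := 'rV[R]_n.
Implicit Types (sigma tau S X : set V) (x y z v u : V) (Pi : set (set V)) (f : V -> R).

(** For rational ends these are polyhedral convex combinations with both faces equal to the cell;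
    by continuity this extends to all points of the cell. *)
Lemma PC_convex_cell X f Pi (e : set V) x y (t : R) : PC X f -> polyhedral_structure X Pi -> Pi e ->
  e x -> e y -> 0 <= t <= 1 -> f (x + t *: (y - x)) <= (1 - t) * f x + t * f y.
Proof.
move=> [cf pc] sPi Pe ex ey /andP[t0 t1]; have [cPi XE] := sPi.
have eX z : e z -> X z by move=> ez; rewrite -XE; exists e.
have cve := cell_convex cPi Pe.
have ct a b : e a -> e b -> e (a + t *: (b - a)) by move=> ea eb; exact: cve.
apply/ler_addgt0Pr => ep ep0; have ep2 : 0 < ep / 2 by rewrite divr_gt0.
have cfP := (within_continuous_normP _ _).1 cf.
have [d1 d10 d1P] := cfP x _ (eX _ ex) ep2.
have [d2 d20 d2P] := cfP y _ (eX _ ey) ep2.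
have [d3 d30 d3P] := cfP _ _ (eX _ (ct _ _ ex ey)) ep2.
pose d := Num.min d1 (Num.min d2 d3).
have d0 : 0 < d by rewrite !lt_min d10 d20.
have [dd1 dd2 dd3] : [/\ d <= d1, d <= d2 & d <= d3] by rewrite /d !ge_min !lexx ?orbT.
have pole := cell_polyhedron cPi Pe.
have [x' [ex' xr xx']] := rational_point_near pole ex d0.
have [y' [ey' yr yy']] := rational_point_near pole ey d0.
have h1 := d1P _ (eX _ ex') (lt_le_trans xx' dd1).
have h2 := d2P _ (eX _ ey') (lt_le_trans yy' dd2).
have h3 : `|f (x' + t *: (y' - x')) - f (x + t *: (y - x))| < ep / 2.
  apply: d3P; first by apply: eX; exact: ct.
  apply: lt_le_trans dd3.
  have -> : x' + t *: (y' - x') - (x + t *: (y - x)) = (1 - t) *: (x' - x) + t *: (y' - y).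
    by apply/rowP => i; rewrite !mxE; ring.
  rewrite (le_lt_trans (ler_normD _ _))// !normrZ ger0_norm ?subr_ge0// (ger0_norm t0).
  have : Num.max `|x' - x| `|y' - y| < d by rewrite gt_max xx'.
  apply: le_lt_trans; set M := Num.max _ _.
  have : (1 - t) * `|x' - x| <= (1 - t) * M.
    by rewrite ler_wpM2l ?subr_ge0// le_max lexx.
  have : t * `|y' - y| <= t * M by rewrite ler_wpM2l// le_max lexx orbT.
  lra.
have h4 : f (x' + t *: (y' - x')) <= (1 - t) * f x' + t * f y'.
  have := pc (x' + t *: (y' - x')) 2 (fun i => if i == 0 then x' else y')
    (fun i => if i == 0 then 1 - t else t).
  rewrite !big_ord_recl !big_ord0/= !addr0; apply.
  split.
  - by move=> i; case: ifP => _; split => //; exact: eX.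
  - by move=> i; case: ifP => _; lra.
  - by rewrite !big_ord_recl !big_ord0/= addr0 subrK.
  - split; last by apply: eX; exact: ct.
    by rewrite !big_ord_recl !big_ord0/= addr0; apply/rowP => i; rewrite !mxE; ring.
  - exists Pi, e, (fun=> e); split => //; first exact: ct.
    move=> i; split => //; first by case: ifP.
    by apply: face_refl; exists x.
move: h1 h2 h3; rewrite !ltr_norml => /andP[? ?] /andP[? ?] /andP[? ?].
have : (1 - t) * f x' <= (1 - t) * (f x + ep / 2) by apply: ler_wpM2l; lra.
have : t * f y' <= t * (f y + ep / 2) by apply: ler_wpM2l; lra.
lra.
Qed.

Section Ray.
Variables (X : set V) (f g : V -> R) (Pi : set (set V)) (e : set V) (v u : V) (C : R).
Hypotheses (pcf : PC X f) (sPi : polyhedral_structure X Pi) (Pe : Pi e) (ry : is_ray e v u).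
Hypotheses (ag : affine_cell g e) (fgC : forall x, X x -> `|f x - g x| <= C).

Let h t := f (v + t *: u) - g (v + t *: u).

(** A convex function that increases somewhere on a half-line is unbounded. *)
Lemma ray_nonincreasing s t : 0 <= s -> s <= t -> h t <= h s.
Proof.
move=> s0; rewrite le_eqVlt => /predU1P[->//|st]; rewrite leNgt; apply/negP => hst.
have eP r : 0 <= r -> e (v + r *: u) by move=> r0; apply/ry; exists r.
have [_ XE] := sPi; have hC r : 0 <= r -> `|h r| <= C.
  by move=> r0; apply: fgC; rewrite -XE; exists e => //; exact: eP.
have C0 : 0 <= C by rewrite (le_trans _ (hC s s0)).
pose D := h t - h s; have D0 : 0 < D by rewrite subr_gt0.
(* An increase by [D] on $[s, t]$ would become an increase by more than $2 C$ on an interval that is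
   [a] times as long. *)
pose a := (2 * C + 1) / D + 1; have a1 : 1 < a.
  by rewrite ltrDr divr_gt0// ltr_pwDr// mulr_ge0.
pose r := s + a * (t - s); have a0 : 0 < a by lra.
have ts : 0 < t - s by rewrite subr_gt0.
have r0 : 0 <= r by rewrite addr_ge0// mulr_ge0// ltW.
have ia : 0 <= a^-1 <= 1 by rewrite invr_ge0 ltW//= invf_le1// ltW.
have := PC_convex_cell pcf sPi Pe (eP s s0) (eP r r0) ia.
have [m [c gE]] := ag.
have zE : v + s *: u + a^-1 *: (v + r *: u - (v + s *: u)) = v + t *: u.
  by rewrite /r; apply/rowP => i; rewrite !mxE; field; rewrite gt_eqF.
rewrite zE.
have gz : g (v + t *: u) = (1 - a^-1) * g (v + s *: u) + a^-1 * g (v + r *: u).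
  have t0 : 0 <= t by lra.
  by rewrite (gE _ (eP _ t0)) (gE _ (eP _ s0)) (gE _ (eP _ r0)) -zE affine_line.
move=> hconv.
have {hconv} : h t <= (1 - a^-1) * h s + a^-1 * h r by rewrite /h gz; lra.
have hr := hC r r0; have hs := hC s s0.
have -> : (1 - a^-1) * h s + a^-1 * h r = h s + (h r - h s) / a by field; rewrite gt_eqF.
rewrite -lerBlDl -/D ler_pdivlMr//.
have -> : D * a = 2 * C + 1 + D by rewrite /a; field; rewrite gt_eqF.
move: hr hs; rewrite !ler_norml; lra.
Qed.

Lemma ray_limit eps : 0 < eps -> exists2 T, 0 <= T &
  forall s t, T <= s -> T <= t -> `|h s - h t| <= eps.
Proof.
move=> eps0; pose A := [set r | exists2 t, 0 <= t & r = h t].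
have [_ XE] := sPi; have hC r : 0 <= r -> `|h r| <= C.
  by move=> r0; apply: fgC; rewrite -XE; exists e => //; apply/ry; exists r.
have iA : has_inf A.
  split; first by exists (h 0), 0.
  by exists (- C) => _ [t t0 ->]; have := hC t t0; rewrite ler_norml => /andP[].
have [_ [T T0 ->] hT] := inf_adherent eps0 iA.
have bd t : T <= t -> inf A <= h t <= h T.
  move=> Tt; rewrite ray_nonincreasing// andbT; apply: ge_inf; first by case: iA.
  by exists t => //; exact: le_trans Tt.
exists T => // s t /bd/andP[s1 s2] /bd/andP[t1 t2].
by rewrite ler_norml; move: hT; lra.
Qed.

End Ray.

Lemma common_bound (T : eqType) (s : seq T) (P : T -> R -> Prop) :
  (forall a, a \in s -> exists d, forall t, d <= t -> P a t) ->
  exists d, forall a t, a \in s -> d <= t -> P a t.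
Proof.
elim: s => [|a s IH] h; first by exists 1.
have [|d dP] := IH; first by move=> b bs; apply: h; rewrite inE bs orbT.
have [|d' d'P] := h a; first by rewrite inE eqxx.
exists (Num.max d d') => b t; rewrite inE ge_max => /predU1P[->|bs] /andP[td td'].
  exact: d'P.
exact: dP.
Qed.

(** Small oscillation on each cell outside a large ball: fine structures control the
    oscillation only on bounded sets. *)
Definition tame X Pi (h : V -> R) := forall eps, 0 < eps -> exists T, forall s x y,
  Pi s -> s x -> s y -> T <= `|x| -> T <= `|y| -> `|h x - h y| <= eps.

(** On rays $f - g$ is monotone and bounded, hence has a limit. *)
Lemma growth_tame X Pi f g (C : R) : one_dim_polyhedral_space X -> PC X f ->
  polyhedral_structure X Pi -> rooted Pi -> (forall e, edges Pi e -> affine_cell g e) ->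
  (forall x, X x -> `|f x - g x| <= C) -> tame X Pi (fun x => f x - g x).
Proof.
move=> oX pcf sPi rPi ag fgC eps eps0; have [cPi XE] := sPi; have tPi := structure_thin oX sPi.
have [[fPi _ _ _] _] := sPi; have [r rP] := seq_of_finite fPi.
have [|T TP] := @common_bound _ r (fun s T => forall x y, s x -> s y -> T <= `|x| -> T <= `|y| ->
   `|f x - g x - (f y - g y)| <= eps); last first.
  by exists T => s x y /rP sr; exact: (TP s T sr (lexx T) x y).
move=> s /rP Ps; have [Es|[v sE]] := cell_cases oX sPi Ps; last first.
  by exists 0 => t _ x y; rewrite sE => -> -> _ _; rewrite subrr normr0 ltW.
have [v Se] := rPi _ Es; pose u := primitive_at s v.
have pru : prim u by apply: (primitive_prim cPi tPi Es); have [] := primitive_atP cPi tPi Se.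
have u0 : 0 < `|u| by rewrite normr_gt0 prim_neq0.
have [ry|[L sg]] := edge_shape cPi tPi Se erefl; last first.
  exists (`|v| + L * `|u| + 1) => t tT x y sx _ tx _.
  by have := segment_bounded sg sx; rewrite leNgt (lt_le_trans _ tx)// (lt_le_trans _ tT)// ltrDl.
have [T T0 TP] := ray_limit pcf sPi Ps ry (ag _ Es) fgC eps0.
exists (`|v| + T * `|u|) => t tT x y /ry[a a0 ->] /ry[b b0 ->] ta tb.
have big c : 0 <= c -> t <= `|v + c *: u| -> T <= c.
  move=> c0 tc; rewrite -(ler_pM2r u0); have : `|v + c *: u| <= `|v| + c * `|u|.
    by rewrite (le_trans (ler_normD _ _))// normrZ ger0_norm.
  by lra.
by apply: TP; exact: big.
Qed.

(** Heine's theorem, except that only one of the two points is confined to the bounded part. *)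
Lemma uniform_on_bounded X f (B eps : R) : closed X -> {within X, continuous f} -> 0 < eps ->
  exists2 d, 0 < d & forall x y, X x -> X y -> `|x| <= B -> `|y - x| <= d -> `|f y - f x| < eps.
Proof.
move=> cX cf eps0; pose A := X `&` [set x | `|x| <= B].
have cA : compact A.
  apply: bounded_closed_compact; last first.
    apply: closedI => //; apply/closedP_eps => x h /=; apply/ler_addgt0Pr => e e0.
    have [y /= yB yx] := h e e0; rewrite -[x](subrK y) addrC (le_trans (ler_normD _ _))//.
    by rewrite lerD// distrC ltW.
  exists B; split; first exact: num_real.
  by move=> M BM x [_ xB] /=; rewrite (le_trans xB)// ltW.
have H : \forall d \near (0 : R)^'+, A `<=`
    (fun x => X x -> forall y, X y -> `|y - x| <= d -> `|f y - f x| < eps).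
  apply: ((compact_near_coveringP A).1 cA R (0 : R)^'+
    (fun d x => X x -> forall y, X y -> `|y - x| <= d -> `|f y - f x| < eps)) => x [Xx _].
  have e2 : 0 < eps / 2 by rewrite divr_gt0.
  have [d d0 dP] := (within_continuous_normP _ _).1 cf x _ Xx e2.
  have d2 : 0 < d / 2 by rewrite divr_gt0.
  exists (ball x (d / 2), [set t | t < d / 2]); first split => /=.
  - exact: nbhsx_ballx.
  - exact: nbhs_right_lt.
  move=> [x' t] /= [xx' td] Xx' y Xy yx'.
  rewrite -ball_normE/= in xx'.
  have h1 : `|x' - x| < d by rewrite distrC (lt_trans xx')// ltr_pdivrMr// ltr_pMr// ltr1n.
  have h2 : `|y - x| < d.
    rewrite -[y](subrK x') -addrA (le_lt_trans (ler_normD _ _))// [ltRHS](splitr d).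
    by rewrite ltrD//; [exact: le_lt_trans yx' td|rewrite distrC].
  have := dP _ Xx' h1; have := dP _ Xy h2 => a b.
  rewrite -[f y](subrK (f x)) -addrA (le_lt_trans (ler_normD _ _))// [ltRHS](splitr eps).
  by rewrite ltrD// distrC.
have [d [d0 dP]] : exists d : R, 0 < d /\ forall x, A x -> X x -> forall y, X y -> `|y - x| <= d ->
    `|f y - f x| < eps.
  have : \forall d \near (0 : R)^'+, 0 < d /\ forall x, A x -> X x -> forall y, X y ->
      `|y - x| <= d -> `|f y - f x| < eps.
    by near=> d; split; near: d; [exact: nbhs_right_gt|exact: H].
  by move=> /near_right_rational[q [_ qP]]; exists (ratr q).
exists d => // x y Xx Xy xB; exact: dP.
Unshelve. all: by end_near. Qed.

Lemma structure_closed X Pi : polyhedral_structure X Pi -> closed X.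
Proof.
move=> [cPi <-]; apply: closed_bigcup => [|s Ps]; first by have [] := cPi.
exact: (cell_closed cPi Ps).
Qed.

Lemma oscillation_structure X Pi (h : V -> R) eps : one_dim_polyhedral_space X ->
  polyhedral_structure X Pi -> {within X, continuous h} -> tame X Pi h -> 0 < eps ->
  exists Pi', [/\ polyhedral_structure X Pi', refines Pi' Pi, rooted Pi' &
    forall s x y, Pi' s -> s x -> s y -> `|h x - h y| <= eps].
Proof.
move=> oX sPi ch th eps0; have [T TP] := th eps eps0.
have [d d0 dP] := uniform_on_bounded (T + 1) (structure_closed sPi) ch eps0.
pose eta := Num.min d 1; have eta0 : 0 < eta by rewrite lt_min d0 ltr01.
have [Pi' [sPi' rf rt fine]] := fine_structure T oX sPi eta0.
exists Pi'; split => // s x y Ps sx sy.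
have sX z : s z -> X z by have [_ <-] := sPi'; move=> sz; exists s.
have [T1|[Tx Ty]] := fine s x y Ps sx sy; last first.
  by have [t Pt st] := rf _ Ps; apply: (TP t); auto.
have : `|x - y| <= d by rewrite (le_trans T1)// ge_min lexx.
have : `|x - y| <= 1 by rewrite (le_trans T1)// ge_min lexx orbT.
move=> xy1 xyd.
have [xT|xT] := leP `|x| (T + 1).
  by rewrite distrC; apply: ltW; apply: dP xT _; [exact: sX|exact: sX|rewrite distrC].
have [t Pt st] := rf _ Ps; apply: (TP t); auto; first by lra.
have : `|x| <= `|x - y| + `|y| by rewrite -[X in `|X|](subrK y) ler_normD.
lra.
Qed.

End Growth.

(** * Piecewise affine approximation *)

Section Approximation.
Variables (R : realType) (n : nat).
Local Notation V := 'rV[R]_n.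
Implicit Types (sigma tau S X : set V) (x y z v u : V) (Pi : set (set V)) (f : V -> R).

Lemma edge_through X Pi (e e' : set V) x : one_dim_polyhedral_space X ->
  polyhedral_structure X Pi -> edges Pi e -> edges Pi e' ->
  e x -> e' x -> ~ Pi [set x] -> e' = e.
Proof.
move=> oX sPi Ee Ee' ex e'x Px; have [cPi _] := sPi; have tPi := structure_thin oX sPi.
apply: contrapT => ee'; apply: Px.
have [_ _ _ /(_ _ _ Ee.1 Ee'.1)[h|[fc fc']]] := cPi.
  by have : (e `&` e') x by []; rewrite h.
apply: (cell_face cPi Ee.1); rewrite (_ : [set x] = e `&` e')//.
apply/seteqP; split => z /=; [by move=> ->|move=> [ez e'z]]; apply/eqP; apply: contra_notT ee' => zx.
exact: (edge_unique cPi tPi Ee' Ee e'z e'x ez ex zx).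
Qed.

(** Membership in a cone may use a generator several times; here its coefficients are collected. *)
Lemma cone_sum (T : eqType) (s : seq T) (d : T -> V) (c : T -> R) : uniq s ->
  forall w r, cone [seq (d a, c a) | a <- s] w r -> exists k : T -> R,
  [/\ forall a, 0 <= k a, w = \sum_(a <- s) k a *: d a & r = \sum_(a <- s) k a * c a].
Proof.
move=> us w r; elim=> [|b p {}w {}r b0 /mapP[a as_ ->] _ [k [k0 -> ->]]].
  by exists (fun=> 0); split => //; rewrite big1// => a _; rewrite ?scale0r ?mul0r.
exists (fun a' => k a' + (if a' == a then b else 0)); split => /=.
- by move=> a'; rewrite addr_ge0//; case: ifP.
- under [RHS]eq_bigr do rewrite scalerDl.
  rewrite big_split/= addrC; congr (_ + _); rewrite (bigD1_seq a)//= eqxx big1 ?addr0//.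
  by move=> i /negPf ->; rewrite scale0r.
- under [RHS]eq_bigr do rewrite mulrDl.
  rewrite big_split/= addrC; congr (_ + _); rewrite (bigD1_seq a)//= eqxx big1 ?addr0//.
  by move=> i /negPf ->; rewrite mul0r.
Qed.

(** The constraint on vertex values and supporting forms, written as a rational affine function of
    the unknowns: a value for each [k'] and the coordinates of a form for each [k']. *)
Lemma rat_affine_vertex (K : finType) (a : K -> rat) (q : 'rV[rat]_n) (k : K) (b : rat)
    (Y : (K + K * 'I_n)%type -> R) :
  rat_affine ([ffun j => match j with inl k' => a k'
    | inr (k', i) => if k' == k then - q 0 i else 0 end], b) Y =
  \sum_k' ratr (a k') * Y (inl k') - pairing (\row_i Y (inr (k, i))) (map_mx ratr q) + ratr b.
Proof.
rewrite /rat_affine/= big_sumType/=; congr (_ + _ + _).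
  by apply: eq_bigr => k' _; rewrite ffunE.
rewrite -pairingNr /pairing (eq_bigr (fun p : K * 'I_n =>
    (if p.1 == k then - ratr (q 0 p.2) else 0) * Y (inr (p.1, p.2)))); last first.
  by move=> [k' i] _; rewrite ffunE/=; case: ifP => _; rewrite ?rmorphN ?rmorph0.
rewrite -(pair_big xpredT xpredT (fun k' i => (if k' == k then - ratr (q 0 i) else 0) * Y (inr (k', i))))/=.
rewrite (bigD1 k)//= [X in _ + X]big1 ?addr0; last first.
  by move=> k' /negPf ->; rewrite big1// => i _; rewrite mul0r.
by apply: eq_bigr => i _; rewrite eqxx !mxE mulrC.
Qed.

Section Construction.
Variables (X : set V) (Pi : set (set V)) (gamma phi : V -> R) (C eps : R).
Hypotheses (oX : one_dim_polyhedral_space X) (sPi : polyhedral_structure X Pi) (rPi : rooted Pi).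
Hypotheses (pag : PA_on X Pi gamma) (pcf : PC X phi).
Hypotheses (fgC : forall x, X x -> `|phi x - gamma x| <= C) (eps0 : 0 < eps).
Hypothesis osc : forall s x y, Pi s -> s x -> s y ->
  `|(phi x - gamma x) - (phi y - gamma y)| <= eps.

Let cPi : polyhedral_complex Pi. Proof. by case: sPi. Qed.
Let tPi : thin Pi. Proof. exact: structure_thin sPi. Qed.

Let root e : V := get [set v | star Pi v e].
Let rootP e : edges Pi e -> star Pi (root e) e.
Proof. by move=> /rPi h; exact: (@getPex _ [set v | star Pi v e] h). Qed.

Let mcg e : 'rV[rat]_n * rat := get [set mc | affine_on e gamma mc].
Let mcgP e : Pi e -> affine_on e gamma (mcg e).
Proof. by move=> /pag.2 h; exact: (@getPex _ [set mc | affine_on e gamma mc] h). Qed.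

(** The slopes of [gamma] on the rays: keeping them makes the difference to [gamma] bounded. *)
Let sl e : R := pairing (map_mx ratr (mcg e).1) (primitive_at e (root e)).

Let star_prim e v : star Pi v e -> prim (primitive_at e v).
Proof.
move=> Se; have [pu _] := primitive_atP cPi tPi Se; exact: (primitive_prim cPi tPi Se.1).
Qed.

Let slP e v : star Pi v e -> is_ray e v (primitive_at e v) -> forall t, 0 <= t ->
  gamma (v + t *: primitive_at e v) = gamma v + t * sl e.
Proof.
move=> Se ry t t0; have [Ee _ ev] := (starP cPi _ _).1 Se.
have rE : root e = v by apply/(ray_vertices cPi _ Se erefl ry); exact: rootP.
rewrite !(mcgP Ee.1)//; last by apply/ry; exists t.
by rewrite pairingDr pairingZr /sl rE addrAC.
Qed.

Let sl_rat e : edges Pi e -> israt (sl e).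
Proof.
move=> Ee; apply: israt_pairing; first by exists (mcg e).1.
by apply: lattice_rational; have [] := star_prim (rootP Ee).
Qed.

(** A second point of the edge, at which increments are measured: the other end, or the point at
    lattice distance one on a ray. *)
Let step e v : V := if pselect (exists L, is_segment e v (primitive_at e v) L) is left h
  then projT1 (cid h) *: primitive_at e v else primitive_at e v.

Let stepP e v : star Pi v e ->
  (exists L, [/\ is_segment e v (primitive_at e v) L, step e v = L *: primitive_at e v &
     star Pi (v + step e v) e]) \/
  (is_ray e v (primitive_at e v) /\ step e v = primitive_at e v).
Proof.
move=> Se; rewrite /step; case: pselect => [h|h].
  left; case: cid => L sg /=; exists L; split => //.
  by have [] := segment_end cPi tPi Se erefl sg.
by right; have [|] := edge_shape cPi tPi Se erefl.
Qed.

Let step_in e v : star Pi v e -> e (v + step e v).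
Proof.
move=> Se; have [[L [_ _ /(starP cPi)[]//]]|[ry ->]] := stepP Se.
by apply/ry; exists 1; rewrite ?ler01 ?scale1r.
Qed.

Let step_rat e v : star Pi v e -> rational_points (step e v).
Proof.
move=> Se; have [_ Pv _] := (starP cPi _ _).1 Se.
have [[L [_ _ /(starP cPi)[_ Pw _]]]|[ry ->]] := stepP Se; last first.
  by apply: lattice_rational; have [] := star_prim Se.
have -> : step e v = (v + step e v) - v by rewrite addrC addKr.
by apply: rational_pointsB; [exact: (structure_vertex_rational sPi Pw)|exact: (structure_vertex_rational sPi Pv)].
Qed.

(** The increment along the edge of the interpolation of the vertex values [y]. *)
Let incr (y : V -> R) e v : R :=
  if pselect (is_ray e v (primitive_at e v)) then sl e else y (v + step e v) - y v.

(** On a ray, $\phi - \gamma$ is nonincreasing by convexity and boundedness. *)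
Let incr_ge e v : star Pi v e -> phi (v + step e v) - phi v <= incr phi e v.
Proof.
move=> Se; rewrite /incr; case: pselect => [ry|] //; have [Ee Pv ev] := (starP cPi _ _).1 Se.
have [[L [sg _ _]]|[_ ->]] := stepP Se.
  by case: (ray_not_segment sg ry); apply: prim_neq0; exact: star_prim.
have ag : affine_cell gamma e := affine_on_cell (mcgP Ee.1).
have := ray_nonincreasing pcf sPi Ee.1 ry ag fgC (lexx 0) ler01.
rewrite /= (slP Se ry ler01) scale0r addr0 scale1r. lra.
Qed.

(** Farkas' lemma: a relation between the steps makes $0$ at most the combination of the
    increments of [phi], by polyhedral convexity, hence of the larger increments [incr phi]. *)
Let supporting v : Pi [set v] -> exists m : V, forall e, star Pi v e ->
  pairing m (step e v) <= incr phi e v.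
Proof.
move=> Pv; pose st : seq (set V) := fset_set (star Pi v).
have fS : finite_set (star Pi v).
  by have [fPi _ _ _] := cPi; apply: sub_finite_set fPi => e [[]].
have stP e : e \in st <-> star Pi v e by rewrite in_fset_set// inE.
have [|m mP] := @farkas _ _ [seq (step e v, incr phi e v) | e <- st]; last first.
  by exists m => e /stP es; exact: (mP _ (map_f _ es)).
move=> s /(cone_sum (fset_uniq _))[k [k0 /esym kd ->]].
apply: le_trans (PC_relation (x := v) (c := k) (d := step ^~ v) pcf sPi Pv _ kd) _.
  move=> e /stP Se; have [Ee _ ev] := (starP cPi _ _).1 Se; split => //.
  - by case: Ee.
  - exact: step_in.
  - by apply: rational_pointsD; [exact: structure_vertex_rational sPi Pv|exact: step_rat].
rewrite big_seq [leRHS]big_seq; apply: ler_sum => e /stP Se.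
by rewrite ler_wpM2l// incr_ge.
Qed.

(** Values and supporting forms at the vertices are the unknowns of finitely many rational
    inequalities. The values of [phi] and the forms of [supporting] solve them, and rational
    solutions are dense. *)
Lemma rational_data : exists (y : V -> R) (m : V -> V),
  [/\ forall v, Pi [set v] -> israt (y v),
    forall v, Pi [set v] -> `|y v - phi v| <= eps &
    forall v e, star Pi v e -> pairing (m v) (step e v) <= incr y e v].
Proof.
have fV : finite_set (vertices Pi).
  have [fPi _ _ _] := cPi; apply: (@sub_finite_set _ _ ((fun s => get s) @` Pi)).
    by move=> v Pv; exists [set v] => //; apply: get_unique.
  exact: finite_image.
pose vs : seq V := fset_set (vertices Pi); pose K := seq_sub vs.
have vsP v : v \in vs <-> Pi [set v] by rewrite in_fset_set// inE.
pose fE : seq (set V) := fset_set (edges Pi).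
have fEP e : e \in fE <-> edges Pi e.
  rewrite in_fset_set ?inE//; have [fPi _ _ _] := cPi; apply: sub_finite_set fPi => s [].
  by [].
pose I := (K + K * 'I_n)%type.
pose yY (Y : I -> R) v : R := if insub v is Some k then Y (inl k) else 0.
pose mY (Y : I -> R) v : V := if insub v is Some k then \row_i Y (inr (k, i)) else 0.
have ex_c (p : set V * V) : exists c : {ffun I -> rat} * rat, star Pi p.2 p.1 ->
    forall Y, rat_affine c Y = incr (yY Y) p.1 p.2 - pairing (mY Y p.2) (step p.1 p.2).
  case: p => e v /=; have [Se|h] := pselect (star Pi v e); last by exists (0, 0).
  have [Ee Pv ev] := (starP cPi _ _).1 Se.
  have [q qE] := step_rat Se; have vvs : v \in vs by apply/vsP.
  pose k : K := SeqSub vvs.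
  have kE : insub v = Some k by rewrite insubT; congr Some; exact: val_inj.
  have mE Y : mY Y v = \row_i Y (inr (k, i)) by rewrite /mY kE.
  rewrite /incr; case: pselect => [ry|nry].
    have [b bE] := sl_rat Ee; exists ([ffun j => match j with inl k' => 0
      | inr (k', i) => if k' == k then - q 0 i else 0 end], b) => _ Y.
    rewrite (@rat_affine_vertex K (fun=> 0)) mE qE bE big1 ?add0r 1?addrC//.
    by move=> i _; rewrite rmorph0 mul0r.
  have [[L [sg dE Sw]]|[//]] := stepP Se.
  have wvs : v + step e v \in vs by apply/vsP; have [] := (starP cPi _ _).1 Sw.
  pose kw : K := SeqSub wvs.
  have kwE : insub (v + step e v) = Some kw by rewrite insubT; congr Some; exact: val_inj.
  exists ([ffun j => match j with inl k' => (k' == kw)%:R - (k' == k)%:R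
      | inr (k', i) => if k' == k then - q 0 i else 0 end], 0) => _ Y.
  rewrite (@rat_affine_vertex K (fun k' => (k' == kw)%:R - (k' == k)%:R)) mE -qE rmorph0 addr0.
  congr (_ - _); rewrite /yY kE kwE.
  under eq_bigr do rewrite rmorphB mulrBl !rmorph_nat.
  have one (k0 : K) : \sum_(k' : K) (k' == k0)%:R * Y (inl k') = Y (inl k0).
    by rewrite (bigD1 k0)//= eqxx mul1r big1 ?addr0// => i /negPf ->; rewrite mul0r.
  by rewrite sumrB !one.
pose cf p := sval (cid (ex_c p)).
have cfP e v : star Pi v e -> forall Y, rat_affine (cf (e, v)) Y =
    incr (yY Y) e v - pairing (mY Y v) (step e v).
  by move=> Se; rewrite /cf; case: cid => c /= /(_ Se).
pose cs := [seq cf (e, v) | e <- fE, v <- [seq v <- vs | `[< star Pi v e >] ]].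
pose m0 v : V := if pselect (Pi [set v]) is left h then projT1 (cid (supporting h)) else 0.
have m0P v e : star Pi v e -> pairing (m0 v) (step e v) <= incr phi e v.
  move=> Se; rewrite /m0; case: pselect => [h|[]]; first by case: cid => m /= /(_ e Se).
  by have [] := (starP cPi _ _).1 Se.
pose Y0 (j : I) : R := match j with inl k => phi (val k) | inr (k, i) => m0 (val k) 0 i end.
have yY0 v : Pi [set v] -> yY Y0 v = phi v.
  move=> /vsP vvs; rewrite /yY insubT/=. by [].
have mY0 v : Pi [set v] -> mY Y0 v = m0 v.
  by move=> /vsP vvs; rewrite /mY insubT/=; apply/rowP => i; rewrite mxE.
have incrE Y e v : star Pi v e -> (forall w, Pi [set w] -> yY Y w = phi w) ->
    incr (yY Y) e v = incr phi e v.
  move=> Se h; rewrite /incr; case: pselect => // nry.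
  have [[L [sg dE Sw]]|[//]] := stepP Se.
  by rewrite !h//; [have [] := (starP cPi _ _).1 Se|have [] := (starP cPi _ _).1 Sw].
have [|q qP qY] := @rational_polyhedron_dense R I cs Y0 eps eps0.
  move=> c /allpairsPdep[e [v [_ + ->]]]; rewrite mem_filter => /andP[/asboolP Se _].
  have [_ Pv _] := (starP cPi _ _).1 Se.
  by rewrite cfP// (incrE _ _ _ Se yY0) mY0// subr_ge0 m0P.
exists (yY (ratr \o q)), (mY (ratr \o q)); split.
- by move=> v /vsP vvs; rewrite /yY insubT/=; exists (q (inl (SeqSub vvs))).
- by move=> v /vsP vvs; rewrite /yY insubT/= ltW//; exact: (qY (inl (SeqSub vvs))).
- move=> v e Se; have [Ee Pv ev] := (starP cPi _ _).1 Se.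
  have : cf (e, v) \in cs.
    apply/allpairsPdep; exists e, v; split => //; first exact/fEP.
    by rewrite mem_filter; apply/andP; split; [exact/asboolP|exact/vsP].
  by move=> /qP; rewrite cfP// subr_ge0.
Qed.

(** At a vertex the interpolation is supported by the form of [rational_data], inside an edge it is
    affine: so [support_PC] applies. On a cell, [psi] and [phi] differ from [gamma] by functions that
    vary by at most [eps], and are close at the vertices. *)
Lemma PAPC_approximation : exists psi : V -> R,
  PAPC_growth X gamma psi /\ forall x, X x -> `|psi x - phi x| <= 2 * eps.
Proof.
have [y [m [yrat yphi ym]]] := rational_data.
have [psi [cpsi psiv apsi psiray psirat]] := PL_extension oX sPi rPi y sl.
have psi_step v e : star Pi v e -> psi (v + step e v) - psi v = incr y e v.
  move=> Se; rewrite /incr; case: pselect => [ry|nry].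
    have [[L [sg dE Sw]]|[_ ->]] := stepP Se.
      by case: (ray_not_segment sg ry); apply: prim_neq0; exact: star_prim.
    have := psiray _ _ 1 Se ry ler01; rewrite scale1r => ->.
    by have [_ Pv _] := (starP cPi _ _).1 Se; rewrite psiv// mul1r addrAC subrr add0r.
  have [[L [sg dE Sw]]|[//]] := stepP Se.
  by rewrite !psiv//; [have [] := (starP cPi _ _).1 Se|have [] := (starP cPi _ _).1 Sw].
have reach v e z : star Pi v e -> e z -> exists2 t, 0 <= t & z = v + t *: step e v.
  move=> Se ez; have [[L [sg -> _]]|[ry ->]] := stepP Se.
    have [L0 /(_ z)[/(_ ez)[t /andP[t0 _] ->] _]] := sg; exists (t / L); first by rewrite divr_ge0// ltW.
    by rewrite scalerA mulfVK ?gt_eqF.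
  by have [t t0 ->] := (ry z).1 ez; exists t.
have pc : PC X psi.
  apply: support_PC => // x Xx; have [d d0 dP] := near_cells x sPi.
  have [Px|Px] := pselect (Pi [set x]).
    exists (m x), d => // z Xz zx; have [_ XE] := sPi; rewrite -XE in Xz.
    have [s Ps sz] := Xz; have sx := dP s z Ps sz zx.
    have [Es|[w sE]] := cell_cases oX sPi Ps; last first.
      by move: sz sx; rewrite sE => /= -> ->; rewrite subrr pairing0r addr0.
    have Se : star Pi x s by apply/(starP cPi).
    have [t t0 zE] := reach _ _ _ Se sz; have [mm [c psiE]] := apsi s Ps.
    have Dz : psi z - psi x = t * incr y s x.
      rewrite -(psi_step _ _ Se) !psiE//; last exact: step_in.
      by rewrite zE !pairingDr !pairingZr; ring.
    have -> : psi z = psi x + t * incr y s x by rewrite -Dz addrC subrK.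
    have -> : z - x = t *: step s x by rewrite zE addrC addKr.
    by rewrite lerD2l pairingZr ler_wpM2l// ym.
  have [s Ps sx] : Defs.support Pi x by have [_ ->] := sPi.
  have [Es|[w sE]] := cell_cases oX sPi Ps; last first.
    by case: Px; move: sx Ps; rewrite sE => /= ->.
  have [mm [c psiE]] := apsi s Ps; exists mm, d => // z Xz zx.
  have [s' Ps' s'z] : Defs.support Pi z by have [_ ->] := sPi.
  have s'x := dP s' z Ps' s'z zx.
  have [Es'|[w sE]] := cell_cases oX sPi Ps'; last first.
    by case: Px; move: s'x Ps'; rewrite sE => /= ->.
  have E := edge_through oX sPi Es Es' sx s'x Px; rewrite E in s'z.
  by rewrite !psiE// pairingBr; lra.
have close x : X x -> `|psi x - phi x| <= 2 * eps.
  move=> Xx; have [s Ps sx] : Defs.support Pi x by have [_ ->] := sPi.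
  have [Es|[v sE]] := cell_cases oX sPi Ps; last first.
    have Pv : Pi [set v] by rewrite -sE.
    by move: sx; rewrite sE => /= ->; rewrite psiv// (le_trans (yphi _ Pv))// mulr_natl mulr2n lerDl ltW.
  have Se := rootP Es; set v := root s in Se; have [_ Pv sv] := (starP cPi _ _).1 Se.
  have vtx w : Pi [set w] -> s w -> `|(psi w - gamma w) - (phi x - gamma x)| <= 2 * eps.
    move=> Pw sw; have -> : (psi w - gamma w) - (phi x - gamma x) =
      (y w - phi w) + ((phi w - gamma w) - (phi x - gamma x)) by rewrite psiv//; ring.
    have := yphi w Pw; have := osc Ps sw sx.
    by move=> h1 h2; rewrite (le_trans (ler_normD _ _))//; lra.
  suff [w1 [w2 [t [[P1 s1] [P2 s2] /andP[t0 t1] E]]]] : exists w1 w2 t, [/\ Pi [set w1] /\ s w1,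
      Pi [set w2] /\ s w2, 0 <= t <= 1 &
     psi x - gamma x = (1 - t) * (psi w1 - gamma w1) + t * (psi w2 - gamma w2)].
    have := vtx _ P1 s1; have := vtx _ P2 s2.
    have -> : psi x - phi x = (psi x - gamma x) - (phi x - gamma x) by ring.
    rewrite E !ler_norml => /andP[a1 a2] /andP[b1 b2].
    by apply/andP; split; nra.
  have [mm [c psiE]] := apsi s Ps; have gE := mcgP Ps.
  have [[L [sg dE Sw]]|[ry dE]] := stepP Se; last first.
    exists v, v, 0; split => //; first by rewrite lexx ler01.
    rewrite subr0 mul1r mul0r addr0.
    have [t t0 ->] := (ry x).1 sx.
    by rewrite (slP Se ry t0) (psiray _ _ _ Se ry t0) psiv//; ring.
  have [_ Pw sw] := (starP cPi _ _).1 Sw.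
  have [L0 /(_ x)[/(_ sx)[t /andP[t0 tL] xE] _]] := sg.
  exists v, (v + step s v), (t / L); split => //.
    by rewrite divr_ge0 ?ler_pdivrMr ?mul1r// ltW.
  rewrite !psiE// !gE// xE dE !pairingDr !pairingZr; field; rewrite gt_eqF//.
exists psi; split => //; split; last first.
  exists (2 * eps + C) => x Xx; have := close x Xx; have := fgC Xx => h1 h2.
  rewrite -[psi x](subrK (phi x)) -addrA (le_trans (ler_normD _ _))// lerD//.
split => //; exists Pi => //; split => //; apply: psirat => // e; exact: sl_rat.
Qed.

End Construction.

End Approximation.

(** * Twice differentiable functions on the line *)

Section Smooth.
Variable R : realType.
Implicit Types g : R -> R.

Definition C2 g := [/\ forall t, derivable g t 1, forall t, derivable (derive1 g) t 1 &
  continuous (derive1n 2 g)].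

Lemma derive1n2E g : derive1n 2 g = derive1 (derive1 g).
Proof. by []. Qed.

Lemma derivable_is_derive g t : derivable g t 1 -> is_derive t 1 g (derive1 g t).
Proof. by move=> h; rewrite derive1E; exact: DeriveDef. Qed.

Lemma derivable_continuous g : (forall t, derivable g t 1) -> continuous g.
Proof. by move=> h t; apply: differentiable_continuous; apply/derivable1_diffP. Qed.

(** If $g'' < 0$ near $t$, then by the mean value theorem $g'$ is strictly decreasing, so that the
    increment on the right of $t$ is smaller than the one on the left. *)
Lemma C2_convex_ge0 g (J : set R) : C2 g ->
  (forall s t, J s -> J t -> g ((s + t) / 2) <= (g s + g t) / 2) ->
  forall t, J° t -> 0 <= derive1n 2 g t.
Proof.
move=> [g1 g2 g3] gJ t Jt; rewrite leNgt; apply/negP => gt0.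
have : \forall s \near t, J s /\ derive1n 2 g s < 0.
  near=> s; split; first by near: s.
  by near: s; apply: cvgr_lt; [exact: g3|].
move=> /nbhs_ballP[e /= e0 eP].
pose h := e / 2; have h0 : 0 < h by rewrite divr_gt0.
have he : h < e by rewrite ltr_pdivrMr// ltr_pMr// ltr1n.
have inb s : `|s - t| <= h -> J s /\ derive1n 2 g s < 0.
  by move=> st; apply: eP; rewrite -ball_normE/= distrC (le_lt_trans st).
have mvt a b : a < b -> exists2 c, a < c < b & g b - g a = derive1 g c * (b - a).
  move=> ab; have [|c] := @MVT R g (derive1 g) a b ab (fun x _ => derivable_is_derive (g1 x)).
    by apply: continuous_subspaceT; exact: (derivable_continuous g1).
  by rewrite in_itv/= => cab cE; exists c.
have mvt' a b : a < b -> exists2 c, a < c < b & derive1 g b - derive1 g a = derive1n 2 g c * (b - a).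
  move=> ab; have [|c] := @MVT R (derive1 g) (derive1n 2 g) a b ab (fun x _ => derivable_is_derive (g2 x)).
    by apply: continuous_subspaceT; exact: (derivable_continuous g2).
  by rewrite in_itv/= => cab cE; exists c.
have [|c1 /andP[c1a c1b] E1] := mvt t (t + h); first by rewrite ltrDl.
have [|c2 /andP[c2a c2b] E2] := mvt (t - h) t; first by rewrite ltrBlDr ltrDl.
have [|c3 /andP[c3a c3b] E3] := mvt' c2 c1; first by lra.
have c3n : `|c3 - t| <= h by rewrite ler_norml; clear -c1b c2a c3a c3b; lra.
have [_ gc3] := inb _ c3n.
have [J1 _] : J (t + h) /\ derive1n 2 g (t + h) < 0.
  by apply: inb; rewrite addrAC subrr add0r gtr0_norm.
have [J2 _] : J (t - h) /\ derive1n 2 g (t - h) < 0.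
  by apply: inb; rewrite addrAC subrr add0r normrN gtr0_norm.
have := gJ _ _ J1 J2; rewrite (_ : (t + h + (t - h)) / 2 = t); last by field.
have : derive1 g c1 - derive1 g c2 < 0 by rewrite E3 nmulr_rlt0// subr_gt0 (lt_trans c2b).
move: E1 E2; rewrite addrAC subrr add0r opprB addrCA subrr addr0 => E1 E2 h1 h2.
have : (derive1 g c1 - derive1 g c2) * h < 0 by rewrite nmulr_rlt0.
move: h2 E1 E2; clear.
move: (g (t + h)) (g (t - h)) (g t) (derive1 g c1) (derive1 g c2) (h) => A B C D E F; lra.
Unshelve. all: by end_near. Qed.

Lemma affine_is_derive (a s t : R) : is_derive t 1 (fun t => a + s * t) s.
Proof. by apply: is_derive_eq; rewrite add0r mul1r; exact: mulr1. Qed.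

Lemma derive1_affine_comp g (a s : R) : (forall t : R, derivable g t 1) ->
  (forall t : R, derivable (fun t : R => g (a + s * t)) t 1) /\
  derive1 (fun t : R => g (a + s * t)) = (fun t => s * derive1 g (a + s * t)).
Proof.
move=> g1.
have h (t : R) : is_derive t 1 (fun t : R => g (a + s * t)) (s * derive1 g (a + s * t)).
  have h1 := derivable_is_derive (g1 (a + s * t)).
  have h2 := @is_derive1_comp R g (fun t => a + s * t) t _ _ h1 (affine_is_derive a s t).
  by rewrite (_ : s * _ = derive1 g (a + s * t) * s); [exact: h2|exact: mulrC].
split; first by move=> t; case: (h t).
by apply/funext => t; rewrite derive1E; apply: derive_val.
Qed.

Lemma continuous_affine (a s : R) : continuous (fun t : R => a + s * t).
Proof. by apply: derivable_continuous => t; case: (affine_is_derive a s t). Qed.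

Lemma continuous_affine_comp (h : R -> R) (a s : R) : continuous h ->
  continuous (fun t => h (a + s * t)).
Proof.
move=> ch t; apply: (@continuous_comp R R R (fun t => a + s * t) h t).
  exact: continuous_affine.
exact: ch.
Qed.

Lemma C2_affine_comp g (a s : R) : C2 g -> C2 (fun t => g (a + s * t)).
Proof.
move=> [g1 g2 g3]; have [h1 h1E] := derive1_affine_comp a s g1.
have [h2 h2E] := derive1_affine_comp a s g2.
have E : derive1n 2 (fun t => g (a + s * t)) = (fun t => s * (s * derive1n 2 g (a + s * t))).
  by rewrite derive1n2E h1E; apply/funext => t; rewrite derive1Ml// h2E.
split; first exact: h1.
  by rewrite h1E => t; apply: derivableM => //; exact: derivable_cst.
rewrite E; move: (derive1n 2 g) g3 => g'' g3 t.
have c1 : continuous (fun t => g'' (a + s * t)) by exact: continuous_affine_comp g3.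
apply: (@cvgM R R (nbhs t) _ (cst s) (fun t => s * g'' (a + s * t)) s); first exact: cvg_cst.
apply: (@cvgM R R (nbhs t) _ (cst s) (fun t => g'' (a + s * t)) s); first exact: cvg_cst.
exact: c1.
Qed.

Lemma C2_dirderiv g (a s : R) : C2 g ->
  t^-1 * (g (a + s * t) - g a) @[t --> 0^'+] --> s * derive1 g a.
Proof.
move=> [g1 _ _]; have [h1 h1E] := derive1_affine_comp a s g1.
pose k (t : R) := g (a + s * t).
have kv : 'D_1 k 0 = s * derive1 g a by rewrite -derive1E h1E mulr0 addr0.
have lk : (fun h : R => h^-1 *: ((k \o shift 0) (h *: 1) - k 0)) @ (0 : R)^' --> 'D_1 k 0.
  exact: (h1 0).
have := cvg_dnbhs_at_right lk; rewrite kv; apply: cvg_trans; apply: near_eq_cvg.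
near=> t; rewrite /= /k /= addr0 mulr0 addr0 [t *: 1]mulr1. by [].
Unshelve. all: by end_near. Qed.

(** Integration by parts: $(c + r t) g'(t) - r g(t)$ is a primitive. *)
Lemma C2_parts g (a b c r : R) : C2 g -> a < b ->
  (\int[lebesgue_measure]_(t in `]a, b[) ((c + r * t) * derive1n 2 g t)%:E =
  ((c + r * b) * derive1 g b - (c + r * a) * derive1 g a - r * (g b - g a))%:E)%E.
Proof.
move=> [g1 g2 g3] ab.
pose F t := (c + r * t) * derive1 g t - r * g t.
have dF (t : R) : is_derive t 1 F ((c + r * t) * derive1n 2 g t).
  have h1 := affine_is_derive c r t.
  have h2 := derivable_is_derive (g1 t); have h3 := derivable_is_derive (g2 t).
  have h4 := is_deriveM h1 h3; have h5 := is_deriveZ r h2.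
  have := is_deriveB h4 h5; move/is_derive_eq; apply.
  by rewrite /GRing.scale/=; ring.
have cF : continuous F by apply: derivable_continuous => t; case: (dF t).
have cf : continuous (fun t => (c + r * t) * derive1n 2 g t).
  by move=> t; apply: cvgM; [exact: continuous_affine|exact: g3].
have H1 : {within `[a, b], continuous (fun t => (c + r * t) * derive1n 2 g t)}.
  exact: continuous_subspaceT.
have H2 : derivable_oo_LRcontinuous F a b.
  split; first by move=> t _; case: (dF t).
  + by apply: cvg_at_right_filter; exact: cF.
  + by apply: cvg_at_left_filter; exact: cF.
have H3 : {in `]a, b[, derive1 F =1 (fun t => (c + r * t) * derive1n 2 g t)}.
  by move=> t _; rewrite derive1E; apply: derive_val.
have := continuous_FTC2 ab H1 H2 H3; rewrite -EFinB.
rewrite integral_itv_bndoo; first by move=> ->; congr EFin; rewrite /F; ring.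
by apply/measurable_EFinP; apply: measurable_funTS; exact: continuous_measurable_fun.
Qed.

End Smooth.

(** * Piecewise $C^2$ functions on the space *)

Section C2Edges.
Variables (R : realType) (n : nat) (X : balanced_space R n).
Local Notation V := 'rV[R]_n.
Implicit Types (sigma tau S : set V) (x y z v u : V) (Pi : set (set V)) (f : V -> R).

Let oX := bs_one_dim X.

Lemma edge_frameP Pi (e : set V) : polyhedral_structure X Pi -> edges Pi e ->
  e (edge_frame e).1 /\ primitive_vector e (edge_frame e).2.
Proof.
move=> sPi Ee; have cPi := structure_complex sPi; have tPi := structure_thinX sPi.
have [p ep] := cell_nonempty cPi Ee.1; have [u pu] := edge_primitive cPi tPi Ee.
exact: (@getPex _ [set pu : V * V | e pu.1 /\ primitive_vector e pu.2] (ex_intro _ (p, u) (conj ep pu))).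
Qed.

Lemma edge_frame_prim Pi (e : set V) : polyhedral_structure X Pi -> edges Pi e ->
  prim (edge_frame e).2.
Proof.
move=> sPi Ee; have [_ pu] := edge_frameP sPi Ee.
exact: primitive_prim (structure_complex sPi) (structure_thinX sPi) _ _ Ee pu.
Qed.

Lemma edge_pointB (e : set V) s t : edge_point e s - edge_point e t = (s - t) *: (edge_frame e).2.
Proof. by rewrite /edge_point opprD addrACA subrr add0r scalerBl. Qed.

Lemma edge_pointD (e : set V) s t : edge_point e (s + t) = edge_point e s + t *: (edge_frame e).2.
Proof. by rewrite /edge_point scalerDl addrA. Qed.

Lemma edge_point_inj Pi (e : set V) s t : polyhedral_structure X Pi -> edges Pi e ->
  edge_point e s = edge_point e t -> s = t.
Proof.
move=> sPi Ee /eqP; rewrite -subr_eq0 edge_pointB scaler_eq0 subr_eq0.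
by rewrite (negPf (prim_neq0 (edge_frame_prim sPi Ee))) orbF => /eqP.
Qed.

Lemma edge_point_surj Pi (e : set V) x : polyhedral_structure X Pi -> edges Pi e -> e x ->
  exists t, x = edge_point e t.
Proof.
move=> sPi Ee ex; have [ep pu] := edge_frameP sPi Ee.
by have [t xE] := primitive_line (structure_thinX sPi) Ee pu ep ex; exists t.
Qed.

Lemma edge_point_convex Pi (e : set V) s t r : polyhedral_structure X Pi -> edges Pi e ->
  e (edge_point e s) -> e (edge_point e t) -> s <= r <= t -> e (edge_point e r).
Proof.
move=> sPi Ee es et /andP[sr rt]; have [st|st] := eqVneq s t.
  by rewrite (_ : r = s)//; apply/eqP; rewrite eq_le sr st rt.
have st0 : 0 < t - s by rewrite subr_gt0 lt_neqAle st (le_trans sr).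
have := cell_convex (structure_complex sPi) Ee.1 es et (t := (r - s) / (t - s)).
rewrite edge_pointB scalerA mulfVK ?gt_eqF// -edge_pointD (_ : s + (r - s) = r); last by ring.
apply; first by rewrite divr_ge0 ?(ltW st0)// subr_ge0.
by rewrite ler_pdivrMr// mul1r lerB.
Qed.

Lemma C2_on_edgeP (e : set V) f : C2_on_edge e f <->
  exists g, C2 g /\ forall t, e (edge_point e t) -> f (edge_point e t) = g t.
Proof.
by split=> [[g [g1 g2 g3 gE]]|[g [[g1 g2 g3] gE]]]; exists g.
Qed.

(** Primitive vectors of both edges agree up to sign, since the edges have the same line. *)
Lemma edge_frame_sub Pi Pi' (e e' : set V) : polyhedral_structure X Pi ->
  polyhedral_structure X Pi' -> edges Pi e -> edges Pi' e' -> e' `<=` e ->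
  exists a s : R, (s = 1 \/ s = -1) /\ forall t, edge_point e' t = edge_point e (a + s * t).
Proof.
move=> sPi sPi' Ee Ee' ee'; have cPi := structure_complex sPi; have tPi := structure_thinX sPi.
have [ep pu] := edge_frameP sPi Ee; have [ep' pu'] := edge_frameP sPi' Ee'.
have [a aE] := edge_point_surj sPi Ee (ee' _ ep').
have pru' := edge_frame_prim sPi' Ee'.
have [x [y [ex ey xy]]] := edge_two_points (structure_complex sPi') (structure_thinX sPi') Ee'.
have [t yE] := primitive_line (structure_thinX sPi') Ee' pu' ex ey.
have t0 : t != 0 by apply: contra_neq xy => t0; rewrite yE t0 scale0r addr0.
have pue : primitive_vector e (edge_frame e').2.
  exact: (primitive_vector_of tPi Ee pru' (ee' _ ex) (ee' _ ey) t0 yE).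
exists a; have [uE|uE] := primitive_vector_unique cPi tPi Ee pu pue.
  by exists 1; split; [left|move=> r; rewrite mul1r edge_pointD -aE -uE].
exists (-1); split; [by right|move=> r].
by rewrite mulN1r edge_pointD -aE scaleNr -scalerN -uE.
Qed.

Lemma C2_refine Pi Pi' f : polyhedral_structure X Pi -> weighted_structure X Pi' ->
  refines Pi' Pi -> (forall e, edges Pi e -> C2_on_edge e f) ->
  forall e, edges Pi' e -> C2_on_edge e f.
Proof.
move=> sPi wPi' rf h e Ee; have sPi' := wPi'.1.
have [E PE eE] := rf _ Ee.1.
have EE : edges Pi E.
  apply/(edgeP (structure_complex sPi) (structure_thinX sPi)); split => //.
  have [x [y [ex ey xy]]] := edge_two_points (structure_complex sPi') (structure_thinX sPi') Ee.
  by exists x, y; split => //; exact: eE.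
have [g [Cg gE]] := (C2_on_edgeP _ _).1 (h _ EE).
have [a [s [_ epE]]] := edge_frame_sub sPi sPi' EE Ee eE.
apply/C2_on_edgeP; exists (fun t => g (a + s * t)); split; first exact: C2_affine_comp.
by move=> t et; rewrite epE gE// -epE; exact: eE.
Qed.

Lemma laplacianE f : PS X f -> exists Pi, [/\ weighted_structure X Pi,
  forall e, edges Pi e -> C2_on_edge e f & laplacian X f = laplacian_on X Pi f].
Proof.
move=> [_ [Pi0 sPi0 h]]; have [Pi1 [w1 r1 _]] := weighted_refinement sPi0 sPi0.
have := @getPex _ [set Pi | weighted_structure X Pi /\ forall e, edges Pi e -> C2_on_edge e f]
  (ex_intro _ Pi1 (conj w1 (C2_refine sPi0 w1 r1 h))).
by rewrite /laplacian; move: (get _) => Pi [/= wPi hPi]; exists Pi.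
Qed.

Section Structure.
Variables (Pi : set (set V)) (phi : V -> R).
Hypotheses (wPi : weighted_structure X Pi) (C2e : forall e, edges Pi e -> C2_on_edge e phi).
Hypothesis pc : PC X phi.

Let sPi : polyhedral_structure X Pi := wPi.1.
Let cPi := structure_complex sPi.
Let tPi : thin Pi. Proof. exact: structure_thinX sPi. Qed.

(** The $C^2$ function on the whole line that represents [phi] on the edge [e]. *)
Definition edge_fun e : R -> R := if pselect (edges Pi e) is left h
  then sval (cid ((C2_on_edgeP _ _).1 (C2e h))) else cst 0.

Lemma edge_funP e : edges Pi e -> C2 (edge_fun e) /\
  forall t, e (edge_point e t) -> phi (edge_point e t) = edge_fun e t.
Proof. by move=> Ee; rewrite /edge_fun; case: pselect => // h; case: cid. Qed.

Definition edge_domain (e : set V) : set R := edge_point e @^-1` e.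

Lemma edge_second_derivative e t : edges Pi e -> (edge_domain e)° t ->
  derive1n 2 (phi \o edge_point e) t = derive1n 2 (edge_fun e) t.
Proof.
move=> Ee Jt; have [_ gE] := edge_funP Ee.
have d1 s : (edge_domain e)° s -> derive1 (phi \o edge_point e) s = derive1 (edge_fun e) s.
  move=> Js; rewrite !derive1E; apply: near_eq_derive.
  by apply: filterS Js => r er; exact: gE.
rewrite !derive1n2E !derive1E; apply: near_eq_derive.
have : \forall s \near t, (edge_domain e)° s by exact: nbhs_interior.
by apply: filterS => s Js; exact: d1.
Qed.

(** [phi] is midpoint convex on the edge. *)
Lemma edge_second_derivative_ge0 e t : edges Pi e -> (edge_domain e)° t ->
  0 <= derive1n 2 (edge_fun e) t.
Proof.
move=> Ee; have [Cg gE] := edge_funP Ee; apply: (C2_convex_ge0 Cg) => r s er es.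
have h01 : 0 <= (2^-1 : R) <= 1 by lra.
have := PC_convex_cell pc sPi Ee.1 er es h01.
rewrite edge_pointB scalerA -edge_pointD !gE//; last first.
  have [rs|sr] := leP r s.
    by apply: (edge_point_convex sPi Ee er es); apply/andP; split; lra.
  by apply: (edge_point_convex sPi Ee es er); apply/andP; split; lra.
rewrite (_ : r + 2^-1 * (s - r) = (r + s) / 2); last by field.
by move=> h; apply: (le_trans h); rewrite le_eqVlt; apply/orP; left; apply/eqP; field.
Qed.

Lemma edge_dirderiv_cvg e (t s eps : R) : edges Pi e -> e (edge_point e t) -> 0 < eps ->
  e (edge_point e (t + s * eps)) ->
  r^-1 * (phi (edge_point e t + r *: (s *: (edge_frame e).2)) - phi (edge_point e t)) @[r --> 0^'+]
    --> s * derive1 (edge_fun e) t.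
Proof.
move=> Ee et eps0 es; have [Cg gE] := edge_funP Ee.
have := @C2_dirderiv _ _ t s Cg; apply: cvg_trans; apply: near_eq_cvg.
near=> r; have r0 : 0 < r by near: r; exact: nbhs_right_gt.
have re : r < eps by near: r; exact: nbhs_right_lt.
have er : edge_point e t + r *: (s *: (edge_frame e).2) = edge_point e (t + s * r).
  by rewrite edge_pointD scalerA mulrC.
rewrite er !gE//.
have [s0|s0] := leP 0 s.
  apply: (edge_point_convex sPi Ee et es).
  by rewrite lerDl lerD2l mulr_ge0 ?ler_wpM2l// ltW.
apply: (edge_point_convex sPi Ee es et).
apply/andP; split; first by rewrite lerD2l ler_wnM2l ?ltW.
by rewrite gerDl mulr_le0_ge0 ?ltW.
Unshelve. all: by end_near. Qed.

(** In the coordinate of its edge a germ is one of the two directions of the line. *)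
Lemma germ_frame x u : germs X x u -> exists e t s eps,
  [/\ edges Pi e, x = edge_point e t, e x, u = s *: (edge_frame e).2 &
     [/\ 0 < eps, e (edge_point e (t + s * eps)) & s = 1 \/ s = -1]].
Proof.
move=> gu; have [e Pe [ex [eps eps0 et]]] := germ_cell sPi gu; have [pu _] := gu.
have Ee : edges Pi e.
  apply/(edgeP cPi tPi); split => //; exists x, (x + eps *: u); split => //.
  by apply: prim_shift => //; rewrite gt_eqF.
have [_ puf] := edge_frameP sPi Ee.
have pue : primitive_vector e u.
  by apply: (primitive_vector_of tPi Ee pu ex et) => //; rewrite gt_eqF.
have [t xE] := edge_point_surj sPi Ee ex.
have [s [sP uE]] : exists s : R, (s = 1 \/ s = -1) /\ u = s *: (edge_frame e).2.
  have [->|->] := primitive_vector_unique cPi tPi Ee puf pue.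
    by exists 1; split; [left|rewrite scale1r].
  by exists (-1); split; [right|rewrite scaleN1r].
exists e, t, s, eps; split => //; split => //.
by rewrite edge_pointD -xE mulrC -scalerA -uE.
Qed.

Lemma dirderiv_cvg x u : germs X x u ->
  r^-1 * (phi (x + r *: u) - phi x) @[r --> 0^'+] --> dirderiv phi x u.
Proof.
move=> /germ_frame[e [t [s [eps [Ee xE ex uE [eps0 es _]]]]]].
rewrite xE in ex; have := edge_dirderiv_cvg Ee ex eps0 es; rewrite -uE -xE => h.
by rewrite (dirderiv_eq h).
Qed.

Lemma edge_dirderivE e (t s eps : R) : edges Pi e -> e (edge_point e t) -> 0 < eps ->
  e (edge_point e (t + s * eps)) ->
  dirderiv phi (edge_point e t) (s *: (edge_frame e).2) = s * derive1 (edge_fun e) t.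
Proof. by move=> Ee et eps0 es; apply: dirderiv_eq; exact: (edge_dirderiv_cvg Ee et eps0 es). Qed.

Lemma C2_mass_ge0 Pi' x : weighted_structure X Pi' -> Pi' [set x] -> 0 <= mass X phi x.
Proof. by move=> w' Px; apply: (mass_ge0 pc w' Px) => u; exact: dirderiv_cvg. Qed.

(** A $C^2$ function has opposite slopes in opposite directions. *)
Lemma C2_mass_interior x : bs_carrier X x -> ~ Pi [set x] -> mass X phi x = 0.
Proof.
move=> Xx Px; apply: (mass_interior wPi Xx Px) => e u t Ee pu t0 et.
have [_ puf] := edge_frameP sPi Ee.
have ex : e x by rewrite -[x]addr0 -(scale0r u); apply: et; rewrite normr0 ltW.
have [r xE] := edge_point_surj sPi Ee ex.
have [s sP uE] : exists2 s : R, `|s| = 1 & u = s *: (edge_frame e).2.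
  have [->|->] := primitive_vector_unique cPi tPi Ee puf pu.
    by exists 1; rewrite ?scale1r ?normr1.
  by exists (-1); rewrite ?scaleN1r ?normrN ?normr1.
have e1 : e (edge_point e (r + s * t)).
  by rewrite edge_pointD -xE mulrC -scalerA -uE; apply: et; rewrite gtr0_norm.
have e2 : e (edge_point e (r + (- s) * t)).
  rewrite edge_pointD -xE mulrC -scalerA scaleNr -uE scalerN -scaleNr.
  by apply: et; rewrite normrN gtr0_norm.
rewrite xE in ex *; rewrite uE -scaleNr (edge_dirderivE Ee ex t0 e1) (edge_dirderivE Ee ex t0 e2).
by rewrite mulNr.
Qed.

End Structure.
End C2Edges.

(** * Sums of measures and measures with a density *)

Section Measures.
Context d (T : measurableType d) (R : realType).
Local Open Scope ereal_scope.
Import HBNNSimple.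

(** Finite sums of measures, indexed by the elements of a finite set. *)
Lemma sum_measure (I : choiceType) (S : set I) (m : I -> {measure set T -> \bar R}) :
  finite_set S -> exists L : {measure set T -> \bar R},
  (forall A, L A = \sum_(i \in S) m i A) /\
  forall D (f : T -> \bar R), measurable D -> (forall x, D x -> 0 <= f x) -> measurable_fun D f ->
    \int[L]_(x in D) f x = \sum_(i \in S) \int[m i]_(x in D) f x.
Proof.
move=> fS.
suff [L [L1 L2]] : exists L : {measure set T -> \bar R},
    (forall A, L A = \sum_(i <- fset_set S) m i A) /\
    forall D (f : T -> \bar R), measurable D -> (forall x, D x -> 0 <= f x) -> measurable_fun D f ->
      \int[L]_(x in D) f x = \sum_(i <- fset_set S) \int[m i]_(x in D) f x.
  exists L; split => [A|D f mD f0 mf]; first by rewrite L1 fsbig_finite.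
  by rewrite L2// fsbig_finite.
move: (fset_set S : seq I); elim=> [|i s [L [L1 L2]]].
  exists mzero; split => [A|D f mD f0 mf]; first by rewrite big_nil.
  by rewrite big_nil integral_measure_zero.
exists (measure_add (m i) L); split => [A|D f mD f0 mf].
  by rewrite big_cons -L1; exact: measure_addE.
by rewrite big_cons -L2//; exact: ge0_integral_measure_add.
Qed.

Variables (mu : {measure set T -> \bar R}).

(** The formula for integrals holds for simple functions and passes to monotone limits. *)
Lemma density_measure (f : T -> R) : (forall x, 0 <= f x)%R -> measurable_fun setT f ->
  exists nu : {measure set T -> \bar R}, (forall A, nu A = \int[mu]_(x in A) (f x)%:E) /\
  forall D (h : T -> \bar R), measurable D -> (forall x, D x -> 0 <= h x) -> measurable_fun D h ->
    \int[nu]_(x in D) h x = \int[mu]_(x in D) (h x * (f x)%:E).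
Proof.
move=> f0 mf; have mF : measurable_fun setT (EFin \o f) by exact/measurable_EFinP.
have F0 x : 0 <= (EFin \o f) x by rewrite lee_fin.
pose nu0 A := \int[mu]_(x in A) (f x)%:E.
have nu_set0 : nu0 set0 = 0 by exact: integral_set0.
have nu_ge0 A : 0 <= nu0 A by apply: integral_ge0 => x _; exact: F0.
have nu_add : semi_sigma_additive nu0 by exact: semi_sigma_additive_nng_induced mF F0.
pose nu : {measure set T -> \bar R} := HB.pack nu0 (isMeasure.Build _ _ _ nu0 nu_set0 nu_ge0 nu_add).
exists nu; split => // D h mD h0 mh.
have mFD : measurable_fun D (EFin \o f) by exact: measurable_funTS.
pose a := nnsfun_approx mD mh.
have aE x : D x -> h x = lim ((EFin \o a n) x @[n --> \oo]).
  by move=> Dx; apply/esym/cvg_lim => //; exact: cvg_nnsfun_approx.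
have ma n : measurable_fun D (EFin \o a n).
  by apply/measurable_EFinP; apply: measurable_funTS.
have -> : \int[nu]_(x in D) h x = lim (\int[nu]_(x in D) (EFin \o a n) x @[n --> \oo]).
  under eq_integral => x /[!inE] /aE -> //.
  apply: monotone_convergence => //.
  - by move=> n x Dx; rewrite lee_fin.
  - by move=> x Dx p q pq; rewrite lee_fin; exact/lefP/nd_nnsfun_approx.
have -> : \int[mu]_(x in D) (h x * (f x)%:E) =
    lim (\int[mu]_(x in D) ((EFin \o a n) x * (f x)%:E) @[n --> \oo]).
  have fg x : D x -> h x * (f x)%:E = lim (((EFin \o a n) x * (f x)%:E) @[n --> \oo]).
    move=> Dx; apply/esym/cvg_lim => //; apply: cvgeZr => //.
    exact: cvg_nnsfun_approx.
  under eq_integral => x /[!inE] /fg -> //.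
  apply: monotone_convergence => //.
  - by move=> n; apply: emeasurable_funM.
  - by move=> n x Dx; rewrite mule_ge0// lee_fin.
  - by move=> x Dx p q pq; apply: lee_wpmul2r; rewrite lee_fin//; exact/lefP/nd_nnsfun_approx.
suff E n : \int[mu]_(x in D) ((EFin \o a n) x * (f x)%:E) = \int[nu]_(x in D) (EFin \o a n) x.
  by under eq_fun do rewrite -E.
have mi r : measurable_fun D (fun x => (r * \1_(a n @^-1` [set r]) x)%:E).
  by apply: (measurable_comp measurableT) => //; exact: measurable_funM.
have i0 x r : D x -> 0 <= (r * \1_(a n @^-1` [set r]) x)%:E by move=> _; exact: nnfun_muleindic_ge0.
transitivity (\int[nu]_(x in D) (\sum_(y \in range (a n)) (y * \1_(a n @^-1` [set y]) x)%:E)); last first.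
  by apply: eq_integral => t tE; rewrite /= fimfunE -fsumEFin.
rewrite ge0_integral_fsum//; last by move=> y x Dx; exact: nnfun_muleindic_ge0.
transitivity (\int[mu]_(x in D) (\sum_(y \in range (a n))
    (y * \1_(a n @^-1` [set y]) x)%:E * (f x)%:E)).
  under [RHS]eq_integral => x xE.
    rewrite -ge0_mule_fsuml => [|y]; last exact: nnfun_muleindic_ge0.
    rewrite fsumEFin // -(fimfunE _ x); over.
  by [].
rewrite ge0_integral_fsum//; last 2 first.
  - by move=> y; apply: emeasurable_funM.
  - by move=> y x Dx; apply: mule_ge0; [exact: nnfun_muleindic_ge0|exact: F0].
apply: eq_fsbigr => r rhn.
under [RHS]eq_integral do rewrite EFinM.
rewrite integralZl_indic_nnsfun => //.
under eq_integral do rewrite EFinM -muleA.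
rewrite ge0_integralZl//.
- under eq_integral do rewrite muleC.
  rewrite (eq_integral ((EFin \o f) \_ (a n @^-1` [set r]))); last first.
    by move=> x xE; rewrite epatch_indic.
  rewrite -integral_mkcondr integral_indic// setIC.
  by congr (_ * _).
- by apply: emeasurable_funM => //; exact/measurable_EFinP.
- by move=> t Et; rewrite mule_ge0 ?lee_fin.
- by move: rhn; rewrite inE => -[t _ <-]; rewrite lee_fin.
Qed.

End Measures.

(** * Borel sets and functions *)

Section Borel.
Variables (R : realType) (n : nat).
Local Notation V := 'rV[R]_n.

Lemma open_borel (A : set V) : open A -> measurable (A : set (borelV R n)).
Proof. by move=> oA; exact: sub_sigma_algebra. Qed.

Lemma closed_borel (A : set V) : closed A -> measurable (A : set (borelV R n)).
Proof.
move=> cA; rewrite -[A]setCK; apply: measurableC; apply: open_borel.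
exact: closed_openC.
Qed.

Lemma measurable_to_borel (f : R -> V) : continuous f ->
  measurable_fun setT (f : measurableTypeR R -> borelV R n).
Proof.
move=> /continuousP cf; apply: (@measurability _ _ _ (borelV R n) _ _ (@open V)) => // _ [B oB <-].
by rewrite setTI; apply: open_measurable; exact: cf.
Qed.

Lemma within_borel (X : set V) (f : V -> R) : closed X -> {within X, continuous f} ->
  measurable_fun (X : set (borelV R n)) (f : borelV R n -> R).
Proof.
move=> cX /continuousP cf; apply: (measurability _ (RGenOpens.measurableE R)).
move=> _ [_ [a [b ->] <-]]; have oab : open (`]a, b[%classic : set R) by exact: interval_open.
have /open_subspaceP[U oU UE] := cf _ oab.
rewrite setIC -UE; apply: measurableI; [exact: open_borel|exact: closed_borel].
Qed.

Lemma edge_point_continuous (e : set V) : continuous (edge_point e).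
Proof. by move=> t; apply: cvgD; [exact: cvg_cst|apply: cvgZr_tmp; exact: cvg_id]. Qed.

End Borel.

(** * The Laplacian as a measure *)

Section LaplacianMeasure.
Variables (R : realType) (n : nat) (X : balanced_space R n).
Local Notation V := 'rV[R]_n.
Local Notation mu := (@lebesgue_measure R).
Implicit Types (sigma tau S : set V) (x y z v u : V) (Pi : set (set V)) (f : V -> R).

Variables (Pi : set (set V)) (phi : V -> R).
Hypotheses (wPi : weighted_structure X Pi) (C2e : forall e, edges Pi e -> C2_on_edge e phi).
Hypothesis pc : PC X phi.

Let sPi : polyhedral_structure X Pi := wPi.1.

Local Notation g := (edge_fun C2e).

Lemma measurable_second e : edges Pi e -> measurable_fun setT (derive1n 2 (g e)).
Proof. by move=> Ee; have [[_ _ h] _] := edge_funP C2e Ee; exact: continuous_measurable_fun. Qed.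

(** The push-forward to the edge of the second derivative times Lebesgue measure. Outside the
    interior of the edge, where it may be negative, the derivative is replaced by zero. *)
Lemma edge_measureP e : edges Pi e -> exists m : {measure set (borelV R n) -> \bar R},
  (forall A, measurable A -> m A = edge_measure X phi e A) /\
  forall (D : set (borelV R n)) (h : borelV R n -> \bar R), measurable D ->
  (forall x, D x -> (0 <= h x)%E) -> measurable_fun D h ->
  (\int[m]_(x in D) h x = (weight X e)%:E *
    \int[mu]_(t in (edge_domain e)° `&` (edge_point e @^-1` D))
      (h (edge_point e t) * (derive1n 2 (g e) t)%:E))%E.
Proof.
move=> Ee; pose J : set R := (edge_domain e)°; pose k : R -> R := (derive1n 2 (g e)) \_ J.
have mJ : measurable J by apply: open_measurable; exact: open_interior.
have k0 t : 0 <= k t.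
  rewrite /k patchE; case: ifPn => // /[!inE] Jt.
  exact: (edge_second_derivative_ge0 wPi C2e pc Ee Jt).
have mk : measurable_fun setT k.
  apply/(measurable_restrictT _ mJ); apply: measurable_funTS; exact: measurable_second.
have [nu [nuE nuI]] := density_measure mu k0 mk.
have mp := measurable_to_borel (@edge_point_continuous _ _ e).
have w0 := ltW (weight_gt0 wPi Ee).
pose w : {nonneg R} := NngNum w0.
pose m0 : {measure set (borelV R n) -> \bar R} :=
  measure_function_pushforward__canonical__measure_function_Measure nu mp.
pose m : {measure set (borelV R n) -> \bar R} := mscale w m0.
exists m; split.
  move=> A mA; rewrite /m /= /mscale/= /pushforward nuE /edge_measure; congr (_ * _)%E.
  rewrite integral_mkcondl; apply: eq_integral => t _; rewrite /k !patchE.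
  case: ifPn => [|_]; last exact: erefl.
  rewrite inE => Jt; by rewrite (edge_second_derivative C2e Ee Jt).
move=> D h mD h0 mh; rewrite /m ge0_integral_mscale//; congr (_ * _)%E.
transitivity (\int[nu]_(x in edge_point e @^-1` D) (h \o edge_point e) x)%E.
  have h0' : {in D, forall y, (0 <= h y)%E} by move=> x /[!inE] /h0.
  exact: (ge0_integral_pushforward mp nu mD mh h0').
have mpD : measurable (edge_point e @^-1` D).
  by rewrite -[X in measurable X]setTI; exact: (mp measurableT _ mD).
rewrite nuI//=; last 2 first.
- by move=> t Dt; exact: h0.
- apply: (measurable_comp mD) => //; last exact: measurable_funTS.
  by move=> _ [t Dt <-].
rewrite integral_mkcondl; apply: eq_integral => t _; rewrite /k !patchE.
case: ifPn => _; [exact: erefl|exact: mule0].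
Qed.

(** Weights, second derivatives and masses are nonnegative, so that the sum that defines the
    Laplacian is a measure. *)
Lemma laplacian_measure : exists L : {measure set (borelV R n) -> \bar R},
  (forall A, measurable A -> L A = laplacian_on X Pi phi A) /\
  forall (D : set (borelV R n)) (h : borelV R n -> \bar R), measurable D ->
  (forall x, D x -> (0 <= h x)%E) -> measurable_fun D h ->
  (\int[L]_(x in D) h x = \sum_(e \in edges Pi) ((weight X e)%:E *
    \int[mu]_(t in (edge_domain e)° `&` (edge_point e @^-1` D))
      (h (edge_point e t) * (derive1n 2 (g e) t)%:E)) +
   \sum_(v \in vertices Pi) (mass X phi v)%:E * (@dirac _ (borelV R n) v R D * h v))%E.
Proof.
have /choice[me meP] : forall e, exists m : {measure set (borelV R n) -> \bar R}, edges Pi e ->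
  (forall A, measurable A -> m A = edge_measure X phi e A) /\
  forall (D : set (borelV R n)) (h : borelV R n -> \bar R), measurable D ->
  (forall x, D x -> (0 <= h x)%E) -> measurable_fun D h ->
  (\int[m]_(x in D) h x = (weight X e)%:E *
    \int[mu]_(t in (edge_domain e)° `&` (edge_point e @^-1` D))
      (h (edge_point e t) * (derive1n 2 (g e) t)%:E))%E.
  move=> e; have [Ee|nEe] := pselect (edges Pi e); last by exists mzero.
  by have [m mP] := edge_measureP Ee; exists m.
pose mv v : {measure set (borelV R n) -> \bar R} :=
  mscale (NngNum (normr_ge0 (mass X phi v))) (@dirac _ (borelV R n) v R).
have [L1 [L1E L1I]] := sum_measure me (finite_edges sPi).
have [L2 [L2E L2I]] := sum_measure mv (finite_vertices sPi).
have mvE v : vertices Pi v -> `|mass X phi v| = mass X phi v.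
  by move=> Pv; rewrite ger0_norm//; exact: (C2_mass_ge0 wPi C2e pc wPi Pv).
exists (measure_add L1 L2); split => [A mA|D h mD h0 mh].
  transitivity (L1 A + L2 A)%E; first exact: measure_addE.
  rewrite /laplacian_on L1E L2E; congr (_ + _)%E; apply: eq_fsbigr => e; rewrite inE => Ee.
    by have [-> ] := meP e Ee.
  transitivity (`|mass X phi e|%:E * @dirac _ (borelV R n) e R A)%E; first exact: erefl.
  by rewrite mvE// -(mass_star phi wPi Ee).
rewrite ge0_integral_measure_add// L1I// L2I//; congr (_ + _)%E.
  by apply: eq_fsbigr => e; rewrite inE => Ee; have [_ ->] := meP e Ee.
apply: eq_fsbigr => v; rewrite inE => Pv.
by rewrite /mv ge0_integral_mscale//= mvE// integral_dirac.
Qed.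

End LaplacianMeasure.

(** * Green's formula for the Laplacian *)

Section IntegralFormula.
Variables (R : realType) (n : nat) (X : balanced_space R n).
Local Notation V := 'rV[R]_n.
Local Notation mu := (@lebesgue_measure R).
Implicit Types (sigma tau S e E : set V) (x y z v u : V) (Pi : set (set V)).

Let oX := bs_one_dim X.

Variables (Pi : set (set V)) (phi : V -> R).
Hypotheses (wPi : weighted_structure X Pi) (C2e : forall e, edges Pi e -> C2_on_edge e phi).
Hypothesis pc : PC X phi.

Let sPi : polyhedral_structure X Pi := wPi.1.
Let cPi := structure_complex sPi.
Let tPi : thin Pi. Proof. exact: structure_thinX sPi. Qed.

Local Notation g := (edge_fun C2e).

(** The interior of the parameter interval corresponds to the points that are not vertices. *)
Lemma edge_domain_interior e t : edges Pi e -> e (edge_point e t) -> ~ Pi [set edge_point e t] ->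
  (edge_domain e)° t.
Proof.
move=> Ee et nP; have Xt : bs_carrier X (edge_point e t) by exact: (structure_sub sPi Ee.1).
have [e' [u [Ee' pu' [eps eps0 epsP] _]]] := germs_interior oX sPi Xt nP.
have e't : e' (edge_point e t).
  by rewrite -[edge_point e t]addr0 -(scale0r u); apply: epsP; rewrite normr0 ltW.
have ee' := edge_through oX sPi Ee Ee' et e't nP; rewrite {}ee' in e't pu' epsP.
have [_ pu] := edge_frameP sPi Ee.
apply/nbhs_ballP; exists eps => //= s; rewrite -ball_normE/= distrC => /ltW st.
rewrite /edge_domain/= (_ : s = t + (s - t)); last by rewrite addrC subrK.
rewrite edge_pointD; have [uE|uE] := primitive_vector_unique cPi tPi Ee pu pu'.
  by rewrite -uE; exact: epsP.
by rewrite -[s - t]opprK scaleNr -scalerN -uE; apply: epsP; rewrite normrN.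
Qed.

Variables (Pic : set (set V)).
Hypotheses (wPic : weighted_structure X Pic) (rPic : rooted Pic) (rf : refines Pic Pi).

Let sPic : polyhedral_structure X Pic := wPic.1.
Let cPic := structure_complex sPic.
Let tPic : thin Pic. Proof. exact: structure_thinX sPic. Qed.

(** The parameters on a large edge of the vertices of a refined structure. *)
Definition break_points E : set R := [set t | Pic [set edge_point E t]].

Lemma finite_break_points E : edges Pi E -> finite_set (break_points E).
Proof.
move=> EE; apply: (@sub_finite_set _ _ ((fun v => get [set t | edge_point E t = v]) @` vertices Pic)).
  by move=> t Pt; exists (edge_point E t) => //; apply: get_unique => //= s /(edge_point_inj sPi EE).
by apply: finite_image; exact: (finite_vertices sPic).
Qed.

Lemma break_points_null E : edges Pi E ->
  measurable (break_points E : set (measurableTypeR R)) /\ mu (break_points E) = 0%E.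
Proof.
move=> EE; have cN : countable (break_points E) by apply: finite_set_countable; exact: finite_break_points.
split; last exact: countable_lebesgue_measure0.
by apply: countable_measurable => // t; exact: measurable_set1.
Qed.

(** The part of a large edge that a refined edge covers, without the vertices: these sets are
    disjoint, and together with the break points they make up the edge. *)
Definition piece E e : set R := if pselect (edges Pic e /\ e `<=` E) then edge_point E @^-1` e `\` break_points E else set0.

Lemma edge_pieces E : edges Pi E ->
  ((edge_domain E)° `&` (edge_point E @^-1` X)) `\` break_points E =
  \big[setU/set0]_(e <- fset_set (edges Pic)) piece E e.
Proof.
move=> EE; rewrite -bigcup_fset_set; last exact: (finite_edges sPic).
apply/seteqP; split => t.
  move=> [[Jt _] nt]; have et := interior_subset Jt.
  have [s Ps st] : Defs.support Pic (edge_point E t).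
    by case: sPic => _ ->; exact: (structure_sub sPi EE.1).
  have Es : edges Pic s.
    have [//|[v sE]] := cell_cases oX sPic Ps.
    by exfalso; apply: nt; rewrite /break_points/=; move: st Ps; rewrite sE => ->.
  have [E' PE' sE'] := rf Ps.
  have EE' : edges Pi E'.
    have [//|[v E'E]] := cell_cases oX sPi PE'.
    have [x [y [sx sy xy]]] := edge_two_points cPic tPic Es.
    have := sE' _ sx; have := sE' _ sy; rewrite E'E /= => yv xv.
    by rewrite xv yv eqxx in xy.
  have nP : ~ Pi [set edge_point E t].
    by move=> h; apply: nt; exact: (refines_vertices sPi sPic rf h).
  have E'E := edge_through oX sPi EE EE' et (sE' _ st) nP.
  by exists s => //; rewrite /piece; case: pselect => // -[]; split; rewrite -?E'E.
move=> [e Ee]; rewrite /piece; case: pselect => // -[_ eE] [et nt]; split => //; split.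
  apply: edge_domain_interior => //; first exact: eE.
  by move=> h; apply: nt; exact: (refines_vertices sPi sPic rf h).
exact: (structure_sub sPic Ee.1).
Qed.

Lemma measurable_piece E e : edges Pi E -> measurable (piece E e : set (measurableTypeR R)).
Proof.
move=> EE; rewrite /piece; case: pselect => [[Ee eE]|h]; last exact: measurable0.
apply: measurableD; last exact: (break_points_null EE).1.
rewrite -[X in measurable X]setTI.
apply: (measurable_to_borel (@edge_point_continuous _ _ E) measurableT).
exact: closed_borel (cell_closed cPic Ee.1).
Qed.

Lemma trivIset_piece E : trivIset (edges Pic) (piece E).
Proof.
move=> e e' Ee Ee' [t []]; rewrite /piece; case: pselect => // -[_ eE] [et nt].
case: pselect => // -[_ e'E] [e't _]; apply/esym; exact: (edge_through oX sPic Ee Ee' et e't nt).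
Qed.

Variable f : V -> R.
Hypotheses (f0 : forall x, bs_carrier X x -> 0 <= f x) (cf : {within X, continuous f})
  (af : forall e, edges Pic e -> affine_cell f e) (rf0 : vanishes_on_rays Pic f).

(** The boundary terms in Green's second identity on the edge. *)
Definition boundary_term e : R :=
  \sum_(v \in edge_vertices Pic e) (slope_at e v f * phi v - slope_at e v phi * f v).

Let F E t : \bar R := ((f (edge_point E t))%:E * (derive1n 2 (g E) t)%:E)%E.

Lemma edge_integral_split E : edges Pi E ->
  (\int[mu]_(t in (edge_domain E)° `&` (edge_point E @^-1` X)) F E t =
   \sum_(e \in edges Pic) \int[mu]_(t in piece E e) F E t)%E.
Proof.
move=> EE; have [mN N0] := break_points_null EE.
have mp := measurable_to_borel (@edge_point_continuous _ _ E).
have mX := closed_borel (structure_closed sPi).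
have mD : measurable ((edge_domain E)° `&` (edge_point E @^-1` X) : set (measurableTypeR R)).
  apply: measurableI; first by apply: open_measurable; exact: open_interior.
  by rewrite -[X in measurable X]setTI; exact: (mp measurableT _ mX).
have mF : measurable_fun ((edge_domain E)° `&` (edge_point E @^-1` X) : set (measurableTypeR R)) (F E).
  apply: emeasurable_funM; last first.
    by apply/measurable_EFinP; apply: measurable_funTS; exact: measurable_second.
  apply/measurable_EFinP.
  apply: (measurable_comp mX) => //; last exact: measurable_funTS.
    by move=> _ [t [_ Xt] <-].
  exact: within_borel (structure_closed sPi) cf.
have F0 t : ((edge_domain E)° `&` (edge_point E @^-1` X)) t -> (0 <= F E t)%E.
  move=> [Jt Xt]; rewrite /F -EFinM lee_fin mulr_ge0 ?f0//.
  exact: (edge_second_derivative_ge0 wPi C2e pc EE Jt).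
rewrite (@ge0_negligible_integral _ _ _ mu _ (break_points E) _ mN mD mF F0 N0) edge_pieces//.
rewrite ge0_integral_bigsetU//.
- by rewrite fsbig_finite//; exact: (finite_edges sPic).
- by move=> e; exact: measurable_piece.
- by rewrite fset_setK; [exact: trivIset_piece|exact: (finite_edges sPic)].
- by rewrite -edge_pieces//; apply: measurable_funS mF => // t [].
- by rewrite -edge_pieces// => t [] /F0.
Qed.

(** In the coordinate of a larger edge a bounded edge is an interval, whose ends carry opposite
    primitive vectors. *)
Lemma segment_frame E e v L : edges Pi E -> e `<=` E -> star Pic v e ->
  is_segment e v (primitive_at e v) L -> exists a b : R, [/\ a < b,
    forall t, e (edge_point E t) <-> a <= t <= b,
    star Pic (edge_point E a) e /\ star Pic (edge_point E b) e,
    forall G : V -> R, \sum_(x \in edge_vertices Pic e) G x = G (edge_point E a) + G (edge_point E b) &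
    primitive_at e (edge_point E a) = (edge_frame E).2 /\
    primitive_at e (edge_point E b) = - (edge_frame E).2].
Proof.
move=> EE eE Se sg; have [L0 eP] := sg; pose u := primitive_at e v.
have [_ puE] := edge_frameP sPi EE; have [Ee _ ev] := (starP cPic _ _).1 Se.
have [Se' uN] := segment_end cPic tPic Se erefl sg.
have sumG := fun G => segment_sum G sPic Se erefl sg.
have [r vE] := edge_point_surj sPi EE (eE _ ev).
have [pu [t0 t00 et0]] := primitive_atP cPic tPic Se.
have pru : prim u := primitive_prim cPic tPic Ee pu.
have puE' : primitive_vector E u.
  apply: (primitive_vector_of tPi EE pru (eE _ ev) (eE _ et0) _ erefl).
  by rewrite gt_eqF.
rewrite -/u in uN Se' sumG eP.
have epE (s t : R) : s *: u = t *: (edge_frame E).2 -> v + s *: u = edge_point E (r + t).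
  by move=> h; rewrite edge_pointD -vE h.
have [uE|uE] := primitive_vector_unique cPi tPi EE puE puE'.
  have vL : v + L *: u = edge_point E (r + L) by apply: epE; rewrite uE.
  exists r, (r + L); split; [by rewrite ltrDl| |by rewrite -vE -vL|by rewrite -vE -vL| ].
    move=> t; rewrite eP; split.
      move=> [s /andP[s0 sL]]; rewrite (epE s s) ?uE// => /(edge_point_inj sPi EE) ->.
      by rewrite lerDl s0 lerD2l.
    move=> /andP[rt tL]; exists (t - r); first by rewrite subr_ge0 rt lerBlDl.
    by rewrite (epE _ (t - r)) ?uE// addrC subrK.
  by rewrite -vE -vL uN -uE.
have vL : v + L *: u = edge_point E (r - L) by apply: epE; rewrite uE scalerN scaleNr.
exists (r - L), r; split; [by rewrite ltrBlDr ltrDl| |by rewrite -vE -vL| |].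
- move=> t; rewrite eP; split.
    move=> [s /andP[s0 sL]]; rewrite (epE s (- s)) ?uE ?scalerN ?scaleNr// => /(edge_point_inj sPi EE) ->.
    by rewrite lerD2l lerN2 sL gerDl oppr_le0.
  move=> /andP[rt tL]; exists (r - t); first by rewrite subr_ge0 tL lerBlDl -lerBlDr.
  by rewrite (epE _ (t - r)) ?uE ?scalerN -?scaleNr ?opprB// addrC subrK.
- by move=> G; rewrite sumG -vE -vL addrC.
- by rewrite -vE -vL uN uE opprK -/u uE.
Qed.

(** Integration by parts against the affine function $f$: the boundary terms of [C2_parts] are
    slopes and values of $f$ and [phi] at the two ends. *)
Lemma segment_integral E e v L : edges Pi E -> e `<=` E -> star Pic v e ->
  is_segment e v (primitive_at e v) L ->
  (\int[mu]_(t in piece E e) F E t = (boundary_term e)%:E)%E.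
Proof.
move=> EE eE Se sg; have [a [b [ab eP [Sa Sb] sumG [pa pb]]]] := segment_frame EE eE Se sg.
have [mN N0] := break_points_null EE; have [Cg gE] := edge_funP C2e EE.
have [Ee Pa ea] := (starP cPic _ _).1 Sa; have [_ Pb eb] := (starP cPic _ _).1 Sb.
have [m [c fE]] := af Ee; pose w := (edge_frame E).2; pose c0 := pairing m (edge_frame E).1 + c.
have fE' t : e (edge_point E t) -> f (edge_point E t) = c0 + pairing m w * t.
  by move=> et; rewrite fE// /edge_point pairingDr pairingZr /c0 /w; ring.
have pieceE : piece E e = `]a, b[%classic `\` break_points E.
  rewrite /piece; case: pselect => [h|[]//] /=; apply/seteqP; split => t /= [et nt]; split => //.
    rewrite in_itv/=; have /andP[at_ tb] := (eP t).1 et; rewrite !lt_neqAle at_ tb !andbT.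
    by apply/andP; split; apply/eqP => h'; apply: nt; rewrite /break_points/= -?h'// h'.
  by apply/eP; move: et; rewrite in_itv/= => /andP[/ltW -> /ltW ->].
have eE' t : a < t < b -> e (edge_point E t).
  by move=> /andP[at_ tb]; apply/eP; rewrite !ltW.
have Jt t : a < t < b -> (edge_domain E)° t.
  move=> tab; apply/nbhs_ballP.
  exists (Num.min (t - a) (b - t)) => /=; first by rewrite lt_min !subr_gt0.
  move=> s; rewrite -ball_normE/= lt_min ltr_distl => /andP[/andP[_ s1]].
  rewrite distrC ltr_distl => /andP[_ s2]; apply: eE; apply: eE'.
  by apply/andP; split; lra.
have GE t : t \in `]a, b[%classic -> F E t = ((c0 + pairing m w * t) * derive1n 2 (g E) t)%:E.
  by rewrite inE/= in_itv/= => tab; rewrite /F fE' ?EFinM//; exact: eE'.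
have mF : measurable_fun (`]a, b[%classic : set (measurableTypeR R)) (F E).
  apply: (eq_measurable_fun (fun t => ((c0 + pairing m w * t) * derive1n 2 (g E) t)%:E)).
    by move=> t tab; rewrite GE.
  apply/measurable_EFinP; apply: measurable_funM.
    by apply: measurable_funTS; apply: continuous_measurable_fun; exact: continuous_affine.
  by apply: measurable_funTS; exact: measurable_second.
rewrite pieceE -(@ge0_negligible_integral _ _ _ mu _ _ _ mN _ mF _ N0)//; last first.
  move=> t /=; rewrite in_itv/= => tab; rewrite /F -EFinM lee_fin mulr_ge0//.
    by apply: f0; apply: (structure_sub sPic Ee.1); exact: eE'.
  exact: (edge_second_derivative_ge0 wPi C2e pc EE (Jt _ tab)).
transitivity (\int[mu]_(t in `]a, b[) ((c0 + pairing m w * t) * derive1n 2 (g E) t)%:E)%E.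
  by apply: eq_integral => t tab; exact: GE.
rewrite C2_parts//; congr EFin.
have sla : slope_at e (edge_point E a) f = pairing m w.
  rewrite /slope_at pa.
  apply: (dirderiv_affine_cell (cell_convex cPic Ee.1) fE ea (t := b - a)); first by rewrite subr_gt0.
  by rewrite -edge_pointD addrC subrK.
have slb : slope_at e (edge_point E b) f = - pairing m w.
  rewrite /slope_at pb -pairingNr.
  apply: (dirderiv_affine_cell (cell_convex cPic Ee.1) fE eb (t := b - a)); first by rewrite subr_gt0.
  by rewrite scalerN -scaleNr -edge_pointD opprB addrC subrK.
have ba0 : 0 < b - a by rewrite subr_gt0.
have sla' : slope_at e (edge_point E a) phi = derive1 (g E) a.
  have := @edge_dirderivE _ _ _ _ _ wPi C2e E a 1 (b - a) EE (eE _ ea) ba0; rewrite scale1r mul1r mul1r.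
  by rewrite /slope_at pa; apply; rewrite addrC subrK; exact: eE.
have slb' : slope_at e (edge_point E b) phi = - derive1 (g E) b.
  have := @edge_dirderivE _ _ _ _ _ wPi C2e E b (-1) (b - a) EE (eE _ eb) ba0; rewrite scaleN1r !mulN1r.
  by rewrite /slope_at pb; apply; rewrite opprB addrC subrK; exact: eE.
rewrite /boundary_term sumG sla slb sla' slb' !fE'// !gE; [ring|exact: eE|exact: eE].
Qed.

Lemma ray_integral E e v : edges Pi E -> e `<=` E -> star Pic v e ->
  is_ray e v (primitive_at e v) ->
  (\int[mu]_(t in piece E e) F E t = (boundary_term e)%:E)%E.
Proof.
move=> EE eE Se ry; have [pu [t t0 et]] := primitive_atP cPic tPic Se.
have [Ee Pv ev] := (starP cPic _ _).1 Se.
have fe x : e x -> f x = 0 by move=> ex; exact: (rf0 Se ry ex).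
rewrite integral0_eq; last first.
  move=> s; rewrite /piece; case: pselect => // h [es _].
  by rewrite /F fe// mul0e.
rewrite /boundary_term (ray_sum _ sPic Se erefl ry) (fe _ ev) mulr0 subr0.
rewrite (_ : slope_at e v f = 0) ?mul0r//.
apply: (dirderiv_affine t0) => s /andP[s0 st]; rewrite mulr0 addr0 (fe _ ev).
by apply: fe; apply/ry; exists s => //; exact: ltW.
Qed.

(** Green's formula for the Laplacian. Summing the boundary terms over all edges gives the sum
    of $m_f(v) \phi(v) - m_\phi(v) f(v)$ over all vertices, where $m$ is the mass; the second part cancels
    the atoms of the Laplacian. *)
Lemma integral_PL (L : {measure set (borelV R n) -> \bar R}) :
  (forall (D : set (borelV R n)) (h : borelV R n -> \bar R), measurable D ->
  (forall x, D x -> (0 <= h x)%E) -> measurable_fun D h ->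
  (\int[L]_(x in D) h x = \sum_(e \in edges Pi) ((weight X e)%:E *
    \int[mu]_(t in (edge_domain e)° `&` (edge_point e @^-1` D))
      (h (edge_point e t) * (derive1n 2 (g e) t)%:E)) +
   \sum_(v \in vertices Pi) (mass X phi v)%:E * (@dirac _ (borelV R n) v R D * h v))%E) ->
  (\int[L]_(x in (bs_carrier X : set (borelV R n))) (f x)%:E =
    (\sum_(v \in vertices Pic) mass X f v * phi v)%:E)%E.
Proof.
move=> ->; last 3 first.
- exact: closed_borel (structure_closed sPi).
- by move=> x Xx; rewrite lee_fin f0.
- by apply/measurable_EFinP; exact: within_borel (structure_closed sPi) cf.
have fEPi := finite_edges sPi; have fEPic := finite_edges sPic.
have -> : (\sum_(v \in vertices Pi) (mass X phi v)%:E * (@dirac _ (borelV R n) v R X * (f v)%:E) =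
    (\sum_(v \in vertices Pi) mass X phi v * f v)%:E)%E.
  rewrite -fsumEFin; last exact: (finite_vertices sPi).
  apply: eq_fsbigr => v; rewrite inE => Pv; rewrite diracE mem_set ?mul1e//.
  exact: (vertex_in sPi Pv).
have pieceI E e : edges Pi E -> edges Pic e ->
    (\int[mu]_(t in piece E e) F E t = (if pselect (e `<=` E) then boundary_term e else 0)%:E)%E.
  move=> EE Ee; case: pselect => eE; last first.
    by rewrite /piece; case: pselect => [[//]|h]; rewrite integral_set0.
  have [v Se] := rPic Ee; have [ry|[r sg]] := edge_shape cPic tPic Se erefl.
    exact: (ray_integral EE eE Se ry).
  exact: (segment_integral EE eE Se sg).
have -> : (\sum_(e \in edges Pi) ((weight X e)%:E *
    \int[mu]_(t in (edge_domain e)° `&` (edge_point e @^-1` X))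
      ((f (edge_point e t))%:E * (derive1n 2 (g e) t)%:E)) =
    (\sum_(e \in edges Pic) weight X e * boundary_term e)%:E)%E.
  transitivity (\sum_(E \in edges Pi) (weight X E *
      \sum_(e \in edges Pic) (if pselect (e `<=` E) then boundary_term e else 0))%:E)%E.
    apply: eq_fsbigr => E; rewrite inE => EE; rewrite [RHS]EFinM; congr (mule _ _).
    rewrite (edge_integral_split EE) -fsumEFin//; apply: eq_fsbigr => e; rewrite inE => Ee.
    exact: pieceI.
  rewrite fsumEFin//; congr EFin.
  transitivity (\sum_(E \in edges Pi) \sum_(e \in edges Pic)
      (if pselect (e `<=` E) then weight X e * boundary_term e else 0)).
    apply: eq_fsbigr => E; rewrite inE => EE.
    rewrite !fsbig_finite// mulr_sumr; apply: eq_big_seq => e; rewrite in_fset_set// inE => Ee.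
    case: pselect => eE; last by rewrite mulr0.
    have [E0 EE0 EE0s] := refined_edge wPi EE.
    by rewrite (weight_parent wPi EE EE0 EE0s) (weight_parent wPic Ee EE0)// => x /eE /EE0s.
  rewrite exchange_fsbig//; apply: eq_fsbigr => e; rewrite inE => Ee.
  have [x [y [ex ey xy]]] := edge_two_points cPic tPic Ee.
  have [E PE eE] := rf Ee.1.
  have EE : edges Pi E.
    by apply/(edgeP cPi tPi); split => //; exists x, y; split => //; exact: eE.
  rewrite -(@fsbig_widen _ _ _ _ [set E]).
  - by rewrite fsbig_set1; case: pselect.
  - by move=> _ ->.
  - move=> E' [EE' nE] /=; case: pselect => // eE'; exfalso; apply: nE.
    exact: (edge_unique cPi tPi EE' EE (eE' _ ex) (eE' _ ey) (eE _ ex) (eE _ ey) xy).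
rewrite -EFinD; congr EFin.
rewrite (mass_sum_refines _ wPi wPic rf (C2_mass_interior wPi C2e)).
rewrite (mass_sum_edges _ _ wPic) (mass_sum_edges _ _ wPic) -(fsbig_split _ _ _ fEPic) /=.
apply: eq_fsbigr => e _; rewrite -mulrDr; congr (_ * _).
have fS : finite_set (edge_vertices Pic e).
  apply: sub_finite_set (finite_vertices sPic) => v /(starP cPic)[_ Pv _]; exact: Pv.
rewrite /boundary_term -(fsbig_split _ _ _ fS) /=; apply: eq_fsbigr => v _; exact: subrK.
Qed.

End IntegralFormula.

(** * Piecewise affine test functions *)

Section TestFunctions.
Variables (R : realType) (n : nat) (X : balanced_space R n).
Local Notation V := 'rV[R]_n.
Implicit Types (sigma tau S e E : set V) (x y z v u : V) (Pi : set (set V)) (f h : V -> R).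

Let oX := bs_one_dim X.

(** The piecewise affine functions of compact support, with a structure that shows this. *)
Definition PL_test Pi h := [/\ weighted_structure X Pi, rooted Pi,
  {within X, continuous h}, forall e, edges Pi e -> affine_cell h e & vanishes_on_rays Pi h].

Lemma compact_support_bound f : compactly_supported X f ->
  exists2 M, 0 < M & forall x, bs_carrier X x -> M <= `|x| -> f x = 0.
Proof.
move=> [_ [K [cK KX fK]]]; have [M [_ MK]] := compact_bounded cK.
exists (Num.max 1 (M + 2)); first by rewrite lt_max ltr01.
move=> x Xx; rewrite ge_max => /andP[_ Mx]; apply: fK => // Kx.
have := MK (M + 1); rewrite ltrDl ltr01 => /(_ isT x Kx) /= xM.
by have := le_trans Mx xM; lra.
Qed.

Lemma edge_ray Pi e v u : polyhedral_structure X Pi -> star Pi v e -> is_ray e v u ->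
  is_ray e v (primitive_at e v).
Proof.
move=> sPi Se ry; have cPi := structure_complex sPi; have tPi := structure_thinX sPi.
have [Ee _ _] := (starP cPi _ _).1 Se.
have [//|[L sg]] := edge_shape cPi tPi Se erefl; exfalso; apply: (ray_not_segment sg ry).
have [x [y [ex ey xy]]] := edge_two_points cPi tPi Ee; apply: contra_neq xy => u0.
by move: ex ey => /ry[s _ ->] /ry[t _ ->]; rewrite u0 !scaler0.
Qed.

Lemma ray_far Pi e v (M : R) : polyhedral_structure X Pi -> star Pi v e ->
  is_ray e v (primitive_at e v) -> exists2 x, e x & M <= `|x|.
Proof.
move=> sPi Se ry; have cPi := structure_complex sPi; have tPi := structure_thinX sPi.
have [Ee _ _] := (starP cPi _ _).1 Se; have [pu _] := primitive_atP cPi tPi Se.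
have u0 : 0 < `|primitive_at e v|.
  by rewrite normr_gt0; apply: prim_neq0; exact: (primitive_prim cPi tPi Ee pu).
have t0 : 0 <= (`|v| + `|M|) / `|primitive_at e v| by rewrite divr_ge0// addr_ge0.
exists (v + (`|v| + `|M|) / `|primitive_at e v| *: primitive_at e v); first by apply/ry; eexists; first exact: t0.
apply: le_trans (ray_norm _ _ t0); rewrite mulfVK ?gt_eqF// addrAC subrr add0r.
exact: ler_norm.
Qed.

(** Interpolating $\max(0, f - \delta)$ at the vertices of a structure on whose cells $f$ varies by at most
    $\delta$. On rays $f \le \delta$, as $f$ vanishes far out; so the truncation makes the interpolation
    vanish there, and keeps it below $f$. *)
Lemma PL_below Pi f (delta : R) : weighted_structure X Pi -> compactly_supported X f ->
  (forall x, bs_carrier X x -> 0 <= f x) -> 0 < delta ->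
  exists Pi' h, [/\ PL_test Pi' h, refines Pi' Pi,
    forall x, bs_carrier X x -> 0 <= h x, forall x, bs_carrier X x -> h x <= f x &
    forall x, bs_carrier X x -> f x - 2 * delta <= h x].
Proof.
move=> [sPi rPi] cf f0 delta0; have [M M0 fM] := compact_support_bound cf.
have tf : tame X Pi f.
  move=> eps eps0; exists M => s x y Ps sx sy Mx My.
  by rewrite !fM// ?subrr ?normr0 ?ltW//; exact: (structure_sub sPi Ps).
have [Pi' [sPi' rf rPi' osc]] := oscillation_structure oX sPi cf.1 tf delta0.
have cPi' := structure_complex sPi'; have tPi' := structure_thinX sPi'.
pose y v := Num.max 0 (f v - delta).
have [h [ch hv ha hray _]] := PL_extension oX sPi' rPi' y (fun=> 0).
have yle s x v : Pi' s -> s x -> s v -> [/\ 0 <= y v, y v <= f x & f x - 2 * delta <= y v].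
  move=> Ps sx sv; have := osc s x v Ps sx sv; rewrite ler_norml => /andP[h1 h2].
  have fx0 : 0 <= f x by apply: f0; exact: (structure_sub sPi' Ps).
  rewrite /y le_max lexx ge_max fx0; split => //=; first by lra.
  by rewrite le_max; apply/orP; right; lra.
have ray0 e v : star Pi' v e -> is_ray e v (primitive_at e v) -> y v = 0.
  move=> Se ry; have [[Ee _] _ ev] := (starP cPi' _ _).1 Se.
  have [x ex Mx] := ray_far M sPi' Se ry.
  have := osc e v x Ee ev ex; rewrite (fM x)//; last exact: (structure_sub sPi' Ee).
  by rewrite subr0 => /ler_normlP[_ fv]; rewrite /y max_l// subr_le0.
have hv0 : vanishes_on_rays Pi' h.
  move=> e v u Se ry x ex; have ry' := edge_ray sPi' Se ry.
  have [t t0 ->] := (ry' x).1 ex.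
  by rewrite hray// (ray0 _ _ Se ry') mulr0 addr0.
have hP x : bs_carrier X x -> [/\ 0 <= h x, h x <= f x & f x - 2 * delta <= h x].
  move=> Xx; have [s Ps sx] : Defs.support Pi' x by case: sPi' => _ ->.
  have [Es|[v sE]] := cell_cases oX sPi' Ps; last first.
    by move: Ps (sx); rewrite sE => Ps /= xv; rewrite xv (hv _ Ps); apply: (yle _ _ _ Ps).
  have [v Se] := rPi' s Es; have [_ Pv ev] := (starP cPi' _ _).1 Se.
  have [ry|[L sg]] := edge_shape cPi' tPi' Se erefl.
    have [t t0 xE] := (ry x).1 sx.
    have -> : h x = y v by rewrite xE hray// mulr0 addr0.
    exact: (yle s x v Ps sx ev).
  have [Se' _] := segment_end cPi' tPi' Se erefl sg; have [L0 sP] := sg.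
  have [_ Pw ew] := (starP cPi' _ _).1 Se'.
  have [t /andP[t0 tL] xE] := (sP x).1 sx.
  have [m [c hE]] := ha s Ps; set w := v + L *: _ in Pw ew.
  have hx : h x = (1 - t / L) * y v + (t / L) * y w.
    rewrite -!hv// !hE// xE /w !pairingDr !pairingZr; field; exact: lt0r_neq0.
  have [a1 a2 a3] := yle s x v Ps sx ev; have [b1 b2 b3] := yle s x w Ps sx ew.
  have q0 : 0 <= t / L by rewrite divr_ge0// ltW.
  have q1 : 0 <= 1 - t / L by rewrite subr_ge0 ler_pdivrMr// mul1r.
  rewrite hx; split; first by rewrite addr_ge0// mulr_ge0.
    have -> : f x = (1 - t / L) * f x + t / L * f x by ring.
    by rewrite lerD// ler_wpM2l.
  have -> : f x - 2 * delta = (1 - t / L) * (f x - 2 * delta) + t / L * (f x - 2 * delta) by ring.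
  by rewrite lerD// ler_wpM2l.
exists Pi', h; split => //; try by move=> x /hP[].
by split => //; [split => //; exact: refines_trans rf rPi|move=> e [Pe _]; exact: ha].
Qed.

(** A ray of the finer structure lies on a ray of the coarser one. *)
Lemma PL_test_refines Pi Pi' h : PL_test Pi h -> weighted_structure X Pi' -> rooted Pi' ->
  refines Pi' Pi -> PL_test Pi' h.
Proof.
move=> [[sPi rPi] roPi ch ah h0] wPi' roPi' rf; have sPi' := wPi'.1.
have cPi := structure_complex sPi; have tPi := structure_thinX sPi.
have cPi' := structure_complex sPi'; have tPi' := structure_thinX sPi'.
have parent e : edges Pi' e -> exists2 E, edges Pi E & e `<=` E.
  move=> Ee; have [E PE eE] := rf _ Ee.1; exists E => //.
  have [x [y [ex ey xy]]] := edge_two_points cPi' tPi' Ee.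
  by apply/(edgeP cPi tPi); split => //; exists x, y; split => //; exact: eE.
split => //.
  by move=> e /parent[E EE eE]; have [m [c hE]] := ah E EE; exists m, c => x /eE; exact: hE.
move=> e v u Se ry x ex; have [Ee _ ev] := (starP cPi' _ _).1 Se.
have [E EE eE] := parent e Ee; have [v0 SE] := roPi E EE.
have [ryE|[L sg]] := edge_shape cPi tPi SE erefl; first exact: (h0 _ _ _ SE ryE _ (eE _ ex)).
have [z ez zM] := ray_far (`|v0| + L * `|primitive_at E v0| + 1) sPi' Se (edge_ray sPi' Se ry).
by have := segment_bounded sg (eE _ ez); move: zM; lra.
Qed.

(** Green's formula on a common refinement moves the mass to the test function. *)
Lemma MA_PA_integral_test psi Pi h : PA X psi -> PL_test Pi h ->
  MA_PA_integral X psi h = \sum_(v \in vertices Pi) mass X h v * psi v.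
Proof.
move=> PApsi th; have [wPi roPi ch ah h0] := th; have sPi := wPi.1.
have [Pj [wj paj ->]] := MA_PA_integralE h PApsi.
have [P1 [w1 r1 r2]] := weighted_refinement wj.1 sPi.
have [P2 [s2 r3 roP2 _]] := fine_structure 0 oX w1.1 ltr01.
have w2 : weighted_structure X P2 by split => //; exact: refines_trans r3 w1.2.
have r2j := refines_trans r3 r1; have r2P := refines_trans r3 r2.
have [_ _ _ ah2 h02] := PL_test_refines th w2 roP2 r2P.
have aj e : edges Pj e -> affine_cell psi e.
  by move=> [Pe _]; have [mc psiE] := paj.2 _ Pe; exact: affine_on_cell psiE.
have aj2 e : edges P2 e -> affine_cell psi e.
  by move=> [Pe _]; have [mc psiE] := (PA_on_refines r2j paj).2 _ Pe; exact: affine_on_cell psiE.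
rewrite (mass_sum_refines h wj w2 r2j); last by move=> x Xx Px; exact: (mass_interior_affine wj Xx Px aj).
rewrite (green_affine w2 roP2 ah2 aj2 h02); apply/esym.
by apply: (mass_sum_refines psi wPi w2 r2P) => x Xx Px; exact: (mass_interior_affine wPi Xx Px ah).
Qed.

(** The measure is positive, by [mass_ge0]. *)
Lemma MA_PA_integral_le psi f h : PAPC X psi -> (forall x, bs_carrier X x -> f x <= h x) ->
  MA_PA_integral X psi f <= MA_PA_integral X psi h.
Proof.
move=> [PApsi PCpsi] fh.
have [Pj [wj [cj aj] _]] := MA_PA_integralE h PApsi.
have := @getPex _ [set Pi | weighted_structure X Pi /\ PA_on X Pi psi] (ex_intro _ Pj (conj wj (conj cj aj))).
rewrite /MA_PA_integral; move: (get _) => Pi [/= wPi paPi]; have sPi := wPi.1.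
rewrite !fsbig_finite; try exact: (finite_vertices sPi).
rewrite big_seq [leRHS]big_seq; apply: ler_sum => v.
rewrite in_fset_set; last exact: (finite_vertices sPi).
rewrite inE => Pv; rewrite ler_wpM2l//; last by apply: fh; exact: (vertex_in sPi Pv).
rewrite (MA_mass_mass wPi paPi Pv); apply: (mass_ge0 PCpsi wPi Pv) => u gu.
have [s Ps [sv [t t0 st]]] := germ_cell sPi gu; have [mc psiE] := paPi.2 _ Ps.
have [m [c psiE']] := affine_on_cell psiE.
have cs := cell_convex (structure_complex sPi) Ps.
rewrite (dirderiv_affine_cell cs psiE' sv t0 st); apply: cvg_near_cst; near=> r.
have r0 : 0 < r by near: r; exact: nbhs_right_gt.
have rt : r < t by near: r; exact: nbhs_right_lt.
have sr : s (v + r *: u).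
  have := cs _ _ (r / t) sv st; rewrite addrAC subrr add0r scalerA mulfVK ?gt_eqF//; apply.
    by rewrite divr_ge0// ltW.
  by rewrite ler_pdivrMr// mul1r ltW.
by rewrite !psiE'// pairingDr pairingZr; field; rewrite gt_eqF.
Unshelve. all: by end_near. Qed.

Lemma MA_PA_integral_linear psi (a : R) f h : PA X psi ->
  MA_PA_integral X psi (fun x => a * f x + h x) = a * MA_PA_integral X psi f + MA_PA_integral X psi h.
Proof.
move=> PApsi; have [Pj [wj paj _]] := MA_PA_integralE h PApsi.
have := @getPex _ [set Pi | weighted_structure X Pi /\ PA_on X Pi psi] (ex_intro _ Pj (conj wj paj)).
rewrite /MA_PA_integral; move: (get _) => Pi [/= wPi paPi].
rewrite !fsbig_finite; try exact: (finite_vertices wPi.1).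
rewrite mulr_sumr -big_split/=; apply: eq_bigr => v _; ring.
Qed.

End TestFunctions.

(** * The weak limit of the Monge-Ampere measures *)

Section WeakLimit.
Variables (R : realType) (n : nat) (X : balanced_space R n).
Local Notation V := 'rV[R]_n.
Implicit Types (sigma tau S e E : set V) (x y z v u : V) (Pi : set (set V)) (f h : V -> R).

Let oX := bs_one_dim X.

Lemma uniform_epsP (Y : set V) (psi : nat -> V -> R) phi : {uniform Y, psi @ \oo --> phi} <->
  forall eps, 0 < eps -> \forall j \near \oo, forall x, Y x -> `|psi j x - phi x| < eps.
Proof.
split=> [h eps eps0|h].
  have : nbhs (phi : {uniform` Y -> R}) [set k | forall x, Y x -> `|k x - phi x| < eps].
    apply/uniform_nbhs; exists [set xy | `|xy.2 - xy.1| < eps]; split => //.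
    rewrite -entourage_ballE; exists eps => // -[a b] /=; by rewrite -ball_normE/= distrC.
  by move/h.
move=> P /uniform_nbhs[E [entE EP]].
move: entE; rewrite -entourage_ballE => -[eps/= eps0 epsE].
apply: filterS (h eps eps0) => j hj; apply: EP => x Yx; apply: epsE.
by rewrite /= -ball_normE/= distrC; exact: hj.
Qed.

(** A uniform way to preserve continuity and compact support under truncations. *)
Definition contraction (k : R -> R) := forall a b, `|k a - k b| <= `|a - b|.

Lemma contraction_continuous (Y : set V) (k : R -> R) f : contraction k ->
  {within Y, continuous f} -> {within Y, continuous (fun x => k (f x))}.
Proof.
move=> kc /within_continuous_normP cf; apply/within_continuous_normP => x e Yx e0.
have [d d0 dP] := cf x e Yx e0; exists d => // y Yy yx.
by apply: le_lt_trans (kc _ _) _; exact: dP.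
Qed.

Lemma contraction_pos : contraction (fun a => Num.max 0 a).
Proof.
move=> a b; rewrite ler_norml /Num.max; have := ler_norm (a - b).
have : - (a - b) <= `|a - b| by rewrite -normrN; exact: ler_norm.
by case: ifP => h1; case: ifP => h2; lra.
Qed.

Lemma contraction_tent (M : R) : contraction (fun a => Num.max 0 (Num.min 2 (M + 2 - a))).
Proof.
move=> a b; apply: le_trans (contraction_pos _ _) _.
have -> : `|a - b| = `|(M + 2 - a) - (M + 2 - b)|.
  by rewrite distrC; congr (`| _ |); ring.
move: (M + 2 - a) (M + 2 - b) => {}a {}b.
rewrite ler_norml /Num.min; have := ler_norm (a - b).
have : - (a - b) <= `|a - b| by rewrite -normrN; exact: ler_norm.
by case: ifP => h1; case: ifP => h2; lra.
Qed.

Lemma compactly_supported_comp (k : R -> R) f : contraction k -> k 0 = 0 ->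
  compactly_supported X f -> compactly_supported X (fun x => k (f x)).
Proof.
move=> kc k0 [cf [K [cK KX fK]]]; split; first exact: contraction_continuous.
by exists K; split => // x Xx Kx; rewrite fK.
Qed.

Lemma bounded_part_compact (M : R) : compact (bs_carrier X `&` [set x | `|x| <= M]).
Proof.
apply: bounded_closed_compact.
  exists M; split; first exact: num_real.
  by move=> a Ma x [_ /= xM]; rewrite (le_trans xM)// ltW.
apply: closedI; first exact: (structure_closed (bs_poly X)).
apply: (@closed_comp _ _ (fun x : V => `|x|) [set a : R | a <= M]); last exact: closed_le.
by move=> x _; exact: norm_continuous.
Qed.

(** A lower approximation of a function that is $2$ on the ball, with error $1$. *)
Lemma cutoff Pi (M : R) : weighted_structure X Pi -> exists Pi' chi, [/\ PL_test X Pi' chi,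
  refines Pi' Pi, forall x, bs_carrier X x -> 0 <= chi x &
  forall x, bs_carrier X x -> `|x| <= M -> 1 <= chi x].
Proof.
move=> wPi; pose c x : R := Num.max 0 (Num.min 2 (M + 2 - `|x|)).
have cc : compactly_supported X c.
  split; first by apply: (contraction_continuous (contraction_tent M)); apply: continuous_subspaceT => x; exact: norm_continuous.
  exists (bs_carrier X `&` [set x | `|x| <= M + 2]); split; first exact: bounded_part_compact.
    by move=> x [].
  move=> x Xx h; rewrite /c max_l// ge_min; apply/orP; right.
  by rewrite subr_le0 leNgt; apply/negP => /ltW xM; apply: h.
have c0 x : bs_carrier X x -> 0 <= c x by rewrite /c le_max lexx.
have h0 : 0 < 2^-1 :> R by rewrite invr_gt0.
have [Pi' [chi [t r chi0 chic chiM]]] := PL_below wPi cc c0 h0.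
exists Pi', chi; split => // x Xx xM; have := chiM x Xx; rewrite /c min_l; last by lra.
by rewrite max_r//; lra.
Qed.

(** The error is a small multiple of a fixed cutoff, a test function: so its integrals along an
    approximating sequence converge and are bounded, independently of the error. *)
Lemma PL_sandwich Pi f : weighted_structure X Pi -> compactly_supported X f ->
  (forall x, bs_carrier X x -> 0 <= f x) -> exists Pi0 chi, [/\ PL_test X Pi0 chi, refines Pi0 Pi,
    forall x, bs_carrier X x -> 0 <= chi x &
    forall eps, 0 < eps -> exists Pi' h, [/\ PL_test X Pi' h, refines Pi' Pi,
      forall x, bs_carrier X x -> 0 <= h x, forall x, bs_carrier X x -> h x <= f x &
      forall x, bs_carrier X x -> f x <= eps * chi x + h x]].
Proof.
move=> wPi cf f0; have [M M0 fM] := compact_support_bound cf.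
have [Pi0 [chi [tchi rchi chi0 chi1]]] := cutoff M wPi.
exists Pi0, chi; split => // eps eps0; have e20 : 0 < eps / 2 by rewrite divr_gt0.
have [Pi' [h [th rh h0 hf fh]]] := PL_below wPi cf f0 e20.
exists Pi', h; split => // x Xx; have [Mx|xM] := leP M `|x|.
  by rewrite fM// addr_ge0 ?h0// mulr_ge0 ?chi0// ltW.
have := chi1 x Xx (ltW xM); have := fh x Xx; rewrite mulrCA divff// mulr1 => h1 h2.
have : eps * 1 <= eps * chi x by rewrite ler_wpM2l// ltW.
by rewrite mulr1 => h3; move: h1 h3; lra.
Qed.

Variables (gamma phi : V -> R) (Pi0 : set (set V)) (L : {measure set (borelV R n) -> \bar R}).
Hypothesis wPi0 : weighted_structure X Pi0.
Hypothesis LE : forall Pi h, PL_test X Pi h -> refines Pi Pi0 ->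
  (forall x, bs_carrier X x -> 0 <= h x) ->
  (\int[L]_(x in (bs_carrier X : set (borelV R n))) (h x)%:E =
    (\sum_(v \in vertices Pi) mass X h v * phi v)%:E)%E.

Local Notation XB := (bs_carrier X : set (borelV R n)).

Let mX : measurable XB. Proof. exact: closed_borel (structure_closed (bs_poly X)). Qed.

Lemma PL_integrable Pi h : PL_test X Pi h -> refines Pi Pi0 ->
  (forall x, bs_carrier X x -> 0 <= h x) -> L.-integrable XB (EFin \o h).
Proof.
move=> th rh h0; apply/integrableP; split.
  by apply/measurable_EFinP; apply: within_borel (structure_closed (bs_poly X)) _; have [] := th.
under eq_integral => x /[!inE] Xx do rewrite /= ger0_norm ?h0//.
by rewrite (LE th rh h0) ltry.
Qed.

Lemma compact_integrable f : compactly_supported X f -> L.-integrable XB (EFin \o f).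
Proof.
move=> cf; have cn : contraction (fun a : R => `|a|) by move=> a b; exact: ler_dist_dist.
have cf' := compactly_supported_comp cn (normr0 _) cf.
have [P1 [chi [tchi rchi chi0 hh]]] := PL_sandwich wPi0 cf' (fun x _ => normr_ge0 _).
have [P2 [h [th rh h0 _ fh]]] := hh 1 ltr01.
have i1 := PL_integrable tchi rchi chi0; have i2 := PL_integrable th rh h0.
apply: (le_integrable mX _ _ (integrableD mX i1 i2)).
  by apply/measurable_EFinP; exact: within_borel (structure_closed (bs_poly X)) cf.1.
move=> x Xx /=; rewrite lee_fin; have := fh x Xx; rewrite mul1r => /le_trans; apply.
exact: ler_norm.
Qed.

Local Notation I f := (Rintegral L XB f).

Lemma I_PL Pi h : PL_test X Pi h -> refines Pi Pi0 -> (forall x, bs_carrier X x -> 0 <= h x) ->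
  I h = \sum_(v \in vertices Pi) mass X h v * phi v.
Proof. by move=> th rh h0; rewrite /Rintegral (LE th rh h0). Qed.

Variables (psi : nat -> V -> R).
Hypothesis ap : approximates X gamma phi psi.

Let PApsi j : PA X (psi j). Proof. by have [h _] := ap; have [[]] := h j. Qed.
Let PAPCpsi j : PAPC X (psi j). Proof. by have [h _] := ap; have [] := h j. Qed.

(** Both sides are the same finite combination of values of $\psi_j$, respectively $\phi$. *)
Lemma weak_limit_PL Pi h : PL_test X Pi h -> refines Pi Pi0 ->
  (forall x, bs_carrier X x -> 0 <= h x) ->
  (fun j => MA_PA_integral X (psi j) h) @ \oo --> I h.
Proof.
move=> th rh h0; rewrite (I_PL th rh h0); have [wPi _ _ _ _] := th.
have fv := finite_vertices wPi.1.
have -> : (fun j => MA_PA_integral X (psi j) h) =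
    (fun j => \sum_(v <- fset_set (vertices Pi)) mass X h v * psi j v).
  by apply/funext => j; rewrite (MA_PA_integral_test (PApsi j) th) fsbig_finite.
rewrite fsbig_finite//=; have [_ /uniform_epsP up] := ap.
rewrite big_seq; under eq_fun do rewrite big_seq.
apply: cvg_big => [|v vP]; first exact: add_continuous.
apply: cvgM; first exact: cvg_cst.
apply/cvgrPdist_lt => eps eps0; apply: filterS (up eps eps0) => j hj.
rewrite distrC; apply: hj; rewrite in_fset_set// inE in vP; exact: vertex_in wPi.1 vP.
Qed.

(** By [PL_sandwich] and positivity both integrals of $f$ lie between those of a test function and
    the same plus a small multiple of those of the cutoff. *)
Lemma weak_limit_ge0 f : compactly_supported X f -> (forall x, bs_carrier X x -> 0 <= f x) ->
  (fun j => MA_PA_integral X (psi j) f) @ \oo --> I f.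
Proof.
move=> cf f0; have [P1 [chi [tchi rchi chi0 hh]]] := PL_sandwich wPi0 cf f0.
have ichi := PL_integrable tchi rchi chi0; have if_ := compact_integrable cf.
have Ichi0 : 0 <= I chi by exact: Rintegral_ge0.
apply/cvgrPdist_lt => eps eps0.
(* So [del] times the integral of [chi] against any measure of the sequence is at most half of
   [eps], once this integral is within $1$ of its limit. *)
pose del := eps / (2 * (I chi + 1)); have del0 : 0 < del.
  by rewrite divr_gt0// mulr_gt0// ltr_wpDl.
have [P2 [h [th rh h0 hf fh]]] := hh del del0; have ih := PL_integrable th rh h0.
have cE : del * (I chi + 1) = eps / 2.
  by rewrite /del; field; rewrite gt_eqF//= ltr_wpDl.
have lo : I h <= I f by apply: le_Rintegral.
have hi : I f <= del * I chi + I h.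
  have iz : L.-integrable XB (EFin \o (fun x => del * chi x)).
    by have := integrableZl mX del ichi.
  have -> : del * I chi + I h = I (fun x => del * chi x + h x).
    by rewrite (RintegralD mX iz ih) RintegralZl.
  by apply: le_Rintegral => //; have := integrableD mX iz ih.
have e2 : 0 < del / 2 by rewrite divr_gt0.
have /cvgrPdist_lt/(_ _ e2) ch := weak_limit_PL th rh h0.
have /cvgrPdist_lt/(_ _ ltr01) cchi := weak_limit_PL tchi rchi chi0.
near=> j.
have h1 : `|I h - MA_PA_integral X (psi j) h| < del / 2 by near: j.
have h2 : `|I chi - MA_PA_integral X (psi j) chi| < 1 by near: j.
have slo := MA_PA_integral_le (PAPCpsi j) hf.
have := MA_PA_integral_le (PAPCpsi j) fh; rewrite (MA_PA_integral_linear _ _ _ (PApsi j)).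
move: slo h1 h2 lo hi cE.
move: (MA_PA_integral _ _ f) (MA_PA_integral _ _ h) (MA_PA_integral _ _ chi) (I h) (I f) (I chi).
move=> A B D E F G s1 /ltr_normlP[a1 a2] /ltr_normlP[b1 b2] s2 s3 cE s4.
have : del * D <= del * (G + 1) by rewrite ler_wpM2l ?ltW//; lra.
have : del * (G + 1) = del * G + del by ring.
by rewrite ltr_norml; lra.
Unshelve. all: by end_near. Qed.

Lemma weak_limit : weak_limit_MA X psi L.
Proof.
move=> f cf; pose fp x := Num.max 0 (f x); pose fm x := Num.max 0 (- f x).
have cfp : compactly_supported X fp.
  by apply: (compactly_supported_comp contraction_pos); rewrite ?maxxx.
have cfm : compactly_supported X fm.
  apply: (@compactly_supported_comp (fun a => Num.max 0 (- a))) => //; last by rewrite oppr0 maxxx.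
  by move=> a b; apply: le_trans (contraction_pos _ _) _; rewrite opprK addrC distrC.
have fE x : f x = -1 * fm x + fp x.
  by rewrite /fm /fp /Num.max; case: ifP => ?; case: ifP => ?; lra.
have -> : f = (fun x => -1 * fm x + fp x) by apply/funext.
have ip := compact_integrable cfp; have im := compact_integrable cfm.
have imz : L.-integrable XB (EFin \o (fun x => -1 * fm x)).
  by have := integrableZl mX (-1) im.
rewrite (RintegralD mX imz ip) RintegralZl//.
under eq_fun do rewrite (MA_PA_integral_linear _ _ _ (PApsi _)).
apply: cvgD; last by apply: weak_limit_ge0 => // x _; rewrite /fp le_max lexx.
by apply: cvgM; [exact: cvg_cst|apply: weak_limit_ge0 => // x _; rewrite /fm le_max lexx].
Qed.

End WeakLimit.

(** * Uniqueness of the limit measure *)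

Section Uniqueness.
Variables (R : realType) (n : nat) (X : balanced_space R n).
Local Notation V := 'rV[R]_n.
Local Notation XB := (bs_carrier X : set (borelV R n)).
Implicit Types (x y z : V) (K : set V).

Definition distance K x : R := inf [set `|x - y| | y in K].

Lemma distance_lbound K x : has_lbound [set `|x - y| | y in K].
Proof. by exists 0 => _ [y _ <-]. Qed.

Lemma distance_contraction K x z : K !=set0 -> `|distance K x - distance K z| <= `|x - z|.
Proof.
move=> [y0 Ky0]; have h a b : distance K a <= distance K b + `|a - b|.
  rewrite -lerBlDr; apply: lb_le_inf; first by exists `|b - y0|, y0.
  move=> _ [y Ky <-]; rewrite lerBlDr.
  apply: le_trans (_ : `|a - y| <= _); first by apply: ge_inf; [exact: distance_lbound|exists y].
  rewrite (_ : a - y = (b - y) + (a - b)); first exact: ler_normD.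
  by rewrite [RHS]addrC addrA subrK.
have h1 := h x z; have h2 := h z x; rewrite (distrC z x) in h2.
by rewrite ler_norml; apply/andP; split; [rewrite lerNl opprB|]; rewrite lerBlDl.
Qed.

Lemma distance_continuous K : K !=set0 -> continuous (distance K).
Proof.
move=> K0; apply/continuousP_eps => x e e0; exists e => // y yx.
by apply: le_lt_trans (distance_contraction _ _ K0) _.
Qed.

Lemma distance0 K x : K x -> distance K x = 0.
Proof.
move=> Kx; apply/eqP; rewrite eq_le; apply/andP; split.
  by apply: ge_inf; [exact: distance_lbound|exists x; rewrite // subrr normr0].
by apply: lb_le_inf; [exists `|x - x|, x|move=> _ [y _ <-]].
Qed.

Lemma distance_gt0 K x : closed K -> K !=set0 -> ~ K x -> 0 < distance K x.
Proof.
move=> cK [y0 Ky0] nK; have oK : open (~` K) by exact: closed_openC.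
have /nbhs_ballP[e /= e0 eP] : nbhs x (~` K) by exact: open_nbhs_nbhs.
apply: lt_le_trans e0 _; apply: lb_le_inf; first by exists `|x - y0|, y0.
move=> _ [y Ky <-]; rewrite leNgt; apply/negP => xy; apply: (eP y) => //.
by rewrite -ball_normE.
Qed.

(** A sequence that decreases to the indicator function of a compact set. *)
Definition bump K (k : nat) x : R := Num.max 0 (1 - k%:R * distance K x).

Lemma bump_continuous K k : K !=set0 -> {within X, continuous (bump K k)}.
Proof.
move=> K0; apply: (@contraction_continuous _ _ _ _ (fun x => 1 - k%:R * distance K x) (@contraction_pos R)).
apply: continuous_subspaceT => x.
apply: (@continuous_comp _ _ _ (distance K) (fun a : R => 1 - k%:R * a)).
  exact: distance_continuous.
by apply: cvgB; [exact: cvg_cst|apply: cvgM; [exact: cvg_cst|exact: cvg_id]].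
Qed.

Lemma bump_le1 K k x : bump K k x <= 1.
Proof.
rewrite /bump ge_max ler01/= gerBl mulr_ge0//.
have [[y Ky]|K0] := pselect (K !=set0); first by apply: lb_le_inf; [exists `|x - y|, y|move=> _ [z _ <-]].
rewrite /distance (_ : [set _ | _ in _] = set0) ?inf0//.
by apply/seteqP; split => // t [y Ky _]; apply: K0; exists y.
Qed.

Lemma bump_ge0 K k x : 0 <= bump K k x. Proof. by rewrite le_max lexx. Qed.

Lemma compact_norm_bound K : compact K -> exists2 M, 0 < M & forall x, K x -> `|x| <= M.
Proof.
move=> cK; have [M [_ MK]] := compact_bounded cK; exists (Num.max 1 (M + 1)).
  by rewrite lt_max ltr01.
by move=> x Kx; rewrite le_max (MK (M + 1) _ x Kx) ?orbT// ltrDl.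
Qed.

Lemma bump_far K k M x : (0 < k)%N -> (forall x, K x -> `|x| <= M) -> K !=set0 ->
  M + 1 <= `|x| -> bump K k x = 0.
Proof.
move=> k0 KM [y0 Ky0] Mx; rewrite /bump max_l// subr_le0.
have d1 : 1 <= distance K x.
  apply: lb_le_inf; first by exists `|x - y0|, y0.
  move=> _ [y Ky <-]; have := KM _ Ky; have : `|x| <= `|x - y| + `|y|.
    by rewrite -{1}[x](subrK y) ler_normD.
  by move: Mx; lra.
by rewrite -[leLHS]mul1r ler_pM// ler1n.
Qed.

Lemma bump_compact K k : (0 < k)%N -> compact K -> K !=set0 -> compactly_supported X (bump K k).
Proof.
move=> k0 cK K0; split; first exact: bump_continuous.
have [M M0 KM] := compact_norm_bound cK.
exists (bs_carrier X `&` [set x | `|x| <= M + 1]); split; first exact: bounded_part_compact.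
  by move=> x [].
move=> x Xx h; apply: (bump_far k0 KM K0); rewrite leNgt; apply/negP => /ltW xM.
by apply: h.
Qed.

Lemma radon_restrict (mu : {measure set (borelV R n) -> \bar R}) (A : set (borelV R n)) :
  radon_on X mu -> measurable A -> mu A = mu (A `&` XB).
Proof.
move=> [muX _] mA; have mX := closed_borel (structure_closed (bs_poly X)).
have mAX : measurable (A `&` XB) by exact: measurableI.
have mAX' : measurable (A `&` ~` XB) by apply: measurableI => //; exact: measurableC.
have z : mu (A `&` ~` XB) = 0%E.
  apply/eqP; rewrite eq_le measure_ge0 andbT -muX.
  by apply: le_measure; rewrite ?inE//; exact: measurableC.
have disj : A `&` XB `&` (A `&` ~` XB) = set0 by rewrite setIACA setICr setI0.
have h : mu A = (mu (A `&` XB) + mu (A `&` ~` XB))%E.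
  by rewrite -[in LHS](setIT A) -(setUv XB) setIUr; exact: measureU.
by rewrite h z adde0.
Qed.

(** Dominated convergence; all bumps are supported in a fixed ball. *)
Lemma bump_limit (mu : {measure set (borelV R n) -> \bar R}) K : radon_on X mu -> compact K ->
  K !=set0 ->
  (\int[mu]_(x in XB) (bump K k.+1 x)%:E @[k --> \oo] --> mu (K : set (borelV R n)))%E /\
  forall k, mu.-integrable XB (EFin \o bump K k.+1).
Proof.
move=> rmu cK K0; have [_ muf] := rmu; have [M M0 KM] := compact_norm_bound cK.
have mX := closed_borel (structure_closed (bs_poly X)).
have cKK : closed K by apply: compact_closed => //; exact: norm_hausdorff.
have mK := closed_borel cKK.
pose B : set (borelV R n) := bs_carrier X `&` [set x | `|x| <= M + 1].
have cB : compact (B : set V) by exact: bounded_part_compact.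
have mB : measurable B by apply: closed_borel; apply: compact_closed => //; exact: norm_hausdorff.
have iB : mu.-integrable XB (EFin \o (\1_B : borelV R n -> R)).
  apply/integrableP; split; first by apply/measurable_EFinP; exact: measurable_indic.
  under eq_integral do rewrite /= ger0_norm//.
  rewrite integral_indic// (le_lt_trans _ (muf _ cB _))//; last by move=> x [].
  by apply: le_measure; rewrite ?inE//; exact: measurableI.
have bB k x : bs_carrier X x -> bump K k.+1 x <= \1_B x.
  move=> Xx; have [xM|xM] := leP `|x| (M + 1).
    by rewrite indicE mem_set; [exact: bump_le1|split].
  by rewrite (bump_far _ KM K0 (ltW xM)).
have mb k : measurable_fun XB (EFin \o (bump K k.+1 : borelV R n -> R)).
  by apply/measurable_EFinP; exact: (within_borel (structure_closed (bs_poly X)) (@bump_continuous _ k.+1 K0)).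
have ib k : mu.-integrable XB (EFin \o bump K k.+1).
  apply: (le_integrable mX (mb k) _ iB) => x Xx; rewrite /= lee_fin !ger0_norm ?bump_ge0//.
  exact: bB.
split => //; rewrite (radon_restrict rmu mK) -(integral_indic mu mX mK).
apply: (@dominated_cvg _ _ _ mu XB mX (fun k x => (bump K k.+1 x)%:E) (fun x => (\1_K x)%:E)
  (fun x => (\1_B x)%:E)) => //.
- move=> x Xx; apply: cvg_near_cst; near=> k; congr EFin.
  have [Kx|nK] := pselect (K x).
    by rewrite /bump distance0// mulr0 subr0 max_r// indicE mem_set.
  rewrite /bump max_l ?indicE ?memNset// subr_le0.
  have d0 := distance_gt0 cKK K0 nK.
  rewrite -ler_pdivrMr// mul1r; apply: le_trans (_ : k%:R <= _); last by rewrite ler_nat.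
  near: k; exact: nbhs_infty_ger.
- by move=> k x Xx; rewrite /= lee_fin ger0_norm ?bump_ge0//; exact: bB.
Unshelve. all: by end_near. Qed.

(** Both measures agree on compact sets, as limits of the integrals of the bumps. Compact sets are
    stable under intersection, generate the Borel sets, and exhaust the space. *)
Lemma radon_unique (mu1 mu2 : {measure set (borelV R n) -> \bar R}) :
  radon_on X mu1 -> radon_on X mu2 ->
  (forall f, compactly_supported X f -> Rintegral mu1 XB f = Rintegral mu2 XB f) ->
  forall A, measurable A -> mu1 A = mu2 A.
Proof.
move=> r1 r2 E A mA; pose G : set (set (borelV R n)) := [set K | compact (K : set V)].
pose g (k : nat) : set (borelV R n) := [set x : V | `|x| <= k%:R].
have closed_ball (M : R) : closed [set x : V | `|x| <= M].
  apply: (@closed_comp _ _ (fun x : V => `|x|) [set a : R | a <= M]); last exact: closed_le.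
  by move=> x _; exact: norm_continuous.
have Gg k : G (g k).
  apply: bounded_closed_compact; last exact: closed_ball.
  exists k%:R; split; first exact: num_real.
  by move=> a ka x /= xk; rewrite (le_trans xk)// ltW.
have compact_closed' (K : set V) : compact K -> closed K.
  by move=> cK; apply: compact_closed => //; exact: norm_hausdorff.
have cover : \bigcup_k g k = setT.
  apply/seteqP; split => // x _; exists (Num.bound `|x|) => //=; apply: ltW.
  exact: archi_boundP.
apply: (measure_unique G g) => //.
- apply/seteqP; split => B.
    apply: smallest_sub; first exact: smallest_sigma_algebra.
    move=> U oU; have cU : closed (~` U) by exact: open_closedC.
    have -> : U = ~` \bigcup_k (~` U `&` g k).
      by rewrite -setI_bigcupr cover setIT setCK.
    apply: (@measurableC _ (g_sigma_algebraType G)); apply: bigcupT_measurable => k.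
    apply: sub_sigma_algebra; rewrite setIC; apply: compact_closedI => //; exact: Gg.
  apply: smallest_sub; first exact: sigma_algebra_measurable.
  by move=> K cK; apply: closed_borel; exact: compact_closed'.
- by move=> K1 K2 c1 c2; apply: compact_closedI => //; exact: compact_closed'.
- move=> K cK; have [K0|K0] := pselect (K !=set0); last first.
    have -> : K = set0 by apply/seteqP; split => // x Kx; apply: K0; exists x.
    by rewrite !measure0.
  have [l1 i1] := bump_limit r1 cK K0; have [l2 i2] := bump_limit r2 cK K0.
  rewrite -(cvg_lim _ l1)// -(cvg_lim _ l2)//; congr (limn _); apply/funext => k.
  have := E _ (bump_compact (ltn0Sn k) cK K0).
  rewrite /Rintegral => h.
  have mX := closed_borel (structure_closed (bs_poly X)).
  rewrite -[LHS]fineK; last exact: (integrable_fin_num mX (i1 k)).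
  by rewrite -[RHS]fineK ?h//; exact: (integrable_fin_num mX (i2 k)).
- move=> k; rewrite (radon_restrict r1); last exact: (closed_borel (closed_ball _)).
  have [_ muf] := r1; apply: muf; last by move=> x [].
  by rewrite setIC; exact: bounded_part_compact.
Qed.

End Uniqueness.

(** * The Laplacian is the Monge-Ampere measure *)

Section Main.
Variables (R : realType) (n : nat) (X : balanced_space R n).
Local Notation V := 'rV[R]_n.
Local Notation XB := (bs_carrier X : set (borelV R n)).

Let oX := bs_one_dim X.

Lemma within_continuousB (Y : set V) (f h : V -> R) : {within Y, continuous f} ->
  {within Y, continuous h} -> {within Y, continuous (fun x => f x - h x)}.
Proof. by move=> cf ch x; apply: cvgB; [exact: cf|exact: ch]. Qed.

(** A structure on which [phi - gamma] varies little on cells exists because this difference has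
    limits on the rays. *)
Lemma exists_approximation (gamma phi : V -> R) : PAPC X gamma -> PC_growth X gamma phi ->
  exists psi, approximates X gamma phi psi.
Proof.
move=> [[Pi sPi pag] _] [pcf [C fgC]].
have [Pi1 [s1 r1 ro1 _]] := fine_structure 0 oX sPi (@ltr01 R).
have pag1 := PA_on_refines r1 pag.
have ag e : edges Pi1 e -> affine_cell gamma e.
  by move=> [Pe _]; have [mc gE] := pag1.2 _ Pe; exact: affine_on_cell gE.
have tm := growth_tame oX pcf s1 ro1 ag fgC.
have cfg := within_continuousB pcf.1 pag.1.
have main eps : 0 < eps -> exists psi : V -> R,
    PAPC_growth X gamma psi /\ forall x, bs_carrier X x -> `|psi x - phi x| <= 2 * eps.
  move=> eps0; have [Pi2 [s2 r2 ro2 osc]] := oscillation_structure oX s1 cfg tm eps0.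
  exact: (PAPC_approximation oX s2 ro2 (PA_on_refines r2 pag1) pcf fgC eps0 osc).
have /choice[psi psiP] : forall j : nat, exists psi : V -> R,
    PAPC_growth X gamma psi /\ forall x, bs_carrier X x -> `|psi x - phi x| <= 2 * j.+1%:R^-1.
  by move=> j; apply: main; rewrite invr_gt0 ltr0n.
exists psi; split; first by move=> j; have [] := psiP j.
apply/uniform_epsP => eps eps0; near=> j => x Xx; have [_ /(_ x Xx)] := psiP j.
move/le_lt_trans; apply; rewrite -ltr_pdivlMl// -[ltRHS]invrK ltf_pV2 ?posrE ?ltr0n//; last first.
  by rewrite invr_gt0 mulr_gt0 ?invr_gt0.
apply: lt_le_trans (_ : j%:R <= _); last by rewrite ler_nat.
near: j; exact: nbhs_infty_gtr.
Unshelve. all: by end_near. Qed.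

Lemma laplacian_is_MA_poly (gamma phi : V -> R) : PAPC X gamma -> PC_growth X gamma phi ->
  PS X phi -> exists L : {measure set (borelV R n) -> \bar R},
  is_MA_poly X gamma phi L /\ forall A, measurable A -> L A = laplacian X phi A.
Proof.
move=> pg pf /laplacianE[Pi [wPi C2e lapE]]; have [pc _] := pf.
have [L [L1 L2]] := laplacian_measure wPi C2e pc.
have cX := structure_closed (bs_poly X); have mX := closed_borel cX.
have LE Pi' h : PL_test X Pi' h -> refines Pi' Pi -> (forall x, bs_carrier X x -> 0 <= h x) ->
  (\int[L]_(x in XB) (h x)%:E = (\sum_(v \in vertices Pi') mass X h v * phi v)%:E)%E.
  by move=> [w' ro' ch ah hr] rf h0; exact: (integral_PL wPi pc w' ro' rf h0 ch ah hr L2).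
exists L; split; last by move=> A mA; rewrite L1// lapE.
split; last 2 first.
- exact: exists_approximation.
- by move=> psi ap; exact: (weak_limit wPi LE ap).
split.
  rewrite L1; last exact: measurableC.
  rewrite /laplacian_on !fsbig1 ?adde0// => [v Pv|e Ee].
    by rewrite diracE memNset ?mule0// => /(_ (vertex_in wPi.1 Pv)).
  rewrite /edge_measure (_ : _ `&` _ = set0) ?integral_set0 ?mule0//.
  apply/seteqP; split => // t [Jt]; apply; apply: (structure_sub wPi.1 Ee.1).
  exact: interior_subset Jt.
move=> K cK KX; have [M M0 KM] := compact_norm_bound cK.
have [Pi' [chi [tchi rchi chi0 chi1]]] := cutoff M wPi.
have mK : measurable (K : set (borelV R n)).
  by apply: closed_borel; apply: compact_closed => //; exact: norm_hausdorff.
apply: le_lt_trans (_ : \int[L]_(x in XB) (chi x)%:E < +oo)%E; last by rewrite (LE _ _ tchi rchi chi0) ltry.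
rewrite -(setIidl KX) -(integral_indic L mX mK); apply: ge0_le_integral => //.
- by apply/measurable_EFinP; exact: measurable_indic.
- by apply/measurable_EFinP; apply: within_borel cX _; have [] := tchi.
- move=> x Xx; rewrite lee_fin indicE; case: (boolP (x \in _)) => [|_]; last exact: chi0.
  by rewrite inE => Kx; apply: chi1 => //; exact: KM.
Qed.

End Main.

Theorem proposition6p17 (R : realType) (n : nat) (X : balanced_space R n)
    (gamma : 'rV[R]_n -> R)
    (gamma_PAPC : PAPC X gamma) (gamma_pos : positive_at_infinity X gamma)
    (phi : 'rV[R]_n -> R)
    (phi_PC : PC_growth X gamma phi) (phi_PS : PS X phi)
    (A : set (borelV R n)) (mA : measurable A) :
  MA_poly X gamma phi A = laplacian X phi A.
Proof.
have [L [LMA LE]] := laplacian_is_MA_poly gamma_PAPC phi_PC phi_PS.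
rewrite -LE// /MA_poly; case: pselect => [h|[]]; last by exists L.
case: cid => mu /= [rmu [psi ap] wl]; have [rL _ wL] := LMA.
apply: (radon_unique rmu rL) => // f cf.
exact: (cvg_unique _ (wl psi ap f cf) (wL psi ap f cf)).
Qed.
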